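(* Let $(a,b,c)$ be integers with $abc\neq 0$ and $\gcd(a,b,c)=1$ satisfying $a^{13}+b^{13}=3c^7$. Then $13 \mid a+b$ and $4 \mid a+b$. *)

(* Defs.v *)
From mathcomp Require Export all_boot all_order all_algebra.

(* Main.v *)
Require Import Defs.
From Stdlib Require Import ZArith Znumtheory.
From HB Require Import structures.
From mathcomp Require Import all_boot all_order all_algebra all_field.
From mathcomp Require Import ssrZ zify ring.

Set Implicit Arguments.
Unset Strict Implicit.
Unset Printing Implicit Defensive.

Import Order.TTheory GRing.Theory Num.Theory.
Local Open Scope ring_scope.

(** In the ring [O6] of integers of the real subfield of Q(zeta_13), put
    [kap = 2 - theta] (of norm 13), [S = (a + b) ^ 2] and [P = a b]. Then
    [g = S - kap P] has norm [(a ^ 13 + b ^ 13) / (a + b)], so either [a + b = 3 u ^ 7]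
    and [nm g] is a seventh power, or 13 divides [a + b], [13 (a + b) = 3 u ^ 7] and
    [nm (g / kap)] is a seventh power. Since ideals contain elements of small norm,
    [g] (or [g / kap]) is a unit times a seventh power.

    Two characters of order 7, one modulo 2 and one modulo 49, agree on the units and
    on [kap], hence on [g]. Running over the residues of [a] and [b] modulo 49, this
    forces [a + b] to be even when 13 divides it, whence [u] is even and 4 divides
    [a + b]; and it forces 7 to divide [u] when 13 does not divide [a + b].

    In that last case [g] is congruent to [- kap P] modulo 49, and Kummer's lemma gives
    [g kap ^ 6 / 13 = beta ^ 7]. Eliminating [P] between [g] and its conjugate yields
    [X ^ 7 - Y ^ 7 = 9 u ^ 14 E] with [E] a unit and [X = 4 Y] modulo [kap]. Over
    [Q(sqrt (-7))] the cofactor of [X - Y] splits in two comaximal factors; the norm of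
    one of them to the principal ring [Z[(-1 + sqrt (-7)) / 2]] is a seventh power, up
    to a factor [sqrt (-7)] and a unit, which is impossible modulo 13. *)

(** * Divisibility and comaximality in commutative rings *)

(** No class group is computed. If [nm g = v ^ 7], then [(v, g)] behaves like an ideal of norm [|v|]
    whose seventh power is [(g)]; a lattice bound gives it an element whose norm is less than 25
    times [|v|], and residue degrees of small primes make this element a generator up to [kap]. No
    fundamental units are computed either: a pigeonhole argument bounds the rank of the units by 5,
    and independence of five logarithms modulo 7 shows that five conjugates of [theta] generate the
    units modulo seventh powers. The obstacle is the case where 7 divides [u] and 13 does not divide
    [a + b]. There the logarithm of [g] is that of [kap] up to an integer, for all [a] and [b], and
    this is compatible with [a + b] even: no condition modulo 2 and 49 excludes it. The same fact is
    what makes Kummer's lemma applicable and a second descent possible. That descent lives in a ring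
    of rank 12 over [Z], of unknown class group, which is why only norms down to a Euclidean ring
    are shown to be seventh powers. *)

Section Divisibility.
Variable R : comNzRingType.
Implicit Types n x y z p q : R.

Definition divides x y := exists z, y = x * z.
Definition eqmod n x y := divides n (x - y).
Definition comax x y := exists p q, p * x + q * y = 1.

Lemma divides_refl x : divides x x.
Proof. by exists 1; rewrite mulr1. Qed.

Lemma divides_trans y x z : divides x y -> divides y z -> divides x z.
Proof. by case=> u -> [v ->]; exists (u * v); rewrite mulrA. Qed.

Lemma divides_mulr x y z : divides x y -> divides x (y * z).
Proof. by case=> u ->; exists (u * z); rewrite mulrA. Qed.

Lemma divides_mull x y z : divides x y -> divides x (z * y).
Proof. by rewrite mulrC; apply: divides_mulr. Qed.

Lemma divides_add x y z : divides x y -> divides x z -> divides x (y + z).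
Proof. by case=> u -> [v ->]; exists (u + v); rewrite mulrDr. Qed.

Lemma divides_opp x y : divides x y -> divides x (- y).
Proof. by case=> u ->; exists (- u); rewrite mulrN. Qed.

Lemma divides_mul x1 x2 y1 y2 :
  divides x1 y1 -> divides x2 y2 -> divides (x1 * x2) (y1 * y2).
Proof. by case=> u -> [v ->]; exists (u * v); ring. Qed.

Lemma divides_exp k x y : divides x y -> divides (x ^+ k) (y ^+ k).
Proof. by case=> u ->; exists (u ^+ k); rewrite exprMn. Qed.

Lemma divides_expS k x y : divides x y -> (0 < k)%N -> divides x (y ^+ k).
Proof. by case: k => // k dxy _; rewrite exprS; apply: divides_mulr. Qed.

Lemma divides_exp_leq j k x : (j <= k)%N -> divides (x ^+ j) (x ^+ k).
Proof. by move=> jk; exists (x ^+ (k - j)); rewrite -exprD subnKC. Qed.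

Lemma eqmod_refl n x : eqmod n x x.
Proof. by exists 0; rewrite subrr mulr0. Qed.

Lemma eqmod_sym n x y : eqmod n x y -> eqmod n y x.
Proof. by case=> z e; exists (- z); rewrite mulrN -e opprB. Qed.

Lemma eqmod_trans y n x z : eqmod n x y -> eqmod n y z -> eqmod n x z.
Proof. by case=> u e [v f]; exists (u + v); rewrite mulrDr -e -f; ring. Qed.

Lemma eqmodD n x y z t : eqmod n x y -> eqmod n z t -> eqmod n (x + z) (y + t).
Proof. by case=> u e [v f]; exists (u + v); rewrite mulrDr -e -f; ring. Qed.

Lemma eqmodM n x y z t : eqmod n x y -> eqmod n z t -> eqmod n (x * z) (y * t).
Proof.
case=> u e [v f]; exists (u * z + y * v).
transitivity ((x - y) * z + y * (z - t)); first by ring.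
by rewrite e f; ring.
Qed.

Lemma eqmodX n k x y : eqmod n x y -> eqmod n (x ^+ k) (y ^+ k).
Proof.
move=> e; elim: k => [|k IH]; first exact: eqmod_refl.
by rewrite !exprS; apply: eqmodM.
Qed.

Lemma eqmod_divides n x y : eqmod n x y -> divides n y -> divides n x.
Proof. by case=> u e [v f]; exists (u + v); rewrite mulrDr -e -f; ring. Qed.

Lemma eqmod_weak m n x y : divides m n -> eqmod n x y -> eqmod m x y.
Proof. exact: divides_trans. Qed.

Lemma comax_sym x y : comax x y -> comax y x.
Proof. by case=> p [q e]; exists q, p; rewrite addrC. Qed.

Lemma comaxM x y z : comax x y -> comax x z -> comax x (y * z).
Proof.
case=> p [q e] [r [s f]]; exists (p * (r * x + s * z) + q * y * r), (q * s).
by rewrite -[RHS]mulr1 -{1}e -f; ring.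
Qed.

Lemma comax1 x : comax x 1.
Proof. by exists 0, 1; rewrite mul0r mul1r add0r. Qed.

Lemma comaxX k x y : comax x y -> comax x (y ^+ k).
Proof.
move=> c; elim: k => [|k IH]; first exact: comax1.
by rewrite exprS; apply: comaxM.
Qed.

Lemma comax_divides x y z : divides z y -> comax x y -> comax x z.
Proof. by case=> u -> [p [q e]]; exists p, (q * u); rewrite -e; ring. Qed.

Lemma comax_eqmod n x y : eqmod n x y -> comax n y -> comax n x.
Proof. by case=> u e [p [q f]]; exists (p - q * u), q; rewrite -f; rewrite -(subrK y x) e;
  ring. Qed.

Lemma comax_Gauss x y z : comax x y -> divides x (y * z) -> divides x z.
Proof.
case=> p [q e] [u f]; exists (p * z + q * u).
by rewrite mulrDr [x * (q * u)]mulrCA -f -[LHS]mul1r -e; ring.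
Qed.

Lemma comax_unit x y : divides x 1 -> comax x y.
Proof. by case=> z e; exists z, 0; rewrite mul0r addr0 mulrC. Qed.

Lemma divides_prime_binom (p : nat) x y : prime p ->
  eqmod p%:R ((x + y) ^+ p) (x ^+ p + y ^+ p).
Proof.
case: p => // p pp; rewrite exprDn big_ord_recl big_ord_recr /=.
rewrite subn0 expr0 mulr1 bin0 mulr1n /bump /= subnn expr0 mul1r add1n binn mulr1n.
set s := \sum_(i < _) _.
have [z ->] : divides p.+1%:R s.
  apply: (big_ind (fun z => divides p.+1%:R z)) => [|u v|i _].
  - by exists 0; rewrite mulr0.
  - exact: divides_add.
  have: (p.+1 %| 'C(p.+1, bump 0 i))%N.
    by apply: prime_dvd_bin => //; rewrite /bump /= add1n ltnS ltn_ord.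
  case/dvdnP=> k ->; set m := _ * _ ^+ _.
  by exists (m *+ k); rewrite mulrnA mulr_natl.
by exists z; ring.
Qed.

End Divisibility.

(** As [d] generates [(x, z)], its power [d ^ k] generates [(x)]: modulo [x] it is a multiple of
    [z ^ k = x y], and conversely it divides [x y] while being comaximal with [y], because [d]
    divides [x]. *)
Lemma comax_mul_pow (R : comNzRingType) (k : nat) (x y z d p q : R) :
    divides d x -> divides d z -> d = p * x + q * z ->
    comax x y -> x * y = z ^+ k -> GRing.lreg x ->
  exists e, x = e * d ^+ k /\ divides e 1.
Proof.
move=> [x' ex] [z' ez] ed cxy exy regx.
have [u eu] : divides x (d ^+ k).
  have: eqmod x (d ^+ k) ((q * z) ^+ k).
    by apply: eqmodX; exists p; rewrite ed; ring.
  case=> v ev; exists (v + q ^+ k * y).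
  by move/eqP: ev; rewrite subr_eq => /eqP ->; rewrite exprMn -exy; ring.
have [v ev] : divides (d ^+ k) x.
  apply: (@comax_Gauss _ _ y).
    case: k {exy eu} => [|k]; first by apply/comax_sym/comax1.
    apply: comax_sym; apply: comaxX; apply: comax_sym.
    by case: cxy => a [b e]; exists (a * x'), b; rewrite -e ex; ring.
  by rewrite mulrC exy ez exprMn; exists (z' ^+ k).
exists v; split; first by rewrite mulrC.
exists u; apply: regx.
by rewrite mulr1 mulrCA -eu mulrC.
Qed.

(** * The ring of integers of the maximal real subfield of Q(zeta_13) *)

(* [MkO x0 .. x5] stands for [\sum_i x_i theta_(2 ^ i)] where
   [theta_j = zeta ^ j + zeta ^ - j].  The [theta_(2 ^ i)] form a normal
   integral basis with sum [-1], and
   [theta_i theta_j = theta_(i + j) + theta_(i - j)] with [theta_0 = 2]. *)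
Record O6 := MkO { x0_ : Z; x1_ : Z; x2_ : Z; x3_ : Z; x4_ : Z; x5_ : Z }.

Definition O6_seq x := (x0_ x, x1_ x, x2_ x, x3_ x, x4_ x, x5_ x).
Definition seq_O6 t :=
  let: (y0, y1, y2, y3, y4, y5) := t in MkO y0 y1 y2 y3 y4 y5.
Lemma O6_seqK : cancel O6_seq seq_O6. Proof. by case. Qed.
HB.instance Definition _ := Countable.copy O6 (can_type O6_seqK).

Section RawOperations.
Local Open Scope Z_scope.

Definition cst (n : Z) : O6 := MkO (- n) (- n) (- n) (- n) (- n) (- n).

Definition addO (x y : O6) : O6 :=
  let: MkO x0 x1 x2 x3 x4 x5 := x in let: MkO y0 y1 y2 y3 y4 y5 := y in
  MkO (x0 + y0) (x1 + y1) (x2 + y2) (x3 + y3) (x4 + y4) (x5 + y5).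

Definition oppO (x : O6) : O6 :=
  let: MkO x0 x1 x2 x3 x4 x5 := x in
  MkO (- x0) (- x1) (- x2) (- x3) (- x4) (- x5).

Definition mulO (x y : O6) : O6 :=
  let: MkO x0 x1 x2 x3 x4 x5 := x in let: MkO y0 y1 y2 y3 y4 y5 := y in
  let d := x0 * y0 + x1 * y1 + x2 * y2 + x3 * y3 + x4 * y4 + x5 * y5 in
  MkO
    (x0 * y1 + x1 * y0 + x1 * y4 + x2 * y3 + x2 * y4 + x3 * y2 + x3 * y5 + x4 * y1 + x4 * y2 +
      x5 * y3 + x5 * y5 - (d + d))
    (x0 * y0 + x0 * y4 + x1 * y2 + x2 * y1 + x2 * y5 + x3 * y4 + x3 * y5 + x4 * y0 + x4 * y3 +
      x5 * y2 + x5 * y3 - (d + d))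
    (x0 * y3 + x0 * y4 + x1 * y1 + x1 * y5 + x2 * y3 + x3 * y0 + x3 * y2 + x4 * y0 + x4 * y5 +
      x5 * y1 + x5 * y4 - (d + d))
    (x0 * y2 + x0 * y5 + x1 * y4 + x1 * y5 + x2 * y0 + x2 * y2 + x3 * y4 + x4 * y1 + x4 * y3 +
      x5 * y0 + x5 * y1 - (d + d))
    (x0 * y1 + x0 * y2 + x1 * y0 + x1 * y3 + x2 * y0 + x2 * y5 + x3 * y1 + x3 * y3 + x4 * y5 +
      x5 * y2 + x5 * y4 - (d + d))
    (x0 * y3 + x0 * y5 + x1 * y2 + x1 * y3 + x2 * y1 + x2 * y4 + x3 * y0 + x3 * y1 + x4 * y2 +
      x4 * y4 + x5 * y0 - (d + d)).

(** The automorphism induced by [zeta -> zeta ^ 2], a generator of the Galois group, which is cyclic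
    of order 6. Ordering the basis by powers of 2 turns it into a shift. *)
Definition sg (x : O6) : O6 :=
  let: MkO x0 x1 x2 x3 x4 x5 := x in MkO x5 x0 x1 x2 x3 x4.

Ltac O6_ring :=
  repeat (let x := fresh in intro x; destruct x as [? ? ? ? ? ?]);
  unfold addO, oppO, mulO, sg, cst; cbv zeta; f_equal; ring.

Lemma addOA : associative addO. Proof. O6_ring. Qed.
Lemma addOC : commutative addO. Proof. O6_ring. Qed.
Lemma add0O : left_id (cst 0) addO. Proof. O6_ring. Qed.
Lemma addNO : left_inverse (cst 0) oppO addO. Proof. O6_ring. Qed.
Lemma mulOA : associative mulO. Proof. O6_ring. Qed.
Lemma mulOC : commutative mulO. Proof. O6_ring. Qed.
Lemma mul1O : left_id (cst 1) mulO. Proof. O6_ring. Qed.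
Lemma mulODl : left_distributive mulO addO. Proof. O6_ring. Qed.
Lemma oneO_neq0 : cst 1 != cst 0. Proof. by []. Qed.
Lemma sgB x y : sg (addO x (oppO y)) = addO (sg x) (oppO (sg y)).
Proof. revert x y; O6_ring. Qed.
Lemma sgM x y : sg (mulO x y) = mulO (sg x) (sg y).
Proof. revert x y; O6_ring. Qed.
Lemma cstB m n : cst (m - n) = addO (cst m) (oppO (cst n)).
Proof. O6_ring. Qed.
Lemma cstM m n : cst (m * n) = mulO (cst m) (cst n).
Proof. O6_ring. Qed.

End RawOperations.
Arguments cst n%_R.

HB.instance Definition _ := GRing.isZmodule.Build O6 addOA addOC add0O addNO.
HB.instance Definition _ :=
  GRing.Zmodule_isComNzRing.Build O6 mulOA mulOC mul1O mulODl oneO_neq0.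

HB.instance Definition _ := GRing.isZmodMorphism.Build O6 O6 sg sgB.
HB.instance Definition _ :=
  GRing.isMonoidMorphism.Build O6 O6 sg (conj (erefl : sg 1 = 1) sgM).
HB.instance Definition _ := GRing.isZmodMorphism.Build Z O6 cst cstB.
HB.instance Definition _ :=
  GRing.isMonoidMorphism.Build Z O6 cst (conj (erefl : cst 1 = 1) cstM).

(** The relations between the [theta_j] are abstracted so that the formula of [mulO] can be checked
    in [algC]: this makes the embedding multiplicative. *)
Lemma theta_basis_mul (R : comNzRingType) (t : nat -> R)
    (x0 x1 x2 x3 x4 x5 y0 y1 y2 y3 y4 y5 : R) :
    (forall i j, (j <= i)%N -> t i * t j = t (i + j)%N + t (i - j)%N) ->
    (forall i, (i <= 6)%N -> t (13 - i)%N = t i) -> t 0%N = 2 ->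
    t 1%N + t 2%N + t 3%N + t 4%N + t 5%N + t 6%N = - 1 ->
  let d := x0 * y0 + x1 * y1 + x2 * y2 + x3 * y3 + x4 * y4 + x5 * y5 in
  (x0 * y1 + x1 * y0 + x1 * y4 + x2 * y3 + x2 * y4 + x3 * y2 + x3 * y5 + x4 * y1 + x4 * y2 +
    x5 * y3 + x5 * y5 - (d + d)) * t 1%N +
    (x0 * y0 + x0 * y4 + x1 * y2 + x2 * y1 + x2 * y5 + x3 * y4 + x3 * y5 + x4 * y0 + x4 * y3 +
      x5 * y2 + x5 * y3 - (d + d)) * t 2%N +
    (x0 * y3 + x0 * y4 + x1 * y1 + x1 * y5 + x2 * y3 + x3 * y0 + x3 * y2 + x4 * y0 + x4 * y5 +
      x5 * y1 + x5 * y4 - (d + d)) * t 4%N +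
    (x0 * y2 + x0 * y5 + x1 * y4 + x1 * y5 + x2 * y0 + x2 * y2 + x3 * y4 + x4 * y1 + x4 * y3 +
      x5 * y0 + x5 * y1 - (d + d)) * t 5%N +
    (x0 * y1 + x0 * y2 + x1 * y0 + x1 * y3 + x2 * y0 + x2 * y5 + x3 * y1 + x3 * y3 + x4 * y5 +
      x5 * y2 + x5 * y4 - (d + d)) * t 3%N +
    (x0 * y3 + x0 * y5 + x1 * y2 + x1 * y3 + x2 * y1 + x2 * y4 + x3 * y0 + x3 * y1 + x4 * y2 +
      x4 * y4 + x5 * y0 - (d + d)) * t 6%N
  = (x0 * t 1%N + x1 * t 2%N + x2 * t 4%N + x3 * t 5%N + x4 * t 3%N + x5 * t 6%N) *
    (y0 * t 1%N + y1 * t 2%N + y2 * t 4%N + y3 * t 5%N + y4 * t 3%N + y5 * t 6%N).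
Proof.
move=> tM tN t0 tS d.
have tM' i j : t i * t j = t (maxn i j + minn i j)%N + t (maxn i j - minn i j)%N.
  by case: (leqP j i) => [ji|/ltnW ij]; [rewrite tM // (maxn_idPl ji) (minn_idPr ji)
     | rewrite mulrC tM // (maxn_idPr ij) (minn_idPl ij)].
have t7 : t 7%N = t 6%N by rewrite -(tN 6%N).
have t8 : t 8%N = t 5%N by rewrite -(tN 5%N).
have t9 : t 9%N = t 4%N by rewrite -(tN 4%N).
have t10 : t 10%N = t 3%N by rewrite -(tN 3%N).
have t11 : t 11%N = t 2%N by rewrite -(tN 2%N).
have t12 : t 12%N = t 1%N by rewrite -(tN 1%N).
symmetry; transitivity (x0 * y0 * (t 1%N * t 1%N) + (x0 * y1 + x1 * y0) * (t 1%N * t 2%N) +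
  (x0 * y2 + x2 * y0) * (t 1%N * t 4%N) + (x0 * y3 + x3 * y0) * (t 1%N * t 5%N) + (x0 * y4 +
  x4 * y0) * (t 1%N * t 3%N) + (x0 * y5 + x5 * y0) * (t 1%N * t 6%N) + x1 * y1 * (t 2%N * t 2%N) +
  (x1 * y2 + x2 * y1) * (t 2%N * t 4%N) + (x1 * y3 + x3 * y1) * (t 2%N * t 5%N) + (x1 * y4 +
  x4 * y1) * (t 2%N * t 3%N) + (x1 * y5 + x5 * y1) * (t 2%N * t 6%N) + x2 * y2 * (t 4%N * t 4%N) +
  (x2 * y3 + x3 * y2) * (t 4%N * t 5%N) + (x2 * y4 + x4 * y2) * (t 4%N * t 3%N) + (x2 * y5 +
  x5 * y2) * (t 4%N * t 6%N) + x3 * y3 * (t 5%N * t 5%N) + (x3 * y4 + x4 * y3) * (t 5%N * t 3%N) +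
  (x3 * y5 + x5 * y3) * (t 5%N * t 6%N) + x4 * y4 * (t 3%N * t 3%N) + (x4 * y5 +
  x5 * y4) * (t 3%N * t 6%N) + x5 * y5 * (t 6%N * t 6%N)); first by ring.
rewrite !tM' /= !(t7, t8, t9, t10, t11, t12, t0).
(* The constant [theta_0 = 2] produced by squares is spread over the basis, whence the terms
   [- (d + d)]. *)
have -> : (2 : R) = - 2 * (t 1%N + t 2%N + t 3%N + t 4%N + t 5%N + t 6%N).
  by rewrite tS; ring.
by rewrite /d; ring.
Qed.

Lemma O6_eqP (x y : O6) : x0_ x = x0_ y -> x1_ x = x1_ y -> x2_ x = x2_ y ->
  x3_ x = x3_ y -> x4_ x = x4_ y -> x5_ x = x5_ y -> x = y.
Proof. by case: x => ? ? ? ? ? ?; case: y => ? ? ? ? ? ? /= -> -> -> -> -> ->. Qed.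

Lemma mulOE (x y : O6) : x * y = mulO x y. Proof. by []. Qed.
Lemma addOE (x y : O6) : x + y = addO x y. Proof. by []. Qed.
Lemma oppOE (x : O6) : - x = oppO x. Proof. by []. Qed.

Definition th : O6 := MkO 1 0 0 0 0 0.
Definition kap : O6 := cst 2 - th.

Lemma cst_inj : injective cst.
Proof. by move=> m n [] e _ _ _ _ _; lia. Qed.

Lemma iter_sg6 x : iter 6 sg x = x.
Proof. by case: x. Qed.

Lemma sg_cst n : sg (cst n) = cst n.
Proof. by []. Qed.

Lemma iter_sgM k x y : iter k sg (x * y) = iter k sg x * iter k sg y.
Proof. by elim: k => //= k ->; rewrite rmorphM. Qed.

Lemma iter_sgX k n x : iter k sg (x ^+ n) = iter k sg x ^+ n.
Proof. by elim: k => //= k ->; rewrite rmorphXn. Qed.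

Lemma iter_sgB k x y : iter k sg (x - y) = iter k sg x - iter k sg y.
Proof. by elim: k => //= k ->; rewrite rmorphB. Qed.

Lemma iter_sgD k x y : iter k sg (x + y) = iter k sg x + iter k sg y.
Proof. by elim: k => //= k ->; rewrite rmorphD. Qed.

Lemma iter_sg_cst k n : iter k sg (cst n) = cst n.
Proof. by elim: k => //= k ->; rewrite sg_cst. Qed.

Lemma iter_sg_divides k x y : divides x y -> divides (iter k sg x) (iter k sg y).
Proof. by case=> z ->; exists (iter k sg z); rewrite iter_sgM. Qed.

(** * Trace, norm and the embedding in the complex numbers *)

Definition tr (x : O6) : Z := - (x0_ x + x1_ x + x2_ x + x3_ x + x4_ x + x5_ x).
Definition nmO (x : O6) : O6 := \prod_(k < 6) iter k sg x.
(** The product of the conjugates is fixed by [sg], hence is some [cst n], all of whose coordinates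
    are [- n]. *)
Definition nm (x : O6) : Z := - x0_ (nmO x).

Lemma sg_fixed x : sg x = x -> x = cst (- x0_ x).
Proof.
case: x => y0 y1 y2 y3 y4 y5 [] e0 e1 e2 e3 e4 e5.
by apply: O6_eqP => /=; lia.
Qed.

Lemma nmOE x : nmO x = cst (nm x).
Proof.
apply: sg_fixed; rewrite /nmO rmorph_prod.
rewrite !big_ord_recr !big_ord0 /= !mul1r.
have /= -> := iter_sg6 x; ring.
Qed.

Lemma nm_prod x : cst (nm x) = \prod_(k < 6) iter k sg x.
Proof. by rewrite -nmOE. Qed.

Lemma nmM x y : nm (x * y) = nm x * nm y.
Proof.
apply: cst_inj; rewrite rmorphM /= !nm_prod -big_split /=.
by apply: eq_bigr => k _; rewrite iter_sgM.
Qed.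

Lemma nm_cst n : nm (cst n) = n ^+ 6.
Proof.
apply: cst_inj; rewrite nm_prod rmorphXn -[RHS]/(_ ^+ 6).
rewrite (eq_bigr (fun=> cst n)) => [|k _]; last exact: iter_sg_cst.
by rewrite prodr_const card_ord.
Qed.

Lemma nm1 : nm 1 = 1. Proof. exact: (nm_cst 1). Qed.

Lemma nmX n x : nm (x ^+ n) = nm x ^+ n.
Proof. by elim: n => [|n IH]; rewrite ?nm1 // !exprS nmM IH. Qed.

Lemma nm_sg x : nm (sg x) = nm x.
Proof.
apply: cst_inj; rewrite !nm_prod !big_ord_recr !big_ord0 /= !mul1r.
have /= -> := iter_sg6 x; ring.
Qed.

Lemma nm_iter_sg k x : nm (iter k sg x) = nm x.
Proof. by elim: k => //= k <-; rewrite nm_sg. Qed.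

Lemma divides_nm x : divides x (cst (nm x)).
Proof.
rewrite nm_prod big_ord_recl /=; exact/divides_mulr/divides_refl.
Qed.

Lemma divides_cstP n x : divides (cst n) x <->
  [/\ Z.divide n (x0_ x), Z.divide n (x1_ x) & Z.divide n (x2_ x)] /\
  [/\ Z.divide n (x3_ x), Z.divide n (x4_ x) & Z.divide n (x5_ x)].
Proof.
have mulcst y : cst n * y =
    MkO (n * x0_ y) (n * x1_ y) (n * x2_ y) (n * x3_ y) (n * x4_ y) (n * x5_ y).
  case: y => y0 y1 y2 y3 y4 y5; by rewrite mulOE; apply: O6_eqP => /=; lia.
split=> [[y ->]|].
  by rewrite mulcst /=; split; split; apply: Z.divide_factor_l.
case=> -[[y0 e0] [y1 e1] [y2 e2]] [[y3 e3] [y4 e4] [y5 e5]].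
exists (MkO y0 y1 y2 y3 y4 y5); rewrite mulcst /=.
by apply: O6_eqP => /=; lia.
Qed.

Lemma tr_sqr x : tr (x * x) =
  13 * (x0_ x ^+ 2 + x1_ x ^+ 2 + x2_ x ^+ 2 + x3_ x ^+ 2 + x4_ x ^+ 2 + x5_ x ^+ 2)
  - 2 * (x0_ x + x1_ x + x2_ x + x3_ x + x4_ x + x5_ x) ^+ 2.
Proof. case: x => y0 y1 y2 y3 y4 y5; rewrite /tr mulOE /=; lia. Qed.

Definition zeta : algC := sval (C_prim_root_exists (isT : 0 < 13)%N).
Definition tC (n : nat) : algC := zeta ^+ n + (zeta^*) ^+ n.
Definition ZC (n : Z) : algC := (int_of_Z n)%:~R.

Lemma zeta_prim : 13.-primitive_root zeta.
Proof. exact: (svalP (C_prim_root_exists _)). Qed.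

Lemma zeta_conj : zeta * zeta^* = 1.
Proof.
rewrite -normCK; have n1 : `|zeta| = 1.
  apply/eqP; rewrite -(@pexpr_eq1 _ _ 13) //.
  by rewrite -normrX (prim_expr_order zeta_prim) normr1.
by rewrite n1 expr1n.
Qed.

Lemma tC_real n : tC n \is Num.real.
Proof. by apply/CrealP; rewrite /tC rmorphD /= !rmorphXn /= conjCK addrC. Qed.

Lemma tCM i j : (j <= i)%N -> tC i * tC j = tC (i + j) + tC (i - j).
Proof.
move=> ji; rewrite /tC; have e1 : zeta ^+ j * zeta^* ^+ j = 1.
  by rewrite -exprMn zeta_conj expr1n.
have -> : zeta ^+ i = zeta ^+ (i - j) * zeta ^+ j by rewrite -exprD subnK.
have -> : zeta^* ^+ i = zeta^* ^+ (i - j) * zeta^* ^+ j by rewrite -exprD subnK.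
rewrite !exprD.
have -> : zeta ^+ i = zeta ^+ (i - j) * zeta ^+ j by rewrite -exprD subnK.
have -> : zeta^* ^+ i = zeta^* ^+ (i - j) * zeta^* ^+ j by rewrite -exprD subnK.
rewrite -[X in _ = _ + X]mulr1 -e1; ring.
Qed.

Lemma tCN i : (i <= 6)%N -> tC (13 - i) = tC i.
Proof.
move=> i6; have i13 : (i <= 13)%N by lia.
have z13 : zeta ^+ 13 = 1 by exact: prim_expr_order zeta_prim.
have zi : zeta ^+ (13 - i) = zeta^* ^+ i.
  have := zeta_conj => /(congr1 (fun u => u ^+ i)); rewrite exprMn expr1n => e.
  rewrite -[LHS]mulr1 -e mulrA -exprD subnK // z13 mul1r //.
have wi : zeta^* ^+ (13 - i) = zeta ^+ i.
  by rewrite -[RHS]conjCK rmorphXn /= -zi rmorphXn.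
by rewrite /tC zi wi addrC.
Qed.

Lemma tC_sum : tC 1 + tC 2 + tC 3 + tC 4 + tC 5 + tC 6 = - 1.
Proof.
have z13 : zeta ^+ 13 = 1 by exact: prim_expr_order zeta_prim.
have z1 : zeta != 1.
  by rewrite -[zeta]expr1 -(prim_order_dvd zeta_prim).
have zi i : (i <= 13)%N -> zeta^* ^+ i = zeta ^+ (13 - i).
  move=> i13; have := zeta_conj => /(congr1 (fun u => u ^+ i)).
  rewrite exprMn expr1n => e.
  by rewrite -[RHS]mulr1 -e mulrA -exprD subnK // z13 mul1r.
have: (zeta - 1) * \sum_(k < 13) zeta ^+ k = 0 by rewrite -subrX1 z13 subrr.
move/eqP; rewrite mulf_eq0 subr_eq0 (negPf z1) /= !big_ord_recr big_ord0 /=.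
rewrite /tC !zi // => /eqP e; apply/eqP; rewrite -subr_eq0 -e; apply/eqP.
by rewrite ?subSS ?subn0 expr0; ring.
Qed.

Definition emb (x : O6) : algC :=
  ZC (x0_ x) * tC 1 + ZC (x1_ x) * tC 2 + ZC (x2_ x) * tC 4 +
  ZC (x3_ x) * tC 5 + ZC (x4_ x) * tC 3 + ZC (x5_ x) * tC 6.

Lemma ZCB : {morph ZC : x y / x - y}.
Proof. by move=> x y; rewrite /ZC rmorphB /= rmorphB. Qed.
Lemma ZCM : monoid_morphism ZC.
Proof. by split=> // x y; rewrite /ZC rmorphM /= rmorphM. Qed.
HB.instance Definition _ := GRing.isZmodMorphism.Build Z algC ZC ZCB.
HB.instance Definition _ := GRing.isMonoidMorphism.Build Z algC ZC ZCM.

Lemma emb_cst n : emb (cst n) = ZC n.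
Proof.
rewrite /emb /= -[Z.opp n]/(- n) rmorphN.
transitivity (- ZC n * (tC 1 + tC 2 + tC 3 + tC 4 + tC 5 + tC 6)); first by ring.
by rewrite tC_sum; ring.
Qed.

Lemma embB : {morph emb : x y / x - y}.
Proof.
case=> a0 a1 a2 a3 a4 a5 [b0 b1 b2 b3 b4 b5].
by rewrite /emb /= -!/(_ - _) !rmorphB; ring.
Qed.

Lemma embM : monoid_morphism emb.
Proof.
split; first exact: (emb_cst 1).
case=> a0 a1 a2 a3 a4 a5 [b0 b1 b2 b3 b4 b5].
rewrite {2 3}/emb /= -(theta_basis_mul _ _ _ _ _ _ _ _ _ _ _ _ tCM tCN _ tC_sum);
  last by rewrite /tC !expr0.
rewrite /emb /=.
change Z.add with (@GRing.add Z); change Z.mul with (@GRing.mul Z).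
change Z.sub with (fun x y : Z => x - y); cbv beta.
by rewrite !(rmorphB, rmorphD, rmorphM) /=.
Qed.
HB.instance Definition _ := GRing.isZmodMorphism.Build O6 algC emb embB.
HB.instance Definition _ := GRing.isMonoidMorphism.Build O6 algC emb embM.

Lemma ZC_real n : ZC n \is Num.real.
Proof. by rewrite /ZC realz. Qed.

Lemma emb_real x : emb x \is Num.real.
Proof. by rewrite /emb !rpredD ?rpredM ?ZC_real ?tC_real. Qed.

Lemma emb_tr x : ZC (tr x) = \sum_(k < 6) emb (iter k sg x).
Proof.
case: x => y0 y1 y2 y3 y4 y5; rewrite !big_ord_recr big_ord0 /= /emb /=.
rewrite /tr /= !(rmorphN, rmorphD) /=.
set s := (X in - X); transitivity (s * (tC 1 + tC 2 + tC 3 + tC 4 + tC 5 + tC 6)).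
  by rewrite tC_sum mulrN1.
by rewrite /s; ring.
Qed.

Lemma emb_nm x : ZC (nm x) = \prod_(k < 6) emb (iter k sg x).
Proof. by rewrite -emb_cst nm_prod rmorph_prod. Qed.

Lemma ZC_inj : injective ZC.
Proof. by move=> m n /intr_inj/(can_inj int_of_ZK). Qed.

Lemma ler_ZC m n : (ZC m <= ZC n) = (m <= n).
Proof. by rewrite /ZC ler_int; apply/idP/idP; lia. Qed.

(* The arithmetic-geometric mean inequality for the squares of the conjugates. *)
Lemma nm_le_tr x : 6 ^+ 6 * nm x ^+ 2 <= tr (x * x) ^+ 6.
Proof.
rewrite -ler_ZC (rmorphM ZC) !(rmorphXn ZC) (rmorph_nat ZC) /= emb_tr emb_nm -prodrXl.
have pos (k : 'I_6) : k \in 'I_6 -> 0 <= emb (iter k sg x) ^+ 2.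
  by move=> _; rewrite real_exprn_even_ge0 ?emb_real.
have [le _] := leif_AGM pos; rewrite card_ord in le.
rewrite [X in _ <= X ^+ 6](eq_bigr (fun k : 'I_6 => emb (iter k sg x) ^+ 2)) => [|k _]; last first.
  by rewrite iter_sgM rmorphM expr2.
rewrite mulrC; move: le; rewrite expr_div_n ler_pdivlMr ?exprn_gt0 ?ltr0n //.
Qed.

Lemma divides_cst_inj (n m : Z) : divides (cst n) (cst m) -> Z.divide n m.
Proof. by case/divides_cstP=> -[/= h _ _] _; apply/Z.divide_opp_r. Qed.

Lemma divides_cst (n m : Z) : Z.divide n m -> divides (cst n) (cst m).
Proof. by case=> k ->; exists (cst k); rewrite -rmorphM mulrC. Qed.

Lemma O6_decomp x : x = cst (x0_ x) * th + cst (x1_ x) * iter 1 sg th +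
  cst (x2_ x) * iter 2 sg th + cst (x3_ x) * iter 3 sg th +
  cst (x4_ x) * iter 4 sg th + cst (x5_ x) * iter 5 sg th.
Proof.
by case: x => y0 y1 y2 y3 y4 y5; rewrite !mulOE !addOE; apply: O6_eqP => /=; lia.
Qed.

(** * Frobenius at a rational prime *)

Lemma natr_cst (p : nat) : p%:R = cst (Z.of_nat p) :> O6.
Proof. by rewrite -[LHS](rmorph_nat cst); congr cst; lia. Qed.

Lemma fermat_Z (p : nat) (n : Z) : prime p -> eqmod (cst (Z.of_nat p)) (cst n ^+ p) (cst n).
Proof.
move=> pp; have p0 := prime_gt0 pp; rewrite -natr_cst.
have pos (m : nat) : eqmod (p%:R : O6) (m%:R ^+ p) m%:R.
  elim: m => [|m IH]; first by rewrite expr0n eqn0Ngt p0; apply: eqmod_refl.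
  rewrite -addn1 natrD; apply: eqmod_trans (divides_prime_binom _ _ pp) _.
  by rewrite expr1n; apply: eqmodD IH (eqmod_refl _ _).
case: (Z.leb_spec 0 n) => n0.
  have -> : cst n = (Z.to_nat n)%:R by rewrite natr_cst Z2Nat.id.
  exact: pos.
have {n0} [m ->] : exists m : nat, n = - Z.of_nat m by exists (Z.to_nat (- n)); lia.
rewrite rmorphN /= -natr_cst.
have := pos m; move: (m%:R) => M e1.
have := divides_prime_binom (- M) M pp.
rewrite addNr expr0n eqn0Ngt p0 /= => h.
apply: (@eqmod_trans _ (- M ^+ p)).
  by case: h => z ez; exists (- z); rewrite mulrN -ez; ring.
by case: e1 => z ez; exists (- z); rewrite mulrN -ez; ring.
Qed.

(** Modulo [p] both sides are additive, fix the integers and commute with [sg], and the conjugates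
    of [th] span the ring. So one computation with [th] tells which power of [sg] is the
    Frobenius. *)
Lemma frobenius (p e : nat) : prime p ->
    eqmod (cst (Z.of_nat p)) (th ^+ p) (iter e sg th) ->
  forall x, eqmod (cst (Z.of_nat p)) (x ^+ p) (iter e sg x).
Proof.
move=> pp thp x.
have sgp k y : eqmod (cst (Z.of_nat p)) y (iter e sg th) ->
    eqmod (cst (Z.of_nat p)) (iter k sg y) (iter e sg (iter k sg th)).
  by move/(iter_sg_divides k); rewrite iter_sg_cst iter_sgB -!iterD addnC.
have P (n : Z) (k : nat) : eqmod (cst (Z.of_nat p)) ((cst n * iter k sg th) ^+ p)
   (iter e sg (cst n * iter k sg th)).
  rewrite exprMn iter_sgM iter_sg_cst; apply: eqmodM; first exact: fermat_Z.
  by rewrite -iter_sgX; apply: sgp.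
have A y z : eqmod (cst (Z.of_nat p)) (y ^+ p) (iter e sg y) ->
   eqmod (cst (Z.of_nat p)) (z ^+ p) (iter e sg z) ->
   eqmod (cst (Z.of_nat p)) ((y + z) ^+ p) (iter e sg (y + z)).
  move=> ey ez; rewrite iter_sgD -natr_cst.
  apply: eqmod_trans (divides_prime_binom _ _ pp) _.
  by rewrite natr_cst; apply: eqmodD.
rewrite (O6_decomp x); do 5 (apply: (A); last exact: P).
exact: (P _ 0%N).
Qed.

Lemma zdivides_prime (p : nat) (m n : Z) : prime p ->
  Z.divide (Z.of_nat p) (m * n) -> Z.divide (Z.of_nat p) m \/ Z.divide (Z.of_nat p) n.
Proof.
have dvdE k : Z.divide (Z.of_nat p) k <-> (p %| Z.abs_nat k)%N.
  split=> [[q ->]|/dvdnP[q e]].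
    by apply/dvdnP; exists (Z.abs_nat q); lia.
  by exists (Z.sgn k * Z.of_nat q)%R; lia.
move=> pp /dvdE; have -> : Z.abs_nat (m * n) = (Z.abs_nat m * Z.abs_nat n)%N by lia.
by rewrite Euclid_dvdM // => /orP[]/dvdE; [left|right].
Qed.

Lemma zdivides_primeX (p : nat) (m : Z) k : prime p ->
  Z.divide (Z.of_nat p) (m ^+ k) -> Z.divide (Z.of_nat p) m.
Proof.
move=> pp; elim: k => [|k IH].
  by rewrite expr0 => /Z.divide_1_r; have := prime_gt1 pp; lia.
by rewrite exprS => /(zdivides_prime pp)[].
Qed.

(** * Prime divisors of norms and residue degrees *)

Section PrimeNorm.
Variables (p e : nat).
Hypothesis pp : prime p.
Hypothesis frob : forall x, eqmod (cst (Z.of_nat p)) (x ^+ p) (iter e sg x).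
Let P := cst (Z.of_nat p).

Lemma frobenius_iter k x : eqmod P (x ^+ (p ^ k)) (iter (e * k) sg x).
Proof.
elim: k => [|k IH]; first by rewrite muln0; apply: eqmod_refl.
rewrite expnSr exprM mulnS iterD.
apply: eqmod_trans (frob _) _.
by have := iter_sg_divides e IH; rewrite /P iter_sg_cst iter_sgB.
Qed.

Lemma iter_sg_dvd k x : (6 %| k)%N -> iter k sg x = x.
Proof.
case/dvdnP=> q ->; elim: q => // q IH.
by rewrite mulSn iterD IH; apply: iter_sg6.
Qed.

(** Modulo [p] the product is a power of [x], and the quotient by [p] has no nilpotents, since
    [x ^ (p ^ j) = x] there for every multiple [j] of [f]. *)
Lemma frobenius_reduced (lam : O6) (f : nat) x : (0 < f)%N -> (6 %| e * f)%N ->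
    divides lam P ->
  divides lam (\prod_(k < f) iter (e * k) sg x) -> divides lam x.
Proof.
move=> f0 ef lp.
have eqp : eqmod P (x ^+ (\sum_(k < f) p ^ k)) (\prod_(k < f) iter (e * k) sg x).
  elim: f {ef f0} => [|f IH]; first by rewrite !big_ord0; apply: eqmod_refl.
  rewrite !big_ord_recr /= exprD; apply: eqmodM IH _; exact: frobenius_iter.
set K := (\sum_(k < f) _)%N in eqp => dl.
have {dl eqp} dK := eqmod_divides (eqmod_weak lp eqp) dl.
have: divides lam (x ^+ (p ^ (f * K))).
  apply: divides_trans dK _; apply: divides_exp_leq.
  have K1 : (K <= f * K)%N by rewrite leq_pmull.
  apply: leq_trans K1 _; apply: ltnW; exact/ltn_expl/prime_gt1.
apply: eqmod_divides.
have := frobenius_iter (f * K) x; rewrite mulnA (iter_sg_dvd _ (dvdn_mulr _ ef)).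
by move/(eqmod_weak lp)/eqmod_sym.
Qed.

Variables (t f : nat) (lam : O6).
Hypothesis t0 : (0 < t <= 6)%N.
Hypothesis ef : (6 %| e * f)%N.
Hypothesis prod_frob : forall x,
  \prod_(j < f) iter (e * j) sg x = \prod_(j < f) iter (t * j) sg x.
Hypothesis prod_nm : forall x,
  cst (nm x) = \prod_(k < t) iter k sg (\prod_(j < f) iter (t * j) sg x).
Hypothesis fixed : forall x, iter t sg (\prod_(j < f) iter (t * j) sg x) =
  \prod_(j < f) iter (t * j) sg x.
Hypothesis lamP : divides lam P.
Hypothesis residue : forall y, iter t sg y = y -> exists n, eqmod lam y (cst n).
Hypothesis nm_lam : nm lam = (Z.of_nat p) ^+ f \/ nm lam = - (Z.of_nat p) ^+ f.
Hypothesis f0 : (0 < f)%N.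

Lemma lam_divides_cst n : divides lam (cst n) -> Z.divide (Z.of_nat p) n.
Proof.
case=> y /(congr1 nm); rewrite nm_cst nmM => e6.
apply: (@zdivides_primeX p n 6 pp); rewrite e6; apply: Z.divide_mul_l.
case: f f0 nm_lam => // k _ [] ->; rewrite ?exprS.
  exact: Z.divide_factor_l.
by apply/Z.divide_opp_r; apply: Z.divide_factor_l.
Qed.

(** Here [lam] is meant to generate one of the [t = 6 / f] primes above [p], of residue degree [f],
    and [sg ^ t] to generate its decomposition group. The relative norm [D] of [x] lies in the
    decomposition ring, where every element is an integer modulo [lam]; so Euclid's lemma in [Z]
    applies to the factors [iter k sg D] of [nm x], and reducedness modulo [p] leads from [D] back
    to [x]. *)
Lemma nm_prime_divides x : Z.divide (Z.of_nat p) (nm x) ->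
  exists k, divides (iter k sg lam) x.
Proof.
move=> px; set D := \prod_(j < f) iter (t * j) sg x.
have fixI k y : iter t sg y = y -> iter t sg (iter k sg y) = iter k sg y.
  by move=> ty; rewrite -iterD addnC iterD ty.
have lp n : Z.divide (Z.of_nat p) n -> divides lam (cst n).
  by move=> pn; apply: divides_trans lamP (divides_cst pn).
have split m : divides lam (\prod_(k < m) iter k sg D) ->
    exists k, divides lam (iter k sg D) /\ (k < m)%N.
  elim: m => [|m IH].
    rewrite big_ord0 => /(@lam_divides_cst 1)/Z.divide_1_r.
    by have := prime_gt1 pp; lia.
  rewrite big_ord_recr /=; set A := \prod_(k < m) _ => lAB.
  have tA : iter t sg A = A.
    rewrite /A; elim: (m) => [|j IHj]; first by rewrite big_ord0 (iter_sg_cst _ 1).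
    by rewrite big_ord_recr /= iter_sgM IHj fixI //; apply: fixed.
  have [n1 e1] := residue tA; have [n2 e2] := residue (fixI m _ (fixed x)).
  have: divides lam (cst (n1 * n2)).
    rewrite rmorphM; apply: eqmod_divides lAB; exact/eqmod_sym/eqmodM.
  case/lam_divides_cst/(zdivides_prime pp) => /lp d.
    by have [k [lk km]] := IH (eqmod_divides e1 d); exists k; split=> //; lia.
  by exists m; split=> //; apply: eqmod_divides e2 d.
have [k [lk kt]] : exists k, divides lam (iter k sg D) /\ (k < t)%N.
  by apply: split; rewrite -prod_nm; apply: lp.
have {}lk : divides (iter (6 - k) sg lam) D.
  have := iter_sg_divides (6 - k) lk; rewrite -iterD subnK; last by lia.
  by rewrite iter_sg6.
exists (6 - k)%N; apply: (frobenius_reduced f0 ef); last by rewrite prod_frob.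
by have := iter_sg_divides (6 - k) lamP; rewrite /P iter_sg_cst.
Qed.

(** Dividing out a conjugate of [lam] removes exactly [p ^ f] from the norm. *)
Lemma nm_prime_val x : nm x != 0 -> (f %| logn p (Z.abs_nat (nm x)))%N.
Proof.
have [n] := ubnP (Z.abs_nat (nm x)); elim: n x => // n IH x xn x0.
case: (boolP (p %| Z.abs_nat (nm x))%N) => px; last first.
  by rewrite lognE (negPf px) !andbF.
have [k [y ey]] : exists k, divides (iter k sg lam) x.
  apply: nm_prime_divides; case/dvdnP: px => q e1.
  by exists (Z.sgn (nm x) * Z.of_nat q)%R; lia.
have e2 : Z.abs_nat (nm x) = (p ^ f * Z.abs_nat (nm y))%N.
  rewrite ey nmM nm_iter_sg.
  have pf : Z.of_nat p ^+ f = Z.of_nat (p ^ f) by rewrite -natrXE rmorphXn.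
  by case: nm_lam => ->; rewrite pf; lia.
have y0 : nm y != 0 by apply/eqP => y0; move: x0 e2; rewrite y0; lia.
have pf1 : (1 < p ^ f)%N by rewrite -(expn0 p) ltn_exp2l ?prime_gt1.
have ny : (0 < Z.abs_nat (nm y))%N by clear -y0; lia.
have pf0 : (0 < p ^ f)%N by apply: ltn_trans pf1.
rewrite e2 (lognM p pf0 ny).
rewrite pfactorK // dvdn_addr //; apply: IH => //.
by move: xn; rewrite e2; nia.
Qed.

End PrimeNorm.

(** * Norms at the primes up to 23 *)

Definition dvdO (n : Z) (x : O6) : bool :=
  let: MkO y0 y1 y2 y3 y4 y5 := x in
  all (fun y => Z.eqb (Z.modulo y n) Z0) [:: y0; y1; y2; y3; y4; y5].

Lemma dvdOP n x : n != 0 -> dvdO n x -> divides (cst n) x.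
Proof.
case: x => y0 y1 y2 y3 y4 y5 /eqP n0 /= /and5P[d0 d1 d2 d3 /and3P[d4 d5 _]].
by apply/divides_cstP; split; split => /=; apply/(Z.mod_divide _ _ n0)/Z.eqb_eq.
Qed.

Lemma nm_eqP x n : x * sg x * sg (sg x) * sg (sg (sg x)) * sg (sg (sg (sg x))) *
  sg (sg (sg (sg (sg x)))) = cst n -> nm x = n.
Proof. by move=> e; apply: cst_inj; rewrite nm_prod -e !big_ord_recr big_ord0 /= mul1r. Qed.

Ltac iter_sg_ring y := rewrite !big_ord_recr !big_ord0 /= ?mul1r ?rmorphM /=;
  let e6 := fresh in have /= e6 := iter_sg6 y; rewrite ?e6; ring.

Lemma prod_sg_frob1 (e : nat) (y : O6) : e = 1%N \/ e = 5%N ->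
  \prod_(j < 6) iter (e * j) sg y = \prod_(j < 6) iter (1 * j) sg y.
Proof. by case: y => y0 y1 y2 y3 y4 y5 [] -> //; rewrite !big_ord_recr !big_ord0 /=; ring. Qed.

Lemma nm_val_inert (p e : nat) : prime p -> e = 1%N \/ e = 5%N ->
    eqmod (cst (Z.of_nat p)) (th ^+ p) (iter e sg th) ->
  forall x, nm x != 0 -> (6 %| logn p (Z.abs_nat (nm x)))%N.
Proof.
move=> pp e15 ep; apply: (@nm_prime_val p e pp (frobenius pp ep) 1 6 (cst (Z.of_nat p))) => //.
- by rewrite dvdn_mull.
- by move=> y; apply: prod_sg_frob1.
- by move=> y; rewrite nm_prod big_ord1; apply: eq_bigr => k _; rewrite mul1n.
- by move=> y; iter_sg_ring y.
- exact: divides_refl.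
- by move=> y /sg_fixed ->; exists (- x0_ y); apply: eqmod_refl.
- by left; rewrite nm_cst.
Qed.

(** Gaussian periods generating [Q(sqrt 13)] and the cubic subfield, the decomposition fields of the
    rational primes of residue degree 3 and 2 respectively. *)
Definition rho2 := MkO 1 0 1 0 1 0.
Definition rho3 := MkO 1 0 0 1 0 0.

Lemma nm_val_split2 (p e : nat) (lam : O6) (r : Z) : prime p -> e = 2%N \/ e = 4%N ->
    eqmod (cst (Z.of_nat p)) (th ^+ p) (iter e sg th) ->
    divides lam (cst (Z.of_nat p)) -> eqmod lam rho2 (cst r) ->
    nm lam = (Z.of_nat p) ^+ 3 \/ nm lam = - (Z.of_nat p) ^+ 3 ->
  forall x, nm x != 0 -> (3 %| logn p (Z.abs_nat (nm x)))%N.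
Proof.
move=> pp e24 ep lp lr nl.
apply: (@nm_prime_val p e pp (frobenius pp ep) 2 3 lam) => //.
- by case: e24 => ->.
- by case: e24 => -> //; case=> y0 y1 y2 y3 y4 y5; rewrite !big_ord_recr !big_ord0 /=; ring.
- by move=> y; rewrite nm_prod; iter_sg_ring y.
- by move=> y; iter_sg_ring y.
case=> y0 y1 y2 y3 y4 y5 /= [] e0 e1 e2 e3 e4 e5.
exists (y0 * r + y1 * (- 1 - r)).
rewrite rmorphD !rmorphM rmorphB /=.
have -> : MkO y0 y1 y2 y3 y4 y5 = cst y0 * rho2 + cst y1 * (cst (- 1) - rho2).
  by rewrite !mulOE !oppOE !addOE; apply: O6_eqP => /=; lia.
apply: eqmodD; apply: eqmodM; try exact: eqmod_refl; first exact: lr.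
by case: lr => z ez; exists (- z); rewrite mulrN -ez; ring.
Qed.

Lemma nm_val_split3 (p : nat) (lam : O6) (r r' : Z) : prime p ->
    eqmod (cst (Z.of_nat p)) (th ^+ p) (iter 3 sg th) ->
    divides lam (cst (Z.of_nat p)) -> eqmod lam rho3 (cst r) ->
    eqmod lam (sg rho3) (cst r') ->
    nm lam = (Z.of_nat p) ^+ 2 \/ nm lam = - (Z.of_nat p) ^+ 2 ->
  forall x, nm x != 0 -> (2 %| logn p (Z.abs_nat (nm x)))%N.
Proof.
move=> pp ep lp lr lr' nl.
apply: (@nm_prime_val p 3 pp (frobenius pp ep) 3 2 lam) => //.
- by move=> y; rewrite nm_prod; iter_sg_ring y.
- by move=> y; iter_sg_ring y.
case=> y0 y1 y2 y3 y4 y5 /= [] e0 e1 e2 e3 e4 e5.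
exists (y0 * r + y1 * r' + y2 * (- 1 - r - r')).
rewrite !rmorphD !rmorphM !rmorphB /=.
have -> : MkO y0 y1 y2 y3 y4 y5 =
    cst y0 * rho3 + cst y1 * sg rho3 + cst y2 * (cst (- 1) - rho3 - sg rho3).
  by rewrite !mulOE !oppOE !addOE; apply: O6_eqP => /=; lia.
repeat apply: eqmodD; apply: eqmodM; try exact: eqmod_refl; [exact: lr|exact: lr'|].
case: lr lr' => z ez [z' ez']; exists (- z - z').
by rewrite mulrBr mulrN -ez -ez'; ring.
Qed.

(* Each prime [p <= 23] other than 13 has residue degree [f > 1] with
   [p ^ f > 24], and [f] divides the valuation of every norm at [p]. *)
Lemma nm_seventh_power_small x (m : nat) : Z.abs_nat (nm x) = (m ^ 7)%N ->
  (0 < m <= 24)%N -> m = 1%N \/ m = 13%N.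
Proof.
move=> e m24; have x0 : nm x != 0.
  by apply/eqP => x0; move: e; rewrite x0 => /esym/eqP; rewrite expn_eq0; lia.
have key p f : prime p -> (24 < p ^ f)%N -> coprime f 7 ->
    (f %| logn p (Z.abs_nat (nm x)))%N -> ~~ (p %| m)%N.
  move=> pp pf cf; rewrite e lognX Gauss_dvdr // => fm.
  apply/negP => pm; have m0 : (0 < m)%N by case/andP: m24.
  have l0 : (0 < logn p m)%N by rewrite logn_gt0 mem_primes pp m0.
  have fl := dvdn_leq l0 fm.
  have := dvdn_leq m0 (dvdn_trans (dvdn_exp2l p fl) (pfactor_dvdnn p m)).
  by case/andP: m24; lia.
have i p e' : prime p -> (e' == 1%N) || (e' == 5%N) -> (24 < p ^ 6)%N ->
    dvdO (Z.of_nat p) (th ^+ p - iter e' sg th) -> ~~ (p %| m)%N.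
  move=> pp e15 p6 d; apply: (key p 6%N) => //; apply: (@nm_val_inert p e') => //.
    by case/orP: e15 => /eqP ->; [left|right].
  by apply: dvdOP => //; have := prime_gt0 pp; lia.
have s2 p e' lam mu nu r : prime p -> (e' == 2%N) || (e' == 4%N) -> (24 < p ^ 3)%N ->
    dvdO (Z.of_nat p) (th ^+ p - iter e' sg th) -> cst (Z.of_nat p) = lam * mu ->
    rho2 - cst r = lam * nu ->
    nm lam = (Z.of_nat p) ^+ 3 \/ nm lam = - (Z.of_nat p) ^+ 3 -> ~~ (p %| m)%N.
  move=> pp e24 p6 d e1 e2 e3; apply: (key p 3%N) => //.
  apply: (@nm_val_split2 p e' lam r) => //.
  - by case/orP: e24 => /eqP ->; [left|right].
  - by apply: dvdOP => //; have := prime_gt0 pp; lia.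
  - by exists mu.
  - by exists nu.
have n2 := i 2%N 1%N isT isT isT isT; have n7 := i 7%N 5%N isT isT isT isT.
have n11 := i 11%N 1%N isT isT isT isT; have n19 := i 19%N 5%N isT isT isT isT.
(* Primes above 3, 17 and 23 are generated by [rho2], [rho2 - 4] and [3 rho2 - 1], whose norms from
   [Z[rho2]] to [Z] are -3, 17 and -23; [nm] cubes them. *)
have nl3 : nm rho2 = Z.of_nat 3 ^+ 3 \/ nm rho2 = - Z.of_nat 3 ^+ 3.
  by right; apply: nm_eqP; vm_compute.
have nl17 : nm (MkO 5 4 5 4 5 4) = Z.of_nat 17 ^+ 3 \/
    nm (MkO 5 4 5 4 5 4) = - Z.of_nat 17 ^+ 3.
  by left; apply: nm_eqP; vm_compute.
have nl23 : nm (MkO 4 1 4 1 4 1) = Z.of_nat 23 ^+ 3 \/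
    nm (MkO 4 1 4 1 4 1) = - Z.of_nat 23 ^+ 3.
  by right; apply: nm_eqP; vm_compute.
have n3 := s2 3%N 4%N rho2 (MkO 0 (-1) 0 (-1) 0 (-1)) (cst 1) 0 isT isT isT isT erefl erefl
  nl3.
have n17 := s2 17%N 2%N (MkO 5 4 5 4 5 4) (MkO 4 5 4 5 4 5) (cst 1) 4
  isT isT isT isT erefl erefl
  nl17.
have n23 := s2 23%N 4%N (MkO 4 1 4 1 4 1) (MkO (-1) (-4) (-1) (-4) (-1) (-4))
  (MkO 0 1 0 1 0 1) 8 isT isT isT isT erefl erefl
  nl23.
have n5 : ~~ (5 %| m)%N.
  (* This [lam] is [2 + iter 2 sg rho3], of norm -5 in the cubic subfield. *)
  apply: (key 5%N 2%N) => //; pose lam := MkO (-2) (-2) (-1) (-2) (-2) (-1).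
  apply: (@nm_val_split3 5%N lam 2 (-1)) => //.
  - exact: (@dvdOP 5).
  - by exists (MkO 1 0 3 1 0 3).
  - by exists (MkO 0 0 (-1) 0 0 (-1)).
  - by exists (MkO 1 1 2 1 1 2).
  - by left; apply: nm_eqP.
move: m24 n2 n3 n5 n7 n11 n17 n19 n23; clear; case/andP.
by do 25 (case: m => [|m] //=; try (by left); try (by right)).
Qed.

(** Infinite descent: 2 is inert, so an element of norm 0 is divisible by 2, and halving its
    coordinates gives another one. *)
Lemma nm_eq0 x : nm x = 0 -> x = 0.
Proof.
have two y : nm y = 0 -> exists z, y = cst 2 * z.
  move=> y0; have f2 : eqmod (cst (Z.of_nat 2)) (th ^+ 2) (iter 1 sg th).
    exact: (@dvdOP 2).
  have [] := @nm_prime_divides 2 1 isT (@frobenius 2 1 isT f2) 1 6 (cst 2) _ _ _ _ _ _ _ _ _ y => //.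
  - by move=> z; rewrite nm_prod big_ord1; apply: eq_bigr => k _; rewrite mul1n.
  - by move=> z; iter_sg_ring z.
  - by move=> z /sg_fixed ->; exists (- x0_ z); apply: eqmod_refl.
  - by left; rewrite nm_cst.
  - by rewrite y0; exists 0.
  by move=> k [z]; rewrite iter_sg_cst; exists z.
pose w (y : O6) := (Z.abs_nat (x0_ y) + Z.abs_nat (x1_ y) + Z.abs_nat (x2_ y) +
   Z.abs_nat (x3_ y) + Z.abs_nat (x4_ y) + Z.abs_nat (x5_ y))%N.
have [n] := ubnP (w x); elim: n x => // n IH x xn x0.
have [z ez] := two x x0.
have z0 : nm z = 0.
  move: x0; rewrite ez nmM nm_cst => /eqP; rewrite mulf_eq0 => /orP[] /eqP //.
case: (posnP (w x)) => [wx|wx].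
  by move: wx; rewrite /w; case: x {xn x0 ez} => *; apply: O6_eqP => /=; simpl in *; lia.
rewrite ez (IH z) ?mulr0 //.
have: w x = (w z).*2; last by lia.
have -> : x = z + z by rewrite ez; have -> : cst 2 = 2 by []; ring.
by rewrite /w; case: (z) => *; rewrite addOE /=; lia.
Qed.

Lemma O6_mulfI x : x != 0 -> injective (fun y : O6 => x * y).
Proof.
move=> x0 y z /eqP; rewrite -subr_eq0 -mulrBr => /eqP /(congr1 nm).
rewrite nmM (nm_cst 0) expr0n => /eqP; rewrite mulf_eq0 => /orP[] /eqP /nm_eq0.
  by move/eqP: x0.
by move/eqP; rewrite subr_eq0 => /eqP.
Qed.

(** * Hermite's bound for the minimum of a positive definite form *)

Section Hermite.

Definition qform n (G : 'M[Z]_n) (x : 'rV[Z]_n) : Z := (x *m G *m x^T) 0 0.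
Definition posdef n (G : 'M[Z]_n) := G^T = G /\ forall x, x != 0 -> 0 < qform G x.
Definition unimodular n (U : 'M[Z]_n) := \det U ^+ 2 = 1.

Lemma unimodularM n (U V : 'M[Z]_n) : unimodular U -> unimodular V -> unimodular (U *m V).
Proof. by rewrite /unimodular det_mulmx exprMn => -> ->; rewrite mulr1. Qed.

Lemma unimodular_mul_eq0 n (U : 'M[Z]_n) (x : 'rV[Z]_n) : unimodular U -> x *m U = 0 -> x = 0.
Proof.
move=> uU /(congr1 (mulmx^~ (\adj U))); rewrite /= mul0mx -mulmxA mul_mx_adj.
rewrite mul_mx_scalar => /(congr1 (fun y => \det U *: y)).
by rewrite scalerA -expr2 uU scale1r scaler0.
Qed.

Lemma unimodular_row_neq0 n (U : 'M[Z]_n) i : unimodular U -> row i U != 0.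
Proof.
move=> uU; apply/eqP; rewrite rowE => /(unimodular_mul_eq0 uU)/matrixP/(_ 0 i).
by rewrite !mxE !eqxx.
Qed.

Lemma qform_congr n (U G : 'M[Z]_n) x : qform (U *m G *m U^T) x = qform G (x *m U).
Proof. by rewrite /qform trmx_mul !mulmxA. Qed.

Lemma posdef_congr n (U G : 'M[Z]_n) : unimodular U -> posdef G -> posdef (U *m G *m U^T).
Proof.
move=> uU [sG pG]; split; first by rewrite !trmx_mul trmxK sG mulmxA.
move=> x x0; rewrite qform_congr; apply: pG; apply: contra_neq x0.
exact: unimodular_mul_eq0.
Qed.

Lemma congr_diag n (U G : 'M[Z]_n) i : (U *m G *m U^T) i i = qform G (row i U).
Proof.
rewrite /qform -row_mul tr_row mxE [RHS]mxE.
by apply: eq_bigr => j _; rewrite !mxE.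
Qed.

Lemma qform_block n (m a : Z) (g : 'rV[Z]_n) (H : 'M[Z]_n) (y : 'rV[Z]_n) :
  qform (block_mx m%:M g g^T H : 'M_(1 + n)) (row_mx a%:M y) =
  a ^+ 2 * m + 2 * a * (y *m g^T) 0 0 + qform H y.
Proof.
rewrite /qform mul_row_block tr_row_mx mul_row_col !mul_scalar_mx tr_scalar_mx.
rewrite mul_mx_scalar !mulmxDl -scalemxAl.
have -> : g *m y^T = (y *m g^T)^T by rewrite trmx_mul trmxK.
by rewrite !mxE eqxx /=; ring.
Qed.

Lemma qformZ n (m : Z) (H : 'M[Z]_n) y : qform (m *: H) y = m * qform H y.
Proof. by rewrite /qform -scalemxAr -scalemxAl mxE. Qed.

Lemma qformB n (G H : 'M[Z]_n) y : qform (G - H) y = qform G y - qform H y.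
Proof. by rewrite /qform mulmxBr mulmxBl !mxE. Qed.

Lemma qform_rank1 n (g y : 'rV[Z]_n) : qform (g^T *m g) y = ((y *m g^T) 0 0) ^+ 2.
Proof.
rewrite /qform mulmxA -mulmxA expr2.
have -> : g *m y^T = (y *m g^T)^T by rewrite trmx_mul trmxK.
by rewrite mxE big_ord1 [(_ ^T) _ _]mxE.
Qed.

Lemma qform_schur n (m : Z) (g : 'rV[Z]_n) (H : 'M[Z]_n) y :
  qform (m *: H - g^T *m g) y = m * qform H y - ((y *m g^T) 0 0) ^+ 2.
Proof. by rewrite qformB qformZ qform_rank1. Qed.

(** The form [m H - g^T g] is [m] times the Schur complement of the corner; the factor keeps it
    integral. *)
Lemma posdef_schur n (m : Z) (g : 'rV[Z]_n) (H : 'M[Z]_n) :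
    posdef (block_mx m%:M g g^T H : 'M_(1 + n)) ->
  [/\ 0 < m, posdef (m *: H - g^T *m g) &
   \det (block_mx m%:M g g^T H : 'M_(1 + n)) * m ^+ n = m * \det (m *: H - g^T *m g)].
Proof.
move=> [sG pG].
have e1 : (1%:M : 'M[Z]_1) != 0 by apply/eqP => /matrixP/(_ 0 0); rewrite !mxE.
have m0 : 0 < m.
  have := pG (row_mx 1%:M 0); rewrite qform_block mul0mx /qform !mul0mx !mxE.
  rewrite !mulr0 expr1n mul1r !addr0; apply.
  by rewrite -(row_mx0 Z 1 1 n); apply: contra_neq e1 => /eq_row_mx[].
split=> //.
  split.
    have [sH] : H^T = H.
      by move: sG; rewrite tr_block_mx => /eq_block_mx[].
    by rewrite linearB /= linearZ /= trmx_mul trmxK sH.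
  move=> y y0; rewrite qform_schur; set c := (y *m g^T) 0 0.
  have := pG (row_mx (- c)%:M (m *: y)); rewrite qform_block.
  have -> : (m *: y *m g^T) 0 0 = m * c by rewrite -scalemxAl mxE.
  have -> : qform H (m *: y) = m ^+ 2 * qform H y.
    by rewrite /qform linearZ /= -!scalemxAl -scalemxAr !mxE; ring.
  move=> h; have {}h : 0 < m * (m * qform H y - c ^+ 2).
    have -> : m * (m * qform H y - c ^+ 2) =
      (- c) ^+ 2 * m + 2 * (- c) * (m * c) + m ^+ 2 * qform H y by ring.
    apply: h; apply: contra_neq y0; rewrite -(row_mx0 Z 1 1 n) => /eq_row_mx[_ /rowP my].
    apply/rowP => j; have /eqP := my j.
    by rewrite !mxE mulf_eq0 (gt_eqF m0) => /eqP.
  by rewrite pmulr_rgt0 in h.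
have := det_mulmx (block_mx 1%:M 0 (- g^T) m%:M : 'M_(1 + n)) (block_mx m%:M g g^T H).
rewrite mulmx_block !mul0mx !addr0 !mul1mx det_lblock det1 mul1r det_scalar.
rewrite mulNmx mul_mx_scalar mul_scalar_mx.
have -> : - g^T *m g + m%:M *m H = m *: H - g^T *m g.
  by rewrite mulNmx mul_scalar_mx addrC.
have -> : - (m *: g^T) + m *: g^T = 0 by rewrite addNr.
by rewrite det_ublock det_scalar1 => ->; rewrite mulrC.
Qed.

Lemma nearest_mul (m c : Z) : 0 < m -> exists a : Z, 4 * (m * a + c) ^+ 2 <= m ^+ 2.
Proof.
move=> m0; exists (- Z.div (2 * c + m) (2 * m)).
have := Z.div_mod (2 * c + m) (2 * m); have := Z.mod_pos_bound (2 * c + m) (2 * m).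
set q := Z.div _ _; set r := Z.modulo _ _ => h1 h2.
have {}h1 : (0 <= r < 2 * m) by lia.
have {}h2 : 2 * c + m = 2 * m * q + r by lia.
have -> : 4 * (m * - q + c) ^+ 2 = (r - m) ^+ 2.
  have -> : r = 2 * c + m - 2 * m * q by lia.
  by ring.
nia.
Qed.

(** Induction on the dimension, then on the corner [m]. Let [mu] be the value of the scaled Schur
    complement at the vector [y] given by induction, and [q] that of [G] at the best lift [(a, y)].
    If [q < m], a change of basis puts the lift first and lowers the corner. Otherwise
    [m ^ 2 <= m q <= m ^ 2 / 4 + mu] gives [3 m ^ 2 <= 4 mu], and the first basis vector will do. *)
Lemma hermite n (G : 'M[Z]_n.+1) : posdef G -> exists U, unimodular U /\
  (qform G (row 0 U)) ^+ n.+1 * 3 ^+ 'C(n.+1, 2) <= 4 ^+ 'C(n.+1, 2) * \det G.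
Proof.
elim: n G => [|n IH] G pG.
  exists 1%:M; split; first by rewrite /unimodular det1 expr1n.
  have -> : row 0 1%:M = 1%:M :> 'M[Z]_1 by apply/matrixP => i j; rewrite !mxE !ord1.
  by rewrite /qform mul1mx trmx1 mulmx1 {2}[G]mx11_scalar det_scalar1 mulrC.
have [k] := ubnP (Z.to_nat (G 0 0)); elim: k G pG => // k IHk G pG Gk.
pose G' : 'M[Z]_(1 + n.+1) := G; pose m := G 0 0.
pose g : 'rV[Z]_n.+1 := ursubmx G'; pose H := drsubmx G'.
have eG : G = block_mx m%:M g g^T H :> 'M_(1 + n.+1).
  have [sG _] := pG; rewrite -[LHS](submxK G') -/g -/H; congr block_mx.
    by rewrite [LHS]mx11_scalar !mxE; congr (_ _ _)%:M; apply: val_inj.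
  by rewrite /g trmx_ursub; congr dlsubmx; rewrite /G' sG.
have pG1 : posdef (block_mx m%:M g g^T H : 'M_(1 + n.+1)) by rewrite -eG.
have [m0 pG2 dG] := posdef_schur pG1.
have [U2 [uU2 hU2]] := IH _ pG2.
set mu := qform _ _ in hU2; set y := row 0 U2 in mu hU2.
have [a ha] := nearest_mul ((y *m g^T) 0 0) m0.
pose q := qform G (row_mx a%:M y : 'rV_(1 + n.+1)).
have mq : m * q = (m * a + (y *m g^T) 0 0) ^+ 2 + mu.
  rewrite /q eG qform_block /mu qform_schur.
  by ring.
case: (ltrP q m) => qm.
  pose W : 'M[Z]_(1 + n.+1) := block_mx 1%:M 0 (a *: delta_mx 0 0) U2.
  pose V : 'M[Z]_n.+2 := xrow 0 (rshift 1 0) W.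
  have dW : \det (W : 'M_(1 + n.+1)) = \det U2 by rewrite /W det_lblock det1 mul1r.
  have uV : unimodular V.
    rewrite /unimodular /V xrowE det_mulmx det_perm exprMn -exprM mulnC exprM.
    by rewrite sqrrN !expr1n mul1r [\det _]dW.
  have rV : row 0 V = row_mx a%:M y :> 'rV_(1 + n.+1).
    apply/rowP => j; rewrite mxE.
    have -> : V 0 j = W (rshift 1 0) j by rewrite mxE perm.tpermL.
    rewrite /W /block_mx [LHS](@col_mxEd _ 1 n.+1 (1 + n.+1) _ _ 0 j).
    rewrite mxE [RHS]mxE; case: (split j) => l; rewrite !mxE //.
    by rewrite !ord1 eqxx mulr1 mulr1n.
  have pV := posdef_congr uV pG.
  have VG : (V *m G *m V^T) 0 0 = q by rewrite congr_diag rV.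
  have q0 : 0 < q by rewrite /q -rV; case: pG => _; apply; apply: unimodular_row_neq0.
  have [|U [uU hU]] := IHk _ pV; first by rewrite VG; lia.
  exists (U *m V); split; first exact: unimodularM.
  move: hU; rewrite qform_congr -row_mul !det_mulmx det_tr.
  suff -> : \det V * \det G * \det V = \det G by [].
  by rewrite mulrAC -expr2 uV mul1r.
exists 1%:M; split; first by rewrite /unimodular det1 expr1n.
have -> : qform G (row 0 1%:M) = m by rewrite -congr_diag mul1mx trmx1 mulmx1.
have h3 : 3 * m ^+ 2 <= 4 * mu by nia.
have dG' : \det (m *: H - g^T *m g) = m ^+ n * \det G.
  apply: (mulfI (lt0r_neq0 m0)); rewrite -dG -eG exprS; ring.
rewrite dG' in hU2.
have -> : 'C(n.+2, 2) = ('C(n.+1, 2) + n.+1)%N by rewrite binS bin1.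
move: 'C(n.+1, 2) hU2 => K hU2; rewrite !(exprD _ K).
have mn0 : 0 < m ^+ n by rewrite exprn_gt0.
rewrite -(ler_pM2l mn0).
apply: (@le_trans _ _ (4 ^+ n.+1 * (mu ^+ n.+1 * 3 ^+ K))); last first.
  apply: (@le_trans _ _ (4 ^+ n.+1 * (4 ^+ K * (m ^+ n * \det G)))).
    by rewrite ler_pM2l ?exprn_gt0.
  by rewrite le_eqVlt; apply/orP; left; apply/eqP; ring.
have -> : m ^+ n * (m ^+ n.+2 * (3 ^+ K * 3 ^+ n.+1)) =
   (3 * m ^+ 2) ^+ n.+1 * 3 ^+ K.
  rewrite exprMn -exprM; have -> : (2 * n.+1 = n + n.+2)%N by lia.
  by rewrite (exprD m); ring.
rewrite mulrA -exprMn ler_pM2r ?exprn_gt0 //.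
by apply: lerXn2r; rewrite ?nnegrE //; have := sqr_ge0 m; lia.
Qed.

End Hermite.

(** * Elements of small norm in an ideal *)

Section SmallNorm.

Let w : 'rV[Z]_5 := const_mx 1.

(* The Gram matrix of the trace form in the basis 1, theta_1, ..., theta_16. *)
Definition gramT : 'M[Z]_(1 + 5) :=
  block_mx 6%:M (- w) (- w)^T (13 *: 1%:M - 2 *: (w^T *m w)).

Definition of_row (n : Z) (y : 'rV[Z]_5) : O6 :=
  cst n + cst (y 0 0) * th + cst (y 0 1) * iter 1 sg th + cst (y 0 2) * iter 2 sg th +
  cst (y 0 3) * iter 3 sg th + cst (y 0 4) * iter 4 sg th.

Lemma of_rowE n y : of_row n y =
  MkO (y 0 0 - n) (y 0 1 - n) (y 0 2 - n) (y 0 3 - n) (y 0 4 - n) (- n).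
Proof.
rewrite /of_row; move: (y 0 0) (y 0 1) (y 0 2) (y 0 3) (y 0 4) => a b c d e.
by rewrite !mulOE !addOE; apply: O6_eqP => /=; lia.
Qed.

Lemma sum5 (F : 'I_5 -> Z) : \sum_(j < 5) F j = F 0 + F 1 + F 2 + F 3 + F 4.
Proof.
rewrite !big_ord_recr big_ord0 /= add0r.
by congr (F _ + F _ + F _ + F _ + F _); apply: val_inj.
Qed.

Lemma qform_gramT n y : qform gramT (row_mx n%:M y) = tr (of_row n y * of_row n y).
Proof.
have yw : (y *m w^T) 0 0 = y 0 0 + y 0 1 + y 0 2 + y 0 3 + y 0 4.
  by rewrite mxE -sum5; apply: eq_bigr => j _; rewrite !mxE mulr1.
have yy : qform 1%:M y = y 0 0 ^+ 2 + y 0 1 ^+ 2 + y 0 2 ^+ 2 + y 0 3 ^+ 2 + y 0 4 ^+ 2.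
  by rewrite /qform mulmx1 mxE sum5 !mxE !expr2.
rewrite qform_block qformB !qformZ qform_rank1 yy.
have -> : (y *m (- w)^T) 0 0 = - (y *m w^T) 0 0 by rewrite linearN /= mulmxN mxE.
rewrite yw tr_sqr of_rowE /=.
move: (y 0 0) (y 0 1) (y 0 2) (y 0 3) (y 0 4) => a b c d e; ring.
Qed.

Lemma tr_sqr_gt0 x : x != 0 -> 0 < tr (x * x).
Proof.
move=> x0; rewrite tr_sqr; case: x x0 => a b c d e f /=; apply: contraNT.
rewrite -leNgt => le0.
have sq (y : Z) : y ^+ 2 <= 0 -> y = 0 by clear; nia.
have key : 0 <= 6 * (a ^+ 2 + b ^+ 2 + c ^+ 2 + d ^+ 2 + e ^+ 2 + f ^+ 2)
    - (a + b + c + d + e + f) ^+ 2.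
  have -> : 6 * (a ^+ 2 + b ^+ 2 + c ^+ 2 + d ^+ 2 + e ^+ 2 + f ^+ 2)
    - (a + b + c + d + e + f) ^+ 2 =
      (a - b) ^+ 2 + (a - c) ^+ 2 + (a - d) ^+ 2 + (a - e) ^+ 2 + (a - f) ^+ 2 +
      (b - c) ^+ 2 + (b - d) ^+ 2 + (b - e) ^+ 2 + (b - f) ^+ 2 + (c - d) ^+ 2 +
      (c - e) ^+ 2 + (c - f) ^+ 2 + (d - e) ^+ 2 + (d - f) ^+ 2 + (e - f) ^+ 2 by ring.
  by rewrite !addr_ge0 ?sqr_ge0.
have [a2 b2 c2] : [/\ a ^+ 2 <= 0, b ^+ 2 <= 0 & c ^+ 2 <= 0].
  move: le0 key (sqr_ge0 a) (sqr_ge0 b) (sqr_ge0 c) (sqr_ge0 d) (sqr_ge0 e) (sqr_ge0 f).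
  move: (a ^+ 2) (b ^+ 2) (c ^+ 2) (d ^+ 2) (e ^+ 2) (f ^+ 2) (_ ^+ 2).
  by clear => *; split; lia.
have [d2 e2 f2] : [/\ d ^+ 2 <= 0, e ^+ 2 <= 0 & f ^+ 2 <= 0].
  move: le0 key (sqr_ge0 a) (sqr_ge0 b) (sqr_ge0 c) (sqr_ge0 d) (sqr_ge0 e) (sqr_ge0 f).
  move: (a ^+ 2) (b ^+ 2) (c ^+ 2) (d ^+ 2) (e ^+ 2) (f ^+ 2) (_ ^+ 2).
  by clear => *; split; lia.
by rewrite (sq _ a2) (sq _ b2) (sq _ c2) (sq _ d2) (sq _ e2) (sq _ f2).
Qed.

(** This is the discriminant of the field; row and column operations make the matrix block
    triangular. *)
Lemma det_gramT : \det gramT = 13 ^+ 5.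
Proof.
have ww : w *m w^T = 5%:M.
  apply/matrixP => i j; rewrite !ord1 !mxE sum5 /w !mxE eqxx mulr1n; ring.
pose L : 'M[Z]_(1 + 5) := block_mx 1%:M 0 (- 2 *: w^T) 1%:M.
pose R : 'M[Z]_(1 + 5) := block_mx 1%:M 0 w^T 1%:M.
have dL : \det L = 1 by rewrite /L det_lblock !det1 mulr1.
have dR : \det R = 1 by rewrite /R det_lblock !det1 mulr1.
have -> : \det gramT = \det (L *m gramT *m R) by rewrite !det_mulmx dL dR mul1r mulr1.
have LT : L *m gramT = block_mx 6%:M (- w) (- 13 *: w^T) (13 *: 1%:M).
  rewrite /L /gramT mulmx_block !mul0mx !mul1mx !addr0; congr block_mx.
    apply/matrixP => i j; rewrite mul_mx_scalar !mxE; ring.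
  rewrite mulmxN -scalemxAl; apply/matrixP => i j; rewrite !mxE; ring.
have -> : L *m gramT *m R = block_mx 1%:M (- w) 0 13%:M.
  rewrite LT /R mulmx_block !mulmx0 !mulmx1 !add0r; congr block_mx.
  - by rewrite mulNmx ww; apply/matrixP => i j; rewrite !mxE !ord1 eqxx.
  - rewrite -scalemxAl mul1mx; apply/matrixP => i j; rewrite !mxE; ring.
  - by rewrite scalemx1.
by rewrite det_ublock det1 mul1r det_scalar.
Qed.

(** The rows of [C] describe the basis [v], [iter j sg th - c_j] of a lattice of index [|v|], with
    Gram determinant [13 ^ 5 v ^ 2]. Hermite's bound followed by the arithmetic-geometric inequality
    bounds [nm x ^ 2] by [v ^ 2] times [(4 / 3) ^ 15 13 ^ 5 / 6 ^ 6], about 595.5 and less than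
    [25 ^ 2]. *)
Lemma small_norm_element (v : Z) (c : 'cV[Z]_5) : v != 0 ->
  exists (n : Z) (y : 'rV[Z]_5), let x := of_row (n * v - (y *m c) 0 0) y in
    x != 0 /\ `|nm x| < 25 * `|v|.
Proof.
move=> v0; pose C : 'M[Z]_(1 + 5) := block_mx v%:M 0 (- c) 1%:M.
have xC n y : row_mx n%:M y *m C = row_mx (n * v - (y *m c) 0 0)%:M y.
  rewrite /C mul_row_block mulmx0 mulmx1 add0r mulmxN -scalar_mxM; congr row_mx.
  by rewrite rmorphB /= -mx11_scalar.
have of_row0 n y : of_row n y = 0 -> n = 0 /\ y = 0.
  rewrite of_rowE => -[e0 e1 e2 e3 e4 e5]; have n0 : n = 0 by lia.
  split=> //; apply/rowP => j; rewrite !mxE.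
  case: j => -[|[|[|[|[|//]]]]] jj.
  - by rewrite (_ : Ordinal jj = 0); [lia|apply: val_inj].
  - by rewrite (_ : Ordinal jj = 1); [lia|apply: val_inj].
  - by rewrite (_ : Ordinal jj = 2); [lia|apply: val_inj].
  - by rewrite (_ : Ordinal jj = 3); [lia|apply: val_inj].
  - by rewrite (_ : Ordinal jj = 4); [lia|apply: val_inj].
have rowE (x : 'rV[Z]_(1 + 5)) : x = row_mx (lsubmx x 0 0)%:M (rsubmx x).
  by rewrite -mx11_scalar hsubmxK.
have pG : posdef (C *m gramT *m C^T).
  split.
    rewrite !trmx_mul trmxK mulmxA; congr (_ *m _ *m _).
    rewrite /gramT tr_block_mx tr_scalar_mx trmxK; congr block_mx.
    by rewrite linearB /= !linearZ /= trmx1 trmx_mul trmxK.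
  move=> x x0; rewrite qform_congr (rowE x) xC qform_gramT; apply: tr_sqr_gt0.
  apply: contra_neq x0 => /of_row0[n0 y0]; 
  have yc : (rsubmx x *m c) 0 0 = 0 by rewrite y0 mul0mx mxE.
  rewrite yc subr0 in n0.
  rewrite (rowE x) y0; move/eqP: n0; rewrite mulf_eq0 (negPf v0) orbF => /eqP ->.
  by rewrite raddf0 row_mx0.
have [U [uU hU]] := hermite pG.
have := unimodular_row_neq0 0 uU; move: hU; set x' := row 0 U; pose x : 'rV[Z]_(1 + 5) := x';
  rewrite -[x']/x => hU x0.
exists (lsubmx x 0 0), (rsubmx x); set X := of_row _ _.
have qX : qform (C *m gramT *m C^T) x = tr (X * X).
  by rewrite qform_congr {1}(rowE x) xC qform_gramT.
have X0 : X != 0.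
  have [_ /(_ _ x0)] := pG; rewrite qX; apply: contraTneq => ->.
  by rewrite mulr0.
split=> //.
have dG : \det (C *m gramT *m C^T) = v ^+ 2 * 13 ^+ 5.
  rewrite !det_mulmx det_tr det_gramT /C det_lblock det_scalar1 det1 mulr1; ring.
rewrite qX dG in hU.
have := nm_le_tr X => nt.
have {nt hU} : (6 ^+ 6 * nm X ^+ 2) * 3 ^+ 15 <= 4 ^+ 15 * (v ^+ 2 * 13 ^+ 5).
  by apply: le_trans hU; rewrite ler_pM2r ?exprn_gt0.
move=> h; have {}h : nm X ^+ 2 <= (24 * v) ^+ 2 + 22 * v ^+ 2.
  move: h; rewrite exprMn; move: (nm X ^+ 2) (v ^+ 2) (sqr_ge0 v) => a b.
  by lia.
rewrite -(@ltr_pXn2r _ 2) ?nnegrE ?mulr_ge0 // real_normK ?num_real //.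
rewrite [(25 * _) ^+ 2]exprMn real_normK ?num_real //.
apply: le_lt_trans h _; have : 0 < v ^+ 2 by rewrite exprn_even_gt0.
by rewrite exprMn; lia.
Qed.

End SmallNorm.

(** * Elements whose norm is a seventh power *)

Lemma nm_unit x : Z.abs_nat (nm x) = 1%N -> divides x 1.
Proof.
move=> x1; have [nx|nx] : nm x = 1 \/ nm x = -1 by lia.
  by have := divides_nm x; rewrite nx.
by have := divides_opp (divides_nm x); rewrite nx -rmorphN.
Qed.

Lemma unit_nm x : divides x 1 -> Z.abs_nat (nm x) = 1%N.
Proof.
case=> y /(congr1 nm); rewrite nm1 nmM => e.
have /eqP : (Z.abs_nat (nm x) * Z.abs_nat (nm y))%N = 1%N by lia.
by rewrite muln_eq1 => /andP[/eqP].
Qed.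

(** All [theta_j] are 2 modulo [kap], so [x] is there twice the sum of its coordinates: [res x]
    represents [x] in the residue field with 13 elements. *)
Definition res (x : O6) : Z := - 2 * tr x.

Lemma nm_kap : nm kap = 13.
Proof. by apply: nm_eqP; vm_compute. Qed.

Lemma theta_sqr k : iter k.+1 sg th = iter k sg th ^+ 2 - cst 2.
Proof.
rewrite iterSr; have -> : sg th = th ^+ 2 - cst 2 by vm_compute.
by rewrite iter_sgB iter_sgX iter_sg_cst.
Qed.

Lemma theta_eqmod_kap k : eqmod kap (iter k sg th) (cst 2).
Proof.
elim: k => [|k IH]; first by exists (- 1); rewrite /kap /=; ring.
rewrite theta_sqr; have := eqmodX 2 IH; case=> z ez; exists z; rewrite -ez.
by rewrite -rmorphXn /=; have -> : cst (2 ^+ 2) = cst 2 + cst 2 by []; ring.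
Qed.

Lemma eqmod_res x : eqmod kap x (cst (res x)).
Proof.
rewrite {1}(O6_decomp x); have -> : cst (res x) = cst (x0_ x) * cst 2 + cst (x1_ x) * cst 2
   + cst (x2_ x) * cst 2 + cst (x3_ x) * cst 2 + cst (x4_ x) * cst 2 + cst (x5_ x) * cst 2.
  by rewrite -!rmorphM -!rmorphD /res /tr; congr cst; ring.
repeat apply: eqmodD; apply: eqmodM (eqmod_refl _ _) _; try exact: theta_eqmod_kap.
exact: (theta_eqmod_kap 0).
Qed.

Lemma res_iter_sg k x : res (iter k sg x) = res x.
Proof.
elim: k => //= k <-; rewrite /res; congr (_ * _); move: (iter k sg x) => [a b c d e f];
  rewrite /tr /=; lia.
Qed.

Lemma kap_divides_cst n : divides kap (cst n) -> Z.divide 13 n.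
Proof.
case=> y /(congr1 nm); rewrite nm_cst nmM nm_kap => e6.
by apply: (@zdivides_primeX 13 n 6 isT); rewrite e6; apply: Z.divide_factor_l.
Qed.

Lemma kap_divides_13 : divides kap (cst 13).
Proof. by have := divides_nm kap; rewrite nm_kap. Qed.

Lemma eqmod_nm_res x : eqmod kap (cst (nm x)) (cst (res x ^+ 6)).
Proof.
rewrite nm_prod rmorphXn /= !big_ord_recr big_ord0 /=.
have e k : eqmod kap (iter k sg x) (cst (res x)).
  by rewrite -(res_iter_sg k x); apply: eqmod_res.
have -> : cst (res x) ^+ 6 = 1 * cst (res x) * cst (res x) * cst (res x) * cst (res x) *
  cst (res x) * cst (res x) by ring.
by repeat apply: eqmodM; [exact: eqmod_refl|exact: (e 0)|exact: (e 1)|exact: (e 2)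
  |exact: (e 3)|exact: (e 4)|exact: (e 5)].
Qed.

Lemma nm_13_kap x : Z.divide 13 (nm x) -> divides kap x.
Proof.
move=> x13; apply: eqmod_divides (eqmod_res x) _.
have: divides kap (cst (res x ^+ 6)).
  apply: eqmod_divides (eqmod_sym (eqmod_nm_res x)) _.
  exact: divides_trans kap_divides_13 (divides_cst x13).
move/kap_divides_cst/(@zdivides_primeX 13 _ 6 isT) => d.
exact: divides_trans kap_divides_13 (divides_cst d).
Qed.

Lemma nm_13_pow k x : Z.abs_nat (nm x) = (13 ^ k)%N ->
  exists y, x = kap ^+ k * y /\ Z.abs_nat (nm y) = 1%N.
Proof.
elim: k x => [|k IH] x; first by exists x; rewrite expr0 mul1r.
rewrite expnS => e.
have [y ey] : divides kap x.
  by apply: nm_13_kap; exists (Z.sgn (nm x) * Z.of_nat (13 ^ k))%R; lia.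
have [|z [ez nz]] := IH y.
  by move: e; rewrite ey nmM nm_kap; move: (nm y) => a; lia.
by exists z; split=> //; rewrite ey ez exprS mulrA.
Qed.

Lemma abs_natM (x y : Z) : Z.abs_nat (x * y) = (Z.abs_nat x * Z.abs_nat y)%N.
Proof. exact: Zabs2Nat.inj_mul. Qed.

Lemma abs_natX (x : Z) k : Z.abs_nat (x ^+ k) = (Z.abs_nat x ^ k)%N.
Proof. by elim: k => // k IH; rewrite exprS expnS -IH abs_natM. Qed.

Lemma seventh_power_ratio (n v w : Z) : v != 0 -> n != 0 -> `|n| < 25 * `|v| ->
    n ^+ 7 = v ^+ 7 * w ->
  exists m, [/\ Z.abs_nat n = (m * Z.abs_nat v)%N, (0 < m <= 24)%N &
    Z.abs_nat w = (m ^ 7)%N].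
Proof.
move=> v0 n0 nx nvw; have nv : (0 < Z.abs_nat v)%N by clear -v0; lia.
have [m em] : exists m, Z.abs_nat n = (m * Z.abs_nat v)%N.
  apply/dvdnP; rewrite -(dvdn_pexp2r _ _ (isT : 0 < 7)%N) -!abs_natX nvw.
  rewrite (abs_natM (v ^+ 7)); exact: dvdn_mulr (dvdnn _).
exists m; split=> //.
  have n25 : (Z.abs_nat n < 25 * Z.abs_nat v)%N by clear -nx; lia.
  move: n25; rewrite em ltn_pmul2r // => m25.
  by case: m em m25 => [em _|m _]; [clear -em n0; lia|rewrite ltnS].
have v7 : (0 < Z.abs_nat v ^ 7)%N by rewrite expn_gt0 nv.
apply/eqP; rewrite -(eqn_pmul2l v7) -expnMn [(_ * m)%N]mulnC -em -!abs_natX nvw.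
by rewrite (abs_natM (v ^+ 7)).
Qed.

(** Since [sg] acts on the conjugates of [theta] as [t -> t ^ 2 - 2], an ideal containing
    [theta - c] contains each conjugate of [theta] up to an integer; with [v] this gives a lattice
    of index [|v|]. *)
Lemma ideal_small_norm (g : O6) (v c : Z) : v != 0 ->
    (exists p q, th - cst c = p * cst v + q * g) ->
  exists x, [/\ x != 0, `|nm x| < 25 * `|v| & exists p q, x = p * cst v + q * g].
Proof.
move=> v0 hc; pose J y := exists p q, y = p * cst v + q * g.
have JD y z : J y -> J z -> J (y + z).
  case=> p [q ->] [p' [q' ->]]; exists (p + p'), (q + q'); ring.
have JM y z : J y -> J (z * y) by case=> p [q ->]; exists (z * p), (z * q); ring.
have Jth k : {n | J (iter k sg th - cst n)}.
  elim: k => [|k [n Jn]]; first by exists c.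
  exists (n ^+ 2 - 2); rewrite theta_sqr.
  have -> : iter k sg th ^+ 2 - cst 2 - cst (n ^+ 2 - 2) =
    (iter k sg th + cst n) * (iter k sg th - cst n).
    by rewrite (rmorphB cst) (rmorphXn cst) /=; ring.
  exact: JM.
pose cc : 'cV[Z]_5 := \col_(j < 5) sval (Jth j).
have [n [y]] := small_norm_element cc v0; set x := of_row _ _ => -[x0 nx].
exists x; split=> //; change (J x).
have -> : x = cst n * cst v + cst (y 0 0) * (iter 0 sg th - cst (cc 0 0))
    + cst (y 0 1) * (iter 1 sg th - cst (cc 1 0))
    + cst (y 0 2) * (iter 2 sg th - cst (cc 2 0))
    + cst (y 0 3) * (iter 3 sg th - cst (cc 3 0))
    + cst (y 0 4) * (iter 4 sg th - cst (cc 4 0)).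
  rewrite /x /of_row; have -> : (y *m cc) 0 0 = y 0 0 * cc 0 0 + y 0 1 * cc 1 0 +
    y 0 2 * cc 2 0 + y 0 3 * cc 3 0 + y 0 4 * cc 4 0 by rewrite mxE sum5.
  by rewrite (rmorphB cst) !(rmorphD cst) !(rmorphM cst) /=; ring.
have Jc k (j : 'I_5) : J (cst k * (iter j sg th - cst (cc j 0))).
  by apply: JM; rewrite mxE; apply: svalP (Jth j).
apply: (JD); last exact: (Jc _ 4).
apply: (JD); last exact: (Jc _ 3).
apply: (JD); last exact: (Jc _ 2).
apply: (JD); last exact: (Jc _ 1).
apply: (JD); last exact: (Jc _ 0).
by exists (cst n), 0; ring.
Qed.

(** As [g] divides [nm g = v ^ 7], the small element [x] of [(v, g)] satisfies [x ^ 7 = g w], with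
    [nm w] equal up to sign to [m ^ 7] for [m = |nm x| / |v| <= 24]. Either [w] is a unit, or it is
    [kap ^ 7] times a unit and [kap] divides [x]. *)
Lemma seventh_power_descent (g : O6) (v c : Z) : v != 0 -> nm g = v ^+ 7 ->
    (exists p q, th - cst c = p * cst v + q * g) ->
  exists e b, divides e 1 /\ g = e * b ^+ 7.
Proof.
move=> v0 ng hc; have [x [x0 nx [p [q ex]]]] := ideal_small_norm v0 hc.
have [w ew] : divides g (x ^+ 7).
  rewrite ex; apply: (@eqmod_divides _ _ _ ((p * cst v) ^+ 7)).
    by apply: eqmodX; exists q; ring.
  rewrite exprMn -rmorphXn /= -ng; exact/divides_mull/divides_nm.
have nxw : nm x ^+ 7 = v ^+ 7 * nm w by rewrite -nmX ew nmM ng.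
have nx0 : nm x != 0 by apply: contra_neq x0; apply: nm_eq0.
have [m [em m24 nw]] := seventh_power_ratio v0 nx0 nx nxw.
case: (nm_seventh_power_small nw m24) => em1; rewrite {}em1 in nw em.
  have [w' ew'] : divides w 1 by apply: nm_unit.
  exists w', x; split; first by exists w; rewrite mulrC.
  by rewrite ew -[LHS]mulr1 ew'; ring.
have [e [ewe ne]] := nm_13_pow nw.
have [x' ex'] : divides kap x.
  by apply: nm_13_kap; exists (Z.sgn (nm x) * Z.of_nat (Z.abs_nat v))%R; clear -em; lia.
have [e' ee'] : divides e 1 by apply: nm_unit.
have k0 : kap ^+ 7 != 0.
  have : nm (kap ^+ 7) != 0 by rewrite nmX nm_kap expf_neq0.
  by apply: contra_neq => ->; rewrite (nm_cst 0) expr0n.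
exists e', x'; split; first by exists e; rewrite mulrC.
have ex7 : x' ^+ 7 = g * e.
  by apply: (O6_mulfI k0); rewrite -exprMn -ex' ew ewe; ring.
by rewrite ex7 -[LHS]mulr1 ee'; ring.
Qed.

(** * Units modulo seventh powers *)

Definition absk (k : nat) (x : O6) : algC := `|emb (iter k sg x)|.

Lemma abskM k x y : absk k (x * y) = absk k x * absk k y.
Proof. by rewrite /absk iter_sgM rmorphM normrM. Qed.

Lemma absk1 k : absk k 1 = 1.
Proof. by rewrite /absk (iter_sg_cst k 1) rmorph1 normr1. Qed.

Lemma abskX k n x : absk k (x ^+ n) = absk k x ^+ n.
Proof. by elim: n => [|n IH]; rewrite ?absk1 // !exprS abskM IH. Qed.

Lemma absk_prod (I : finType) k (F : I -> O6) : absk k (\prod_i F i) = \prod_i absk k (F i).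
Proof. by apply: (big_morph (absk k) (abskM k) (absk1 k)). Qed.

Lemma absk_ge0 k x : 0 <= absk k x.
Proof. exact: normr_ge0. Qed.

Lemma absk_real k x : absk k x \is Num.real.
Proof. exact: normr_real. Qed.

(** The field is real, and the only real seventh root of 1 is 1. *)
Lemma O6_eq_pow7 (x y : O6) : divides y 1 -> x ^+ 7 = y ^+ 7 -> x = y.
Proof.
case=> y' ey; set t := x * y'; move=> e7.
have t7 : t ^+ 7 = 1 by rewrite exprMn e7 -exprMn -ey expr1n.
suff t1 : t = 1 by rewrite -[x]mulr1 ey mulrCA -/t t1 mulr1.
have et7 : emb t ^+ 7 = 1 by rewrite -rmorphXn t7 rmorph1.
have nt : `|emb t| = 1.
  apply/eqP; rewrite -(@pexpr_eq1 _ _ 7) ?normr_ge0 //.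
  by rewrite -normrX et7 normr1.
have et1 : emb t = 1.
  case: (real_ge0P (emb_real t)) nt => _ // e; move/eqP: et7.
  have -> : emb t = -1 by rewrite -[LHS]opprK e.
  by rewrite -signr_odd expr1 eqNr oner_eq0.
have : nm (t - 1) = 0.
  apply: ZC_inj; rewrite emb_nm big_ord_recl /= rmorphB /= et1 rmorph1 subrr mul0r.
  by rewrite rmorph0.
by move/nm_eq0/eqP; rewrite subr_eq0 => /eqP.
Qed.

Lemma absk_unit_prod x : divides x 1 -> \prod_(l < 6) absk l x = 1.
Proof.
move/unit_nm => un; rewrite -normr_prod -emb_nm.
have [->|->] : nm x = 1 \/ nm x = -1 by lia.
  by rewrite rmorph1 normr1.
by rewrite rmorphN rmorph1 normrN1.
Qed.

Lemma ZC_norm_lt (z : Z) (m : nat) : `|ZC z| < m%:R ->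
  (- Z.of_nat m <= z <= Z.of_nat m)%R.
Proof.
have -> : `|ZC z| = (int_of_Z `|z|)%:~R by rewrite /ZC -intr_norm; congr (_%:~R); lia.
by rewrite -[m%:R]/((Posz m)%:~R) ltr_int; lia.
Qed.

Lemma shift_inord_inj (m : nat) (a b : Z) : (- Z.of_nat m <= a <= Z.of_nat m)%R ->
    (- Z.of_nat m <= b <= Z.of_nat m)%R ->
    inord (Z.to_nat (a + Z.of_nat m)%R) = inord (Z.to_nat (b + Z.of_nat m)%R) :> 'I_(2 * m).+1 ->
  a = b.
Proof.
move=> ha hb /(congr1 val) /=.
have a1 : (Z.to_nat (a + Z.of_nat m)%R < (2 * m).+1)%N by lia.
have b1 : (Z.to_nat (b + Z.of_nat m)%R < (2 * m).+1)%N by lia.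
by rewrite !inordK //; lia.
Qed.

(** The pigeonhole count: [n ^ 6] exponent vectors against [(c n) ^ 5] logarithmic cells, five
    coordinates because the norm fixes the sixth absolute value of a unit, and [w] bounded
    elements. *)
Lemma sixth_power_dominates (c w : nat) : exists n, (0 < n /\ (c * n) ^ 5 * w < n ^ 6)%N.
Proof.
have [k ek] : exists k, k = (c ^ 5 * w)%N by exists (c ^ 5 * w)%N.
exists k.+1; split=> //.
by rewrite expnMn mulnAC -ek (expnS _ 5) ltn_pmul2r ?ltnSn // expn_gt0.
Qed.

Section SixUnits.
Variables u v : 'I_6 -> O6.
Hypothesis uv : forall i, u i * v i = 1.

Let zu (m : 'I_6 -> nat) := \prod_i u i ^+ m i.
Let zv (m : 'I_6 -> nat) := \prod_i v i ^+ m i.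

Lemma zuv m : zu m * zv m = 1.
Proof.
rewrite -big_split /= big1 // => i _; by rewrite -exprMn uv expr1n.
Qed.

(** If all exponents agree modulo 7, cancelling common factors leaves an equality of seventh powers,
    hence of their roots, with smaller exponents. Truncated subtraction does the cancelling: at each
    index one of [m'] and [n'] is 0. *)
Lemma relation_not_mod7 K (m n : 'I_6 -> nat) : (forall i, m i < K /\ n i < K)%N ->
    (exists i, m i != n i) -> zu m = zu n ->
  exists m' n', (exists i, (m' i != n' i %[mod 7])%N) /\ zu m' = zu n'.
Proof.
elim: K m n => [|K IH] m n; first by move=> h; case: (h ord0).
move=> bd ne e.
case: (boolP [exists i, m i != n i %[mod 7]]%N) => [/existsP[i hi]|].
  by exists m, n; split=> //; exists i.
rewrite negb_exists => /forallP h7.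
pose m' i := ((m i - n i) %/ 7)%N; pose n' i := ((n i - m i) %/ 7)%N.
have mn i : (m i + 7 * n' i = n i + 7 * m' i)%N.
  by have := h7 i; rewrite negbK /m' /n' => /eqP; lia.
apply: (IH m' n').
- by move=> i; have := bd i; case: ne => j nj; have := bd j; rewrite /m' /n'; lia.
- case: ne => i ni; exists i; have := mn i; lia.
apply: O6_eq_pow7; first by exists (zv n'); rewrite zuv.
have : zu m * zu n' ^+ 7 = zu n * zu m' ^+ 7.
  rewrite /zu -!prodrXl -!big_split /=; apply: eq_bigr => i _.
  by rewrite -!exprM -!exprD ![(_ * 7)%N]mulnC mn.
rewrite e => /(congr1 (fun x => zv n * x)).
by rewrite !(mulrA (zv n) (zu n)) [zv n * zu n]mulrC zuv !mul1r => ->.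
Qed.

Let B : algC := 1 + \sum_i \sum_(k < 6) (absk k (u i) + absk k (v i)).

Lemma B_real : B \is Num.real.
Proof.
rewrite rpredD ?real1 // rpred_sum // => i _; rewrite rpred_sum // => k _.
by rewrite rpredD ?absk_real.
Qed.

Lemma sum_ge_term (I : finType) (F : I -> algC) i :
  (forall j, 0 <= F j) -> F i <= \sum_j F j.
Proof.
by move=> F0; rewrite (bigD1 i) //= lerDl sumr_ge0.
Qed.

Lemma B_ge i (k : 'I_6) : absk k (u i) <= B /\ absk k (v i) <= B.
Proof.
have F0 j (l : 'I_6) : 0 <= absk l (u j) + absk l (v j) by rewrite addr_ge0 ?absk_ge0.
have le : absk k (u i) + absk k (v i) <= B.
  apply: (@le_trans _ _ (\sum_i \sum_(k < 6) (absk k (u i) + absk k (v i)))); last first.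
    by rewrite /B lerDr ler01.
  apply: le_trans (sum_ge_term _ _); last by move=> j; apply: sumr_ge0 => l _.
  exact: sum_ge_term.
by split; apply: le_trans le; rewrite ?lerDl ?lerDr absk_ge0.
Qed.

Lemma B_ge1 : 1 <= B.
Proof.
rewrite lerDl; apply: sumr_ge0 => i _; apply: sumr_ge0 => k _.
by rewrite addr_ge0 ?absk_ge0.
Qed.

Lemma B_gt0 : 0 < B. Proof. exact: lt_le_trans ltr01 B_ge1. Qed.

Lemma absk_zu N m (k : 'I_6) : (forall i, m i <= N)%N ->
  absk k (zu m) <= B ^+ (6 * N) /\ absk k (zv m) <= B ^+ (6 * N).
Proof.
move=> mN; have e : B ^+ (6 * N) = \prod_(i < 6) B ^+ N.
  by rewrite prodr_const card_ord -exprM mulnC.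
have bd i x : 0 <= x -> x <= B -> 0 <= x ^+ m i <= B ^+ N.
  move=> x0 xB; rewrite exprn_ge0 //=; apply: (@le_trans _ _ (B ^+ m i)).
    by rewrite lerXn2r ?nnegrE // ltW ?B_gt0.
  by rewrite ler_weXn2l ?B_ge1.
by rewrite e !absk_prod; split; apply: ler_prod => i _; rewrite abskX bd ?absk_ge0 //;
  case: (B_ge i k).
Qed.

Section Cells.
Variable N : nat.
Let M := (6 * N)%N.

(** A logarithm of [absk k x] in base [B], rounded up and shifted by [M] so as to be a natural
    number. *)
Definition cell (k : nat) (x : O6) : nat :=
  find (fun q => absk k x * B ^+ M <= B ^+ q) (iota 0 (2 * M).+1).

Lemma cellP k x : absk k x <= B ^+ M -> (cell k x <= 2 * M)%N /\
  absk k x * B ^+ M <= B ^+ cell k x.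
Proof.
move=> xB; have h : has (fun q => absk k x * B ^+ M <= B ^+ q) (iota 0 (2 * M).+1).
  apply/hasP; exists (2 * M)%N; first by rewrite mem_iota; lia.
  by rewrite mul2n -addnn exprD; apply: ler_wpM2r xB; apply/ltW/exprn_gt0/B_gt0.
have := h; rewrite has_find size_iota ltnS => le; split=> //.
by have := nth_find 0%N h; rewrite nth_iota // add0n.
Qed.

Lemma cell_le k x y y' : y * y' = 1 -> absk k x <= B ^+ M -> absk k y <= B ^+ M ->
  absk k y' <= B ^+ M -> cell k x = cell k y -> absk k x <= B * absk k y.
Proof.
move=> yy xB yB y'B e; have [_ hx] := cellP xB; have [cy _] := cellP yB.
have BM : 0 < B ^+ M by rewrite exprn_gt0 ?B_gt0.
rewrite -(ler_pM2r BM) -mulrA; apply: le_trans hx _; rewrite e.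
case ec: (cell k y) => [|q].
  (* In the lowest cell, the bound on the inverse [y'] gives [1 <= absk k y * B ^+ M]. *)
  rewrite expr0; apply: (@le_trans _ _ (absk k y * B ^+ M)).
    by rewrite -(absk1 k) -yy abskM ler_wpM2l ?absk_ge0.
  by rewrite ler_peMl ?B_ge1 // mulr_ge0 ?absk_ge0 ?ltW.
rewrite exprS ler_pM2l ?B_gt0 // ltW // real_ltNge.
- have := @before_find _ 0%N (fun q => absk k y * B ^+ M <= B ^+ q) (iota 0 (2 * M).+1) q.
  rewrite -/(cell k y) ec ltnSn => /(_ isT); rewrite nth_iota ?add0n; last by lia.
  by move=> ->.
- by rewrite rpredX ?B_real.
- by rewrite rpredM ?absk_real ?rpredX ?B_real.
Qed.

End Cells.

Let Ct : algC := \sum_(j < 6) \sum_(k < 6) absk k (iter j sg th - cst 2).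

Lemma Ct_ge (j k : 'I_6) : absk k (iter j sg th - cst 2) <= Ct.
Proof.
apply: le_trans (sum_ge_term j _) => [|i]; last by apply: sumr_ge0 => l _; apply: absk_ge0.
by apply: (sum_ge_term k) => l; apply: absk_ge0.
Qed.

Definition coord (x : O6) (j : 'I_6) : Z := nth 0 [:: x0_ x; x1_ x; x2_ x; x3_ x; x4_ x; x5_ x] j.

(** The [(iter j sg th - 2) / 13] form the basis dual to the conjugates of [th] for the trace, so
    bounds on conjugates become bounds on coordinates. *)
Lemma coord_tr x j : 13 * coord x j = tr (x * (iter j sg th - cst 2)).
Proof.
case: x => a b c d e f; case: j => -[|[|[|[|[|[|//]]]]]] jj;
 rewrite /coord /= oppOE addOE mulOE /tr /=; lia.
Qed.

Lemma coord_inj x y : (forall j, coord x j = coord y j) -> x = y.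
Proof.
move=> h; apply: O6_eqP.
- exact: (h (@Ordinal 6 0 isT)).
- exact: (h (@Ordinal 6 1 isT)).
- exact: (h (@Ordinal 6 2 isT)).
- exact: (h (@Ordinal 6 3 isT)).
- exact: (h (@Ordinal 6 4 isT)).
- exact: (h (@Ordinal 6 5 isT)).
Qed.

Lemma coord_bound x j : (forall k : 'I_6, absk k x <= B ^+ 5) ->
  `|ZC (coord x j)| <= B ^+ 5 * Ct *+ 6.
Proof.
move=> xB; have B5 : 0 <= B ^+ 5 by rewrite exprn_ge0 ?ltW ?B_gt0.
apply: (@le_trans _ _ `|ZC (13 * coord x j)%R|).
  have -> : ZC (13 * coord x j)%R = 13 * ZC (coord x j).
    by rewrite rmorphM; congr (_ * _); apply: (rmorph_nat ZC 13).
  by rewrite normrM ler_peMl ?normr_ge0 // normr_nat ler1n.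
rewrite coord_tr emb_tr; apply: le_trans (ler_norm_sum _ _ _) _.
rewrite -[X in _ <= _ *+ X](card_ord 6) -sumr_const; apply: ler_sum => k _.
rewrite -/(absk k _) abskM.
by apply: ler_pM; [exact: absk_ge0|exact: absk_ge0|exact: xB|exact: Ct_ge].
Qed.

(** Dirichlet's argument for rank at most 5. Divide each [zu n] by a representative of its cell: the
    quotient and its inverse have five conjugates of absolute value at most [B], so the sixth is at
    most [B ^ 5], the norm being 1 or -1. These quotients form a finite set, hence two exponent
    vectors share cell and quotient and give the same unit. *)
Lemma six_units_relation : exists m n : 'I_6 -> nat,
  (exists i, (m i != n i %[mod 7])%N) /\ zu m = zu n.
Proof.
have [M2 M2P] : exists M2 : nat, B ^+ 5 * Ct *+ 6 < M2%:R.
  exists (Num.bound (B ^+ 5 * Ct *+ 6)).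
  apply: archi_boundP; rewrite mulrn_wge0 // mulr_ge0 //.
    by apply/ltW/exprn_gt0/B_gt0.
  by apply: sumr_ge0 => j _; apply: sumr_ge0 => k _; apply: absk_ge0.
have [N [N0 NP]] : exists N, (0 < N /\ (13 * N) ^ 5 * (2 * M2).+1 ^ 6 < N ^ 6)%N.
  exact: sixth_power_dominates.
pose T := {ffun 'I_6 -> 'I_N}.
pose Zu (n : T) := zu (fun i => n i); pose Zv (n : T) := zv (fun i => n i).
have Zuv n : Zu n * Zv n = 1 by apply: zuv.
have zuB (n : T) (k : 'I_6) : absk k (Zu n) <= B ^+ (6 * N) /\ absk k (Zv n) <= B ^+ (6 * N).
  by apply: absk_zu => i; apply/ltnW/ltn_ord.
pose cells (n : T) : {ffun 'I_5 -> 'I_(2 * (6 * N)).+1} :=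
  [ffun k : 'I_5 => inord (cell N k (Zu n))].
(* Depends only on the cell of [n]: the default is never reached, since [n] itself qualifies. *)
pose rep (n : T) : T := odflt n [pick n0 | cells n0 == cells n].
have repP n : cells (rep n) = cells n.
  by rewrite /rep; case: pickP => [n0 /eqP|].
pose y (n : T) := Zu n * Zv (rep n).
have yB n (k : 'I_6) : absk k (y n) <= B ^+ 5.
  have w5 (a b : T) (l : 'I_5) : cells a = cells b -> absk l (Zu a * Zv b) <= B.
    move/ffunP/(_ l); rewrite !ffunE => /(congr1 val).
    have [[ca _] [cb _]] := (cellP (zuB a (widen_ord (isT : 5 <= 6)%N l)).1,
      cellP (zuB b (widen_ord (isT : 5 <= 6)%N l)).1).
    rewrite /= !inordK ?ltnS // => ec.
    have [ha _] := zuB a (widen_ord (isT : 5 <= 6)%N l).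
    have [hb hb'] := zuB b (widen_ord (isT : 5 <= 6)%N l).
    have := cell_le (Zuv b) ha hb hb' ec => h.
    have {h} h : absk l (Zu a) <= B * absk l (Zu b) := h.
    have := ler_wpM2r (absk_ge0 l (Zv b)) h.
    by rewrite -abskM -mulrA -(abskM l (Zu b)) Zuv absk1 mulr1.
  have k5 (l : 'I_5) : absk l (y n) <= B by apply: w5.
  have k5' (l : 'I_5) : absk l (Zu (rep n) * Zv n) <= B by apply: w5; rewrite repP.
  have B1 := B_ge1; have B0 := B_gt0.
  case: (ltnP k 5) => k5n.
    apply: le_trans (k5 (Ordinal k5n)) _.
    by rewrite -{1}[B]expr1 ler_weXn2l.
  have -> : absk k (y n) = \prod_(l < 5) absk l (Zu (rep n) * Zv n).
    have ek : (k : nat) = 5%N by apply/eqP; rewrite eqn_leq k5n -ltnS ltn_ord.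
    have y1 : y n * (Zu (rep n) * Zv n) = 1.
      by rewrite /y -[RHS]mulr1 -{1}(Zuv n) -(Zuv (rep n)); ring.
    have pr : \prod_(l < 6) absk l (y n) = 1.
      by apply: absk_unit_prod; exists (Zu (rep n) * Zv n).
    move: pr; rewrite big_ord_recr /= ek => pr.
    have p1 : \prod_(l < 5) absk l (y n) * \prod_(l < 5) absk l (Zu (rep n) * Zv n) = 1.
      by rewrite -big_split big1 // => l _; rewrite /= -abskM y1 absk1.
    have : absk 5 (y n) * (\prod_(l < 5) absk l (y n) *
      \prod_(l < 5) absk l (Zu (rep n) * Zv n)) = absk 5 (y n) by rewrite p1 mulr1.
    by rewrite mulrA [absk 5 _ * _]mulrC pr mul1r => <-.
  rewrite -[5%N in leRHS](card_ord 5) -prodr_const; apply: ler_prod => l _.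
  by rewrite absk_ge0 k5'.
have yc n j : (- Z.of_nat M2 <= coord (y n) j <= Z.of_nat M2)%R.
  exact/ZC_norm_lt/(le_lt_trans (coord_bound j (yB n)) M2P).
pose F (n : T) : {ffun 'I_5 -> 'I_(2 * (6 * N)).+1} * {ffun 'I_6 -> 'I_(2 * M2).+1} :=
  (cells n, [ffun j => inord (Z.to_nat (coord (y n) j + Z.of_nat M2)%R)]).
have /injectivePn[n [n' nn' eF]] : ~~ injectiveb F.
  apply/injectiveP => /leq_card; rewrite card_prod !card_ffun !card_ord.
  apply/negP; rewrite -ltnNge.
  apply: (@leq_ltn_trans ((13 * N) ^ 5 * (2 * M2).+1 ^ 6)).
    (* The origin of the constant 13 in the choice of [N]. *)
    have N13 : ((2 * (6 * N)).+1 <= 13 * N)%N by clear -N0; lia.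
    by rewrite leq_mul2r leq_exp2r // N13 orbT.
  exact: NP.
have [ec ey] : cells n = cells n' /\ y n = y n'.
  case: eF => ec /ffunP ey; split=> //; apply: coord_inj => j.
  by have := ey j; rewrite !ffunE; apply: shift_inord_inj.
have er : rep n = rep n'.
  rewrite /rep ec; case: pickP => [//|h].
  by have := h n'; rewrite eqxx.
apply: (@relation_not_mod7 N (fun i => n i) (fun i => n' i)).
- by move=> i; rewrite !ltn_ord.
- apply/existsP; rewrite -negb_forall; apply: contra nn' => /forallP h.
  by apply/eqP/ffunP => i; apply: val_inj; exact: (eqP (h i)).
change (Zu n = Zu n'); have : y n * Zu (rep n) = y n' * Zu (rep n) by rewrite ey.
by rewrite /y -er -!mulrA [Zv _ * _]mulrC Zuv !mulr1.
Qed.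

End SixUnits.

(** * The logarithm modulo 7 *)

(* For [x] prime to 7 we have [x ^ (7 ^ 6) = x] modulo 7; [lamr x y] says that
   [x ^ (7 ^ 6) = x (1 + 7 y)] modulo 49, so that [y] modulo 7 is a logarithm of [x]
   which vanishes on seventh powers. *)
Definition pow7 (x : O6) : O6 := x ^+ 7.
Definition P7 (x : O6) : O6 := iter 6 pow7 x.
Definition lamr (x y : O6) := eqmod (cst 49) (P7 x) (x * (1 + cst 7 * y)).

Lemma P7M x y : P7 (x * y) = P7 x * P7 y.
Proof. by rewrite /P7; elim: 6%N => // k IH; rewrite !iterS IH /pow7 exprMn. Qed.

Lemma P7X n x : P7 (x ^+ n) = P7 x ^+ n.
Proof.
elim: n => [|n IH]; last by rewrite !exprS P7M IH.
by rewrite !expr0 /P7; elim: 6%N => // k IH; rewrite iterS IH /pow7 expr1n.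
Qed.

Lemma frob7 x : eqmod (cst 7) (x ^+ 7) (iter 5 sg x).
Proof. by apply: (@frobenius 7 5 isT); apply: (@dvdOP 7). Qed.

Lemma frob2 x : eqmod (cst 2) (x ^+ 2) (iter 1 sg x).
Proof. by apply: (@frobenius 2 1 isT); apply: (@dvdOP 2). Qed.

Lemma P7_eqmod x : eqmod (cst 7) (P7 x) x.
Proof.
have h k : eqmod (cst 7) (iter k pow7 x) (iter (5 * k) sg x).
  elim: k => [|k IH]; first exact: eqmod_refl.
  rewrite iterS mulnS iterD; apply: eqmod_trans (frob7 _) _.
  by have := iter_sg_divides 5 IH; rewrite iter_sg_cst iter_sgB.
have := h 6%N; rewrite (_ : iter (5 * 6) sg x = x) //.
by rewrite (iter_sg_dvd x (isT : 6 %| 5 * 6)%N).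
Qed.

Lemma lamrM x y x' y' : lamr x y -> lamr x' y' -> lamr (x * x') (y + y').
Proof.
move=> h h'; rewrite /lamr P7M; apply: eqmod_trans (eqmodM h h') _.
exists (x * x' * y * y'); have -> : cst 49 = cst 7 * cst 7 by []; ring.
Qed.

(** Elements congruent modulo 7, here [P7 x] and [x], have seventh powers congruent modulo 49; the
    witness is the binomial expansion divided by 49. *)
Lemma lamr0 x : lamr (x ^+ 7) 0.
Proof.
rewrite /lamr P7X; have [w ew] := P7_eqmod x.
have -> : P7 x = x + cst 7 * w by rewrite -ew; ring.
have -> : cst 49 = cst 7 * cst 7 by [].
have -> : cst 7 = 7 by rewrite -(rmorph_nat cst 7).
exists (x ^+ 6 * w + 21 * x ^+ 5 * w ^+ 2 + 7 * 35 * x ^+ 4 * w ^+ 3 +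
  7 ^+ 2 * 35 * x ^+ 3 * w ^+ 4 + 7 ^+ 3 * 21 * x ^+ 2 * w ^+ 5 + 7 ^+ 5 * x * w ^+ 6
  + 7 ^+ 5 * w ^+ 7).
ring.
Qed.

Lemma lamr1 : lamr 1 0.
Proof. by have := lamr0 1; rewrite expr1n. Qed.

Lemma lamrX n x y : lamr x y -> lamr (x ^+ n) (y *+ n).
Proof.
move=> h; elim: n => [|n IH]; first exact: lamr1.
by rewrite exprS mulrS; apply: lamrM.
Qed.

Lemma lamr_prod n (F G : 'I_n -> O6) (k : 'I_n -> nat) : (forall j, lamr (F j) (G j)) ->
  lamr (\prod_(j < n) F j ^+ k j) (\sum_(j < n) G j *+ k j).
Proof.
move=> h; apply: (big_ind2 (fun x y => lamr x y)); first exact: lamr1.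
  by move=> x1 x2 y1 y2; apply: lamrM.
by move=> j _; apply: lamrX.
Qed.

Lemma lamr_uniq x y y' : comax (cst 7) x -> lamr x y -> lamr x y' -> eqmod (cst 7) y y'.
Proof.
move=> cx h h'; apply: (comax_Gauss cx).
have [w ew] := eqmod_trans (eqmod_sym h) h'; exists w.
have c7 : cst 7 != 0 by [].
apply: (O6_mulfI c7); have e49 : cst 49 = cst 7 * cst 7 by [].
rewrite e49 in ew; transitivity (cst 7 * cst 7 * w); last by ring.
by rewrite -ew; ring.
Qed.

Lemma lamr_ex x : comax (cst 7) x -> exists y, lamr x y.
Proof.
case=> p [q e]; have [w ew] := P7_eqmod x; exists (q * w).
exists (p * w).
have -> : P7 x = x + cst 7 * w by rewrite -ew; ring.
have -> : cst 49 = cst 7 * cst 7 by [].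
transitivity (cst 7 * w * (1 - q * x)); first by ring.
by rewrite -e; ring.
Qed.

Lemma lamr_cst n : ~ Z.divide 7 n -> exists k, lamr (cst n) (cst k).
Proof.
move=> n7; have [w ew] := P7_eqmod (cst n).
have [m em] : exists m, P7 (cst n) = cst m.
  pose q (z : Z) := z ^+ 7; exists (iter 6 q n); rewrite /P7.
  elim: 6%N => [|j IH]; first by [].
  rewrite !iterS IH /pow7 /q; exact: esym (rmorphXn cst 7 _).
have [k [k' ek]] : exists k k' : Z, k * n + k' * 7 = 1.
  have [q [r [en hr]]] : exists q r : Z, n = 7 * q + r /\ (0 < r < 7).
    exists (Z.div n 7), (Z.modulo n 7).
    have h0 : Z.modulo n 7 <> 0 by move=> h0; apply: n7; apply/Z.mod_divide.
    by have := Z.div_mod n 7; have := Z.mod_pos_bound n 7; lia.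
  have : r = 1 \/ r = 2 \/ r = 3 \/ r = 4 \/ r = 5 \/ r = 6 by clear -hr; lia.
  move=> [|[|[|[|[|]]]]] er; rewrite en er.
  - by exists 1, (- q); ring.
  - by exists 4, (- 1 - 4 * q); ring.
  - by exists 5, (- 2 - 5 * q); ring.
  - by exists 2, (- 1 - 2 * q); ring.
  - by exists 3, (- 2 - 3 * q); ring.
  - by exists 6, (- 5 - 6 * q); ring.
have [m' em'] : Z.divide 7 (m - n).
  apply: (@divides_cst_inj 7 (m - n)); exists w.
  by rewrite rmorphB /= -em.
exists (m' * k); exists (cst (k' * m')).
have c1 : (1 : O6) = cst 1 by [].
rewrite em c1 -(rmorphM cst 7) -(rmorphD cst 1) -(rmorphM cst n) -(rmorphB cst m).
rewrite -(rmorphM cst 49); congr cst.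
have -> : m = n + 7 * m' by lia.
transitivity (7 * m' * (1 - k * n)); first by ring.
by rewrite -ek; ring.
Qed.

Definition redO (n : Z) (x : O6) : O6 :=
  let: MkO y0 y1 y2 y3 y4 y5 := x in
  MkO (Z.modulo y0 n) (Z.modulo y1 n) (Z.modulo y2 n)
      (Z.modulo y3 n) (Z.modulo y4 n) (Z.modulo y5 n).

Definition pow7m (z : O6) : O6 :=
  let z2 := redO 49 (z * z) in redO 49 (z2 * redO 49 (z2 * redO 49 (z2 * z))).
Definition P7m (x : O6) : O6 := iter 6 pow7m x.

Lemma redO_eqmod n x : n != 0 -> eqmod (cst n) (redO n x) x.
Proof.
move/eqP=> n0; case: x => y0 y1 y2 y3 y4 y5; apply/divides_cstP.
have d y : Z.divide n (Z.modulo y n - y)%R.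
  by exists (- Z.div y n)%R; have := Z.div_mod y n n0; lia.
by split; split; apply: d.
Qed.

Lemma P7m_eqmod x : eqmod (cst 49) (P7m x) (P7 x).
Proof.
suff h j : eqmod (cst 49) (iter j pow7m x) (iter j pow7 x) by apply: h.
elim: j => [|j IH]; first exact: eqmod_refl.
rewrite !iterS; move: (iter j pow7m x) (iter j pow7 x) IH => z z' e; rewrite /pow7 /pow7m.
have r y : eqmod (cst 49) (redO 49 y) y by apply: redO_eqmod.
have e2 : eqmod (cst 49) (redO 49 (z * z)) (z' * z').
  by apply: eqmod_trans (r _) _; apply: eqmodM.
have -> : z' ^+ 7 = z' * z' * (z' * z' * (z' * z' * z')) by ring.
apply: eqmod_trans (r _) _; apply: (eqmodM e2).
apply: eqmod_trans (r _) _; apply: (eqmodM e2).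
by apply: eqmod_trans (r _) _; apply: (eqmodM e2).
Qed.

Lemma lamr_check x y : dvdO 49 (P7m x - x * (1 + cst 7 * y)) -> lamr x y.
Proof.
move=> h; apply: eqmod_trans (eqmod_sym (P7m_eqmod x)) _; exact: dvdOP.
Qed.

Definition lth : O6 := MkO 2 4 1 4 0 3.

Lemma lamr_sg k x y : lamr x y -> lamr (iter k sg x) (iter k sg y).
Proof.
have P7s : P7 (iter k sg x) = iter k sg (P7 x).
  by rewrite /P7; elim: 6%N => // j IH; rewrite !iterS IH /pow7 iter_sgX.
rewrite /lamr P7s; move: (P7 x) => p /(iter_sg_divides k).
by rewrite iter_sg_cst iter_sgB iter_sgM iter_sgD iter_sgM (iter_sg_cst k 1) iter_sg_cst.
Qed.

Lemma lamr_th k : lamr (iter k sg th) (iter k sg lth).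
Proof. by apply: lamr_sg; apply: lamr_check; vm_compute. Qed.

Lemma unit_th k : divides (iter k sg th) 1.
Proof.
apply: nm_unit; rewrite nm_iter_sg.
by have -> : nm th = -1 by apply: nm_eqP; vm_compute.
Qed.

Lemma comax_unit_r (R : comNzRingType) (n x : R) : divides x 1 -> comax n x.
Proof. by move=> ux; apply/comax_sym/comax_unit. Qed.

Lemma mul_cstE n x : cst n * x =
  MkO (n * x0_ x) (n * x1_ x) (n * x2_ x) (n * x3_ x) (n * x4_ x) (n * x5_ x).
Proof. by case: x => *; rewrite mulOE; apply: O6_eqP => /=; lia. Qed.

(** Together with 1, the five logarithms form a basis modulo 7. The coefficients of the [k_i] are
    rows of the inverse modulo 7 of the 6 by 6 matrix of coordinates; the other terms absorb the
    multiples of 7. *)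
Lemma lth_independent (d0 d1 d2 d3 d4 r : Z) :
    divides (cst 7) (cst d0 * lth + cst d1 * iter 1 sg lth + cst d2 * iter 2 sg lth +
      cst d3 * iter 3 sg lth + cst d4 * iter 4 sg lth - cst r) ->
  [/\ Z.divide 7 d0, Z.divide 7 d1, Z.divide 7 d2, Z.divide 7 d3 & Z.divide 7 d4].
Proof.
have -> : cst d0 * lth + cst d1 * iter 1 sg lth + cst d2 * iter 2 sg lth +
      cst d3 * iter 3 sg lth + cst d4 * iter 4 sg lth - cst r =
    MkO (d0 * 2 + d1 * 3 + d3 * 4 + d4 + r) (d0 * 4 + d1 * 2 + d2 * 3 + d4 * 4 + r)
        (d0 + d1 * 4 + d2 * 2 + d3 * 3 + r) (d0 * 4 + d1 + d2 * 4 + d3 * 2 + d4 * 3 + r)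
        (d1 * 4 + d2 + d3 * 4 + d4 * 2 + r) (d0 * 3 + d2 * 4 + d3 + d4 * 4 + r).
  by rewrite !mul_cstE !oppOE !addOE; apply: O6_eqP => /=; lia.
move/divides_cstP => /= -[[[k0 e0] [k1 e1] [k2 e2]] [[k3 e3] [k4 e4] [k5 e5]]].
split.
- by exists (k0 * 1 + k1 * 1 + k2 * 6 + k3 * 3 + k4 * 6 + k5 * 4 - d0 * 5 - d1 * 8 - d2 * 7 -
  d3 * 8 - d4 * 6 - r * 3)%R; lia.
- by exists (k0 * 5 + k1 * 2 + k3 * 2 + k4 * 2 + k5 * 3 - d0 * 5 - d1 * 4 - d2 * 4 - d3 * 5 -
  d4 * 5 - r * 2)%R; lia.
- by exists (k0 * 4 + k1 * 6 + k2 * 1 + k3 * 3 + k4 * 1 + k5 * 6 - d0 * 9 - d1 * 5 - d2 * 8 -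
  d3 * 5 - d4 * 9 - r * 3)%R; lia.
- by exists (k1 * 5 + k2 * 5 + k3 * 4 + k4 * 2 + k5 * 5 - d0 * 8 - d1 * 6 - d2 * 9 - d3 * 5 -
  d4 * 8 - r * 3)%R; lia.
- by exists (k0 * 6 + k1 * 1 + k2 * 4 + k3 * 1 + k4 * 3 + k5 * 6 - d0 * 6 - d1 * 7 - d2 * 6 -
  d3 * 8 - d4 * 6 - r * 3)%R; lia.
Qed.

Lemma inverse_mod7 (d : nat) : (d != 0 %[mod 7])%N -> exists c q, (c * d = 7 * q + 1)%N.
Proof.
move=> d7; have [r [q [er hr]]] : exists r q, (d = 7 * q + r /\ 0 < r < 7)%N.
  by exists (d %% 7)%N, (d %/ 7)%N; lia.
have : (r = 1 \/ r = 2 \/ r = 3 \/ r = 4 \/ r = 5 \/ r = 6)%N by clear -hr; lia.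
rewrite er => -[|[|[|[|[|]]]]] ->.
- by exists 1%N, q; lia.
- by exists 4%N, (4 * q + 1)%N; lia.
- by exists 5%N, (5 * q + 2)%N; lia.
- by exists 2%N, (2 * q + 1)%N; lia.
- by exists 3%N, (3 * q + 2)%N; lia.
- by exists 6%N, (6 * q + 5)%N; lia.
Qed.

Lemma unit_prod n (T : 'I_n -> O6) (k : 'I_n -> nat) : (forall j, divides (T j) 1) ->
  divides (\prod_(j < n) T j ^+ k j) 1.
Proof.
move=> uT; apply: (big_ind (fun x => divides x 1)); first exact: divides_refl.
  by move=> x y [x' ex] [y' ey]; exists (x' * y'); rewrite mulrACA -ex -ey mulr1.
by move=> j _; have [z ez] := uT j; exists (z ^+ k j); rewrite -exprMn -ez expr1n.
Qed.

Lemma unit_pow (x : O6) k : divides x 1 -> divides (x ^+ k) 1.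
Proof. by case=> z ez; exists (z ^+ k); rewrite -exprMn -ez expr1n. Qed.

(** With [c (a - b) = 7 q + 1], raising the relation to the power [c] isolates [e] modulo seventh
    powers; exponents being natural numbers, [6 c] stands for [- c]. *)
Lemma unit_relation_solve n (T : 'I_n -> O6) (e : O6) (a b : nat) (f g : 'I_n -> nat) :
    (forall j, divides (T j) 1) -> divides e 1 -> (b < a)%N -> (a != b %[mod 7])%N ->
    e ^+ a * \prod_(j < n) T j ^+ f j = e ^+ b * \prod_(j < n) T j ^+ g j ->
  exists (k : 'I_n -> nat) y, divides y 1 /\ e = \prod_(i < n) T i ^+ k i * y ^+ 7.
Proof.
move=> uT ue ba nab eab; pose d := (a - b)%N.
have [c [q ecd]] : exists c q, (c * d = 7 * q + 1)%N.
  by apply: inverse_mod7; rewrite /d; clear -ba nab; lia.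
set F := \prod_(j < n) T j ^+ f j in eab; set G := \prod_(j < n) T j ^+ g j in eab.
have ed : e ^+ d * F = G.
  have [z ez] := unit_pow b ue; have ea : e ^+ a = e ^+ b * e ^+ d.
    by rewrite -exprD /d subnKC // ltnW.
  rewrite -[LHS]mul1r -[RHS]mul1r ez.
  transitivity (z * (e ^+ b * e ^+ d * F)); first by ring.
  by rewrite -ea eab; ring.
have [w ew] : divides (e ^+ q * F ^+ c) 1.
  have [x ex] := unit_pow q ue; have [y ey] := unit_pow c (unit_prod f uT).
  by exists (x * y); rewrite mulrACA -ex -/F -ey mulr1.
exists (fun j => c * g j + 6 * c * f j)%N, w; split.
  by exists (e ^+ q * F ^+ c); rewrite mulrC.
have -> : \prod_(i < n) T i ^+ (c * g i + 6 * c * f i) = G ^+ c * F ^+ (6 * c).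
  rewrite /F /G -!prodrXl -big_split /=; apply: eq_bigr => j _.
  by rewrite exprD -!exprM [(g j * _)%N]mulnC [(f j * _)%N]mulnC.
rewrite -ed exprMn -exprM mulnC ecd exprD expr1 exprM mulnC exprM.
transitivity (e * (e ^+ q * F ^+ c * w) ^+ 7); first by rewrite -ew expr1n mulr1.
by rewrite [(e ^+ 7) ^+ q]exprAC; ring.
Qed.

(** Apply the pigeonhole relation to [e] and five conjugates of [th]: its two exponents of [e]
    differ modulo 7, so it can be solved for [e]. *)
Lemma units_mod7 e : divides e 1 -> exists (n : 'I_5 -> nat) y,
  divides y 1 /\ e = (\prod_(i < 5) iter i sg th ^+ n i) * y ^+ 7.
Proof.
move=> ue; pose u (i : 'I_6) := oapp (fun j : 'I_5 => iter j sg th) e (unlift ord0 i).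
have uu i : divides (u i) 1 by rewrite /u; case: unlift => [j|] //=; apply: unit_th.
have [v uv] : exists v, forall i, u i * v i = 1.
  have /fin_all_exists[v hv] : forall i, exists z, u i * z = 1.
    by move=> i; case: (uu i) => z ->; exists z.
  by exists v.
have [m [n [[i0 hi0] emn]]] := six_units_relation uv.
have u0 : u ord0 = e by rewrite /u unlift_none.
have uS j : u (lift ord0 j) = iter j sg th by rewrite /u liftK.
have zE (k : 'I_6 -> nat) : \prod_i u i ^+ k i =
    e ^+ k ord0 * \prod_(j < 5) iter j sg th ^+ k (lift ord0 j).
  by rewrite [LHS]big_ord_recl u0; congr (_ * _); apply: eq_bigr => j _; rewrite uS.
have lprod (k : 'I_5 -> nat) : lamr (\prod_(j < 5) iter j sg th ^+ k j)
    (\sum_(j < 5) iter j sg lth *+ k j).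
  by apply: lamr_prod => j; apply: lamr_th.
have [ye lye] := lamr_ex (comax_unit_r (cst 7) ue).
have uprod k := @unit_prod 5 (fun j => iter j sg th) k (fun j => unit_th j).
have ue_pow k := unit_pow k ue.
(* if the two exponents of [e] agreed modulo 7, the logarithms of the
   [iter j sg th] would be dependent *)
have ne : (m ord0 != n ord0 %[mod 7])%N.
  apply/negP => /eqP e0.
  pose m' j := m (lift ord0 j); pose n' j := n (lift ord0 j).
  have lm : lamr (\prod_i u i ^+ m i) (ye *+ m ord0 + \sum_(j < 5) iter j sg lth *+ m' j).
    by rewrite zE; apply: lamrM; [apply: lamrX|apply: lprod].
  have ln : lamr (\prod_i u i ^+ m i) (ye *+ n ord0 + \sum_(j < 5) iter j sg lth *+ n' j).
    by rewrite emn zE; apply: lamrM; [apply: lamrX|apply: lprod].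
  have uz : divides (\prod_i u i ^+ m i) 1.
    by rewrite zE; case: (ue_pow (m ord0)) (uprod m') => z ez [z' ez'];
      exists (z * z'); rewrite mulrACA -ez -ez' mulr1.
  have := lamr_uniq (comax_unit_r (cst 7) uz) lm ln.
  have nat7 (x : O6) (a b : nat) : x *+ a - x *+ b = cst (Z.of_nat a - Z.of_nat b)%R * x.
    by rewrite (rmorphB cst) mulrBl /= -!natr_cst !mulr_natl.
  have h0 : divides (cst 7) (ye *+ m ord0 - ye *+ n ord0).
    rewrite nat7; apply/divides_mulr/divides_cst.
    exists (Z.of_nat (m ord0 %/ 7) - Z.of_nat (n ord0 %/ 7))%R; lia.
  move=> h1; have := divides_add h1 (divides_opp h0).
  set X := (X in divides _ X).
  have -> : X = \sum_(j < 5) cst (Z.of_nat (m' j) - Z.of_nat (n' j))%R * iter j sg lth.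
    under eq_bigr do rewrite -nat7; rewrite sumrB /X; ring.
  rewrite !big_ord_recr big_ord0 /= add0r -[X in divides _ X]subr0 -[0](rmorph0 cst).
  case/lth_independent => d0 d1 d2 d3 d4.
  have mn7 (a b : nat) : Z.divide 7 (Z.of_nat a - Z.of_nat b)%R -> (a = b %[mod 7])%N.
    by case=> z ez; lia.
  move: hi0; case: (unliftP ord0 i0) => [j ->|->]; last by rewrite e0 eqxx.
  apply/negP; rewrite negbK; apply/eqP/mn7.
  have dj (x y : 'I_5) : Z.divide 7 (Z.of_nat (m' x) - Z.of_nat (n' x))%R ->
      val x = val y -> Z.divide 7 (Z.of_nat (m' y) - Z.of_nat (n' y))%R.
    by move=> dx /val_inj <-.
  case: j => -[|[|[|[|[|//]]]]] jj; rewrite -/(m' (Ordinal jj)) -/(n' (Ordinal jj)).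
  - exact: dj d0 _.
  - exact: dj d1 _.
  - exact: dj d2 _.
  - exact: dj d3 _.
  - exact: dj d4 _.
rewrite !zE in emn.
case: (ltngtP (m ord0) (n ord0)) => hmn; last by rewrite hmn eqxx in ne.
  by apply: (unit_relation_solve _ ue hmn _ (esym emn)) => [j|]; [apply: unit_th|rewrite eq_sym].
by apply: (unit_relation_solve _ ue hmn ne emn) => j; apply: unit_th.
Qed.

(** Modulo seventh powers [e] is a product of conjugates of [th], whose logarithms are independent
    of each other and of 1: an integral logarithm forces 7 to divide every exponent. *)
Lemma kummer e r : divides e 1 -> lamr e (cst r) -> exists y, divides y 1 /\ e = y ^+ 7.
Proof.
move=> ue ler; have [n [y [uy ey]]] := units_mod7 ue.
have := lamr_prod n (fun j : 'I_5 => lamr_th j) => lp.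
have := lamrM lp (lamr0 y); rewrite -ey addr0 => le.
have := lamr_uniq (comax_unit_r (cst 7) ue) le ler.
have nat7 (x : O6) (a : nat) : x *+ a = cst (Z.of_nat a) * x.
  by rewrite -natr_cst mulr_natl.
rewrite !big_ord_recr big_ord0 /= add0r !nat7 => /lth_independent[d0 d1 d2 d3 d4].
have d7 j : (7 %| n j)%N.
  suff : Z.divide 7 (Z.of_nat (n j)) by case=> z ez; apply/dvdnP; exists (Z.to_nat z); lia.
  have dj (x y' : 'I_5) : Z.divide 7 (Z.of_nat (n x)) ->
      val x = val y' -> Z.divide 7 (Z.of_nat (n y')).
    by move=> dx /val_inj <-.
  case: j => -[|[|[|[|[|//]]]]] jj.
  - exact: dj d0 _.
  - exact: dj d1 _.
  - exact: dj d2 _.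
  - exact: dj d3 _.
  - exact: dj d4 _.
pose z := \prod_(i < 5) iter i sg th ^+ (n i %/ 7).
exists (z * y); split.
  have [z' ez'] : divides z 1 by apply: unit_prod => j; apply: unit_th.
  by case: uy => y' ey'; exists (z' * y'); rewrite mulrACA -ez' -ey' mulr1.
rewrite exprMn ey; congr (_ * _); rewrite /z -prodrXl; apply: eq_bigr => j _.
by rewrite -exprM divnK.
Qed.

(** * A reciprocity between the primes 2 and 7 *)

(** Modulo 7, [ell] kills the integers, is 1 at [lth] and doubles under [sg]. Likewise [z ^ 9]
    modulo 2 is squared by [sg], the Frobenius at 2; hence agreement at [th] extends to its
    conjugates. *)
Definition ell (y : O6) : Z :=
  4 * x0_ y + x1_ y + 2 * x2_ y + 4 * x3_ y + x4_ y + 2 * x5_ y.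

Lemma ellD x y : ell (x + y) = ell x + ell y.
Proof.
case: x y => a b c d e f [a' b' c' d' e' f']; rewrite addOE /ell.
by cbv beta iota delta [addO x0_ x1_ x2_ x3_ x4_ x5_]; lia.
Qed.

(* The character [z ^ 9] of order 7 modulo 2 and the functional [ell] of the
   logarithm modulo 7 agree on units; [good z] says that they agree on [z]. *)
Definition good (z : O6) := exists (n : nat) (y : O6),
  [/\ lamr z y, eqmod (cst 2) (z ^+ 9) (th ^+ 9 ^+ n) & Z.divide 7 (ell y - Z.of_nat n)%R].

Lemma goodM z z' : good z -> good z' -> good (z * z').
Proof.
case=> n [y [h1 h2 h3]] [n' [y' [h1' h2' h3']]]; exists (n + n')%N, (y + y'); split.
- exact: lamrM.
- by rewrite exprMn exprD; apply: eqmodM.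
- case: h3 h3' => k e [k' e']; exists (k + k')%R.
  by rewrite ellD; lia.
Qed.

Lemma good1 : good 1.
Proof.
exists 0%N, 0; split; [exact: lamr1|rewrite expr1n expr0; exact: eqmod_refl|].
by exists 0.
Qed.

Lemma goodX n z : good z -> good (z ^+ n).
Proof.
by move=> gz; elim: n => [|n IH]; [exact: good1|rewrite exprS; apply: goodM].
Qed.

Lemma good_check n z y : dvdO 49 (P7m z - z * (1 + cst 7 * y)) ->
  dvdO 2 (z ^+ 9 - th ^+ 9 ^+ n) -> Z.eqb (Z.modulo (ell y - Z.of_nat n)%R 7) 0 -> good z.
Proof.
move=> h1 h2 /Z.eqb_eq h3; exists n, y; split; first exact: lamr_check.
  exact: dvdOP.
by apply/Z.mod_divide.
Qed.

Lemma good_th (j : 'I_5) : good (iter j sg th).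
Proof.
case: j => -[|[|[|[|[|//]]]]] jj.
- by apply: (@good_check 1%N _ lth); vm_compute.
- by apply: (@good_check 2%N _ (iter 1 sg lth)); vm_compute.
- by apply: (@good_check 4%N _ (iter 2 sg lth)); vm_compute.
- by apply: (@good_check 1%N _ (iter 3 sg lth)); vm_compute.
- by apply: (@good_check 2%N _ (iter 4 sg lth)); vm_compute.
Qed.

Definition lkap : O6 := MkO 0 5 4 4 5 1.

Lemma lamr_kap : lamr kap lkap.
Proof. by apply: lamr_check; vm_compute. Qed.

Lemma good_kap : good kap.
Proof. by apply: (@good_check 1%N _ lkap); vm_compute. Qed.

(** As 2 is inert, the units modulo 2 form a group of order 63, which is 9 times 7. *)
Lemma good_pow7 b : comax (cst 2) b -> good (b ^+ 7).
Proof.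
move=> cb; exists 0%N, 0; split; first exact: lamr0; last by exists 0.
have h k : eqmod (cst 2) (b ^+ (2 ^ k)) (iter (1 * k) sg b).
  exact: (@frobenius_iter 2 1 frob2).
have := h 6%N; rewrite (iter_sg_dvd b (isT : 6 %| 1 * 6)%N) => {}h.
rewrite expr0 -exprM; apply: (comax_Gauss cb).
case: h => z ez; exists z; rewrite -ez mulrBr mulr1 -exprS.
by [].
Qed.

Lemma good_unit e : divides e 1 -> good e.
Proof.
move=> ue; have [n [y [uy ->]]] := units_mod7 ue; apply: goodM.
  apply: (big_ind good); [exact: good1|exact: goodM|].
  by move=> j _; apply: goodX; apply: good_th.
by apply: good_pow7; apply: comax_unit_r.
Qed.

(** * The quadratic extension generated by [al = (-1 + sqrt (-7)) / 2] *)

Record quad (R : comNzRingType) := Quad { re : R; im : R }.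
Arguments Quad {R}.

Section QuadRing.
Variable R : comNzRingType.
Implicit Types x y z : quad R.

Definition quad_pair x := (re x, im x).
Definition pair_quad (p : R * R) := Quad p.1 p.2.
Lemma quad_pairK : cancel quad_pair pair_quad. Proof. by case. Qed.
HB.instance Definition _ := Choice.copy (quad R) (can_type quad_pairK).

Lemma quad_eqP x y : re x = re y -> im x = im y -> x = y.
Proof. by case: x y => a b [c d] /= -> ->. Qed.

Definition addQ x y := Quad (re x + re y) (im x + im y).
Definition oppQ x := Quad (- re x) (- im x).
Definition mulQ x y :=
  Quad (re x * re y - 2 * (im x * im y)) (re x * im y + im x * re y - im x * im y).

Lemma addQA : associative addQ.
Proof. by move=> x y z; apply: quad_eqP => /=; ring. Qed.
Lemma addQC : commutative addQ.
Proof. by move=> x y; apply: quad_eqP => /=; ring. Qed.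
Lemma add0Q : left_id (Quad 0 0) addQ.
Proof. by move=> x; apply: quad_eqP => /=; ring. Qed.
Lemma addNQ : left_inverse (Quad 0 0) oppQ addQ.
Proof. by move=> x; apply: quad_eqP => /=; ring. Qed.
Lemma mulQA : associative mulQ.
Proof. by move=> x y z; apply: quad_eqP => /=; ring. Qed.
Lemma mulQC : commutative mulQ.
Proof. by move=> x y; apply: quad_eqP => /=; ring. Qed.
Lemma mul1Q : left_id (Quad 1 0) mulQ.
Proof. by move=> x; apply: quad_eqP => /=; ring. Qed.
Lemma mulQDl : left_distributive mulQ addQ.
Proof. by move=> x y z; apply: quad_eqP => /=; ring. Qed.
Lemma oneQ_neq0 : Quad 1 0 != Quad 0 0 :> quad R.
Proof. by apply/eqP => -[/eqP]; rewrite oner_eq0. Qed.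

HB.instance Definition _ := GRing.isZmodule.Build (quad R) addQA addQC add0Q addNQ.
HB.instance Definition _ :=
  GRing.Zmodule_isComNzRing.Build (quad R) mulQA mulQC mul1Q mulQDl oneQ_neq0.

Lemma reD x y : re (x + y) = re x + re y. Proof. by []. Qed.
Lemma imD x y : im (x + y) = im x + im y. Proof. by []. Qed.
Lemma reN x : re (- x) = - re x. Proof. by []. Qed.
Lemma imN x : im (- x) = - im x. Proof. by []. Qed.
Lemma reM x y : re (x * y) = re x * re y - 2 * (im x * im y). Proof. by []. Qed.
Lemma imM x y : im (x * y) = re x * im y + im x * re y - im x * im y.
Proof. by []. Qed.
Lemma re1 : re (1 : quad R) = 1. Proof. by []. Qed.
Lemma im1 : im (1 : quad R) = 0. Proof. by []. Qed.
Definition quadE := (reD, imD, reN, imN, reM, imM, re1, im1).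

Definition inQ (a : R) : quad R := Quad a 0.
Lemma inQB : {morph inQ : a b / a - b}.
Proof. by move=> a b; apply: quad_eqP; rewrite !quadE /=; ring. Qed.
Lemma inQM : monoid_morphism inQ.
Proof. by split=> // a b; apply: quad_eqP; rewrite !quadE /=; ring. Qed.
HB.instance Definition _ := GRing.isZmodMorphism.Build R (quad R) inQ inQB.
HB.instance Definition _ := GRing.isMonoidMorphism.Build R (quad R) inQ inQM.

Definition al : quad R := Quad 0 1.
Definition sq7 : quad R := Quad 1 2.

Lemma sq7P : sq7 * sq7 = - 7.
Proof. by apply: quad_eqP; rewrite /= ?quadE /=; ring. Qed.

Lemma divides_inQ (a : R) x : divides a (re x) -> divides a (im x) -> divides (inQ a) x.
Proof.
case=> u eu [v ev]; exists (Quad u v).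
by apply: quad_eqP; rewrite !quadE /= ?eu ?ev; ring.
Qed.

Lemma inQ_divides (a : R) x : divides (inQ a) x -> divides a (re x) /\ divides a (im x).
Proof.
case=> y ->; rewrite !quadE /=.
by split; [exists (re y)|exists (im y)]; ring.
Qed.

End QuadRing.

Section QuadMap.
Variables (R S : comNzRingType) (f : {rmorphism R -> S}).

Definition mapQ (x : quad R) : quad S := Quad (f (re x)) (f (im x)).

Lemma mapQB : {morph mapQ : x y / x - y}.
Proof. by move=> x y; apply: quad_eqP; rewrite ?quadE /= ?quadE rmorphB. Qed.
Lemma mapQM : monoid_morphism mapQ.
Proof.
split; first by apply: quad_eqP; rewrite /= ?rmorph1 ?rmorph0.
move=> x y; apply: quad_eqP; rewrite ?quadE /= ?quadE /=.
  by rewrite rmorphB !rmorphM rmorph_nat.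
by rewrite rmorphB rmorphD !rmorphM.
Qed.
HB.instance Definition _ := GRing.isZmodMorphism.Build (quad R) (quad S) mapQ mapQB.
HB.instance Definition _ := GRing.isMonoidMorphism.Build (quad R) (quad S) mapQ mapQM.

End QuadMap.

(** ** [Z[al]] is Euclidean *)

Definition nA (x : quad Z) : Z := (re x ^+ 2 - re x * im x + 2 * im x ^+ 2)%R.

Lemma nAM x y : nA (x * y) = nA x * nA y.
Proof. by rewrite /nA !quadE; ring. Qed.

Lemma nA_sqr (a b : Z) : 4 * nA (Quad a b) = (2 * a - b) ^+ 2 + 7 * b ^+ 2.
Proof. by rewrite /nA /=; ring. Qed.

Lemma nA_ge0 x : 0 <= nA x.
Proof.
rewrite /nA; move: (re x) (im x) => a b.
have := sqr_ge0 (2 * a - b); have := sqr_ge0 b.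
have -> : (2 * a - b) ^+ 2 = 4 * (a ^+ 2 - a * b + 2 * b ^+ 2) - 7 * b ^+ 2 by ring.
by move: (b ^+ 2) (_ - _ + _) => ? ?; lia.
Qed.

Lemma nA_eq0 x : nA x = 0 -> x = 0.
Proof.
rewrite /nA => h; suff [ha hb] : re x = 0 /\ im x = 0 by apply: quad_eqP.
move: h; move: (re x) (im x) => a b h.
have h4 : (2 * a - b) ^+ 2 + 7 * b ^+ 2 = 0.
  transitivity (4 * (a ^+ 2 - a * b + 2 * b ^+ 2)); first by ring.
  by rewrite h mulr0.
have b0 : b = 0 by move: h4 (sqr_ge0 (2 * a - b)); clear; nia.
by split=> //; move: h4; rewrite b0; clear; nia.
Qed.

Lemma quadZ_lreg (x : quad Z) : x != 0 -> GRing.lreg x.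
Proof.
move=> x0 y z /eqP; rewrite -subr_eq0 -mulrBr => /eqP /(congr1 nA).
rewrite nAM => /eqP; rewrite mulf_eq0 => /orP[] /eqP /nA_eq0; first by move/eqP: x0.
by move/eqP; rewrite subr_eq0 => /eqP.
Qed.

Lemma nearest_Z (n a : Z) : 0 < n -> exists q : Z, - n <= 2 * (a - q * n) <= n.
Proof.
move=> n0; exists (Z.div (2 * a + n) (2 * n)).
have := Z.div_mod (2 * a + n) (2 * n); have := Z.mod_pos_bound (2 * a + n) (2 * n).
move: (Z.div _ _) (Z.modulo _ _) => q r h1 h2; lia.
Qed.

(** The bounds give [N <= 11 n / 16]. They come from rounding the coordinate of [al] first, then the
    other one relative to the remainder [r]. *)
Lemma euclid_bound (n s r N : Z) : 0 < n -> - n <= s <= n -> - n <= 2 * r <= n ->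
  4 * (N * n) = s ^+ 2 + 7 * r ^+ 2 -> N < n.
Proof.
move=> n0 hs hr e4; have s2 : s ^+ 2 <= n ^+ 2 by clear -hs n0; nia.
have r2 : 4 * r ^+ 2 <= n ^+ 2 by clear -hr n0; nia.
have nn : 0 < n * n by rewrite mulr_gt0.
have : N * n < n * n.
  move: e4 s2 r2 nn; rewrite !expr2; move: (s * s) (r * r) (n * n) (N * n) => *; lia.
by rewrite ltr_pM2r.
Qed.

Lemma quadZ_euclid (x y : quad Z) : y != 0 -> exists q, nA (x - q * y) < nA y.
Proof.
move=> y0; have n0 : 0 < nA y.
  by rewrite lt_neqAle nA_ge0 andbT eq_sym; apply: contra_neq y0; apply: nA_eq0.
pose yb := Quad (re y - im y) (- im y); pose n := nA y.
have yyb : y * yb = inQ n by apply: quad_eqP; rewrite !quadE /= /n /nA; ring.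
have nyb : nA yb = n by rewrite /n /nA /yb /=; ring.
pose w := x * yb.
have [q1 h1] := nearest_Z (im w) n0; set r1 := im w - q1 * nA y in h1.
have n20 : 0 < 2 * nA y by lia.
have [q0 h0] := nearest_Z (2 * re w - r1) n20.
exists (Quad q0 q1); set z := x - _.
have ez : z * yb = Quad (re w - q0 * n) r1.
  have ez (w' : quad Z) : w' - Quad q0 q1 * inQ n = Quad (re w' - q0 * n) (im w' - q1 * n).
    by apply: quad_eqP; rewrite !quadE /=; ring.
  by rewrite /z mulrBl -/w -mulrA yyb ez.
have e4 : 4 * (nA z * n) = (2 * (re w - q0 * n) - r1) ^+ 2 + 7 * r1 ^+ 2.
  by rewrite -[X in nA z * X]nyb -nAM ez nA_sqr.
have h0' : - n <= 2 * (re w - q0 * n) - r1 <= n by rewrite /n; clear -h0; lia.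
exact: euclid_bound n0 h0' h1 e4.
Qed.

Lemma quadZ_bezout (x y : quad Z) : exists d p q,
  [/\ divides d x, divides d y & d = p * x + q * y].
Proof.
have [n] := ubnP (Z.to_nat (nA y)); elim: n x y => // n IH x y yn.
case: (eqVneq y 0) => [->|y0].
  exists x, 1, 0; split; [exact: divides_refl|by exists 0; rewrite mulr0|ring].
have [q hq] := quadZ_euclid x y0; have r0 := nA_ge0 (x - q * y).
have [|d [p [p' [d1 d2 ed]]]] := IH y (x - q * y); first by lia.
exists d, p', (p - p' * q); split=> //; last by rewrite ed; ring.
have -> : x = (x - q * y) + q * y by ring.
by apply: divides_add => //; apply: divides_mull.
Qed.

Lemma quadZ_unit (e : quad Z) : divides e 1 -> e = 1 \/ e = - 1.
Proof.
case=> f /(congr1 nA); rewrite nAM => h1.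
have ne : nA e = 1.
  have e0 := nA_ge0 e; have [|] // := Z.eq_mul_1_nonneg (nA e) (nA f) _ (esym h1).
  by clear -e0; lia.
move: ne; rewrite /nA => ne.
have [b0 a1] : im e = 0 /\ (re e = 1 \/ re e = - 1).
  move: ne; move: (re e) (im e) => a b ne.
  have b0 : b = 0 by clear -ne; nia.
  by split=> //; move: ne; rewrite b0; clear; nia.
by case: a1 => ea; [left|right]; apply: quad_eqP; rewrite ?reN ?imN ?re1 ?im1 ?ea ?b0 ?oppr0.
Qed.

Lemma quadZ_mul_pow7 (x y z : quad Z) : x != 0 -> comax x y -> x * y = z ^+ 7 ->
  exists m, x = m ^+ 7 \/ x = - m ^+ 7.
Proof.
move=> x0 cxy exy; have [d [p [q [dx dz ed]]]] := quadZ_bezout x z.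
have [e [ex ue]] := comax_mul_pow dx dz ed cxy exy (quadZ_lreg x0).
by exists d; case: (quadZ_unit ue) ex => -> ->; [left|right]; rewrite ?mul1r ?mulN1r.
Qed.

(** * The second descent *)

(* Taking norms to a principal ring, this makes the norm of [h] a seventh power
   up to a unit, although [h] itself need not be one. *)
Lemma comax_pow7_cofactor (R : comNzRingType) (h k U : R) : h * k = U ^+ 7 -> comax h k ->
  exists j, h * j = (h + U) ^+ 7 /\ comax j U.
Proof.
move=> ehk chk.
(* So that [h U c = (h + U) ^ 7 - h ^ 7 - U ^ 7]. *)
pose c := 7 * U ^+ 5 + 21 * h * U ^+ 4 + 35 * h ^+ 2 * U ^+ 3 + 35 * h ^+ 3 * U ^+ 2 +
  21 * h ^+ 4 * U + 7 * h ^+ 5.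
exists (k + h ^+ 6 + U * c); split.
  transitivity (h * k + h * (h ^+ 6 + U * c)); first by ring.
  by rewrite ehk /c; ring.
apply: comax_sym; apply: (@comax_eqmod _ _ _ (k + h ^+ 6)); first by exists c; ring.
have c1 : comax h (k + h ^+ 6).
  by apply: (@comax_eqmod _ _ _ k) => //; exists (h ^+ 5); ring.
have c2 : comax k (k + h ^+ 6).
  apply: (@comax_eqmod _ _ _ (h ^+ 6)); first by exists 1; ring.
  exact/comaxX/comax_sym.
apply: comax_sym; apply: (@comax_divides _ _ (U ^+ 7)).
  by exists (U ^+ 6); rewrite -exprS.
by rewrite -ehk; apply: comaxM; apply: comax_sym.
Qed.

Lemma comax_morph (R S : comNzRingType) (f : {rmorphism R -> S}) (x y : R) :
  comax x y -> comax (f x) (f y).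
Proof. by case=> p [q e]; exists (f p), (f q); rewrite -!rmorphM -rmorphD e rmorph1. Qed.

Definition sgQ (z : quad O6) : quad O6 := mapQ sg z.
Definition cstQ (z : quad Z) : quad O6 := mapQ cst z.

Lemma cstQ_inj : injective cstQ.
Proof.
move=> x y e; apply: quad_eqP; apply: cst_inj.
  exact: (congr1 (@re _) e).
exact: (congr1 (@im _) e).
Qed.

Lemma cstQM x y : cstQ (x * y) = cstQ x * cstQ y.
Proof. exact: rmorphM. Qed.

Lemma cstQX n x : cstQ (x ^+ n) = cstQ x ^+ n.
Proof. exact: rmorphXn. Qed.

Lemma iter_sgQM k x y : iter k sgQ (x * y) = iter k sgQ x * iter k sgQ y.
Proof. by elim: k => //= k ->; rewrite /sgQ rmorphM. Qed.

Lemma iter_sgQB k x y : iter k sgQ (x - y) = iter k sgQ x - iter k sgQ y.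
Proof. by elim: k => //= k ->; rewrite /sgQ rmorphB. Qed.

Lemma iter_sgQE k z : iter k sgQ z = Quad (iter k sg (re z)) (iter k sg (im z)).
Proof. by elim: k => [|k IH]; [case: z|rewrite iterS IH]. Qed.

Lemma iter_sgQ_cst k a : iter k sgQ (cstQ a) = cstQ a.
Proof. by rewrite iter_sgQE /cstQ /mapQ /= !iter_sg_cst. Qed.

Lemma iter_sgQ_divides k x y : divides x y -> divides (iter k sgQ x) (iter k sgQ y).
Proof. by case=> z ->; exists (iter k sgQ z); rewrite iter_sgQM. Qed.

Definition nmQ (z : quad O6) : quad O6 := \prod_(k < 6) iter k sgQ z.
Definition nmA (z : quad O6) : quad Z := Quad (- x0_ (re (nmQ z))) (- x0_ (im (nmQ z))).

Lemma nmA_prod z : cstQ (nmA z) = \prod_(k < 6) iter k sgQ z.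
Proof.
have fix_nm : sgQ (nmQ z) = nmQ z.
  rewrite /nmQ /sgQ rmorph_prod !big_ord_recr !big_ord0 /= !mul1r -/sgQ.
  have -> : mapQ sg (mapQ sg (mapQ sg (mapQ sg (mapQ sg (mapQ sg z))))) = z.
    by case: z => -[? ? ? ? ? ?] [].
  by ring.
rewrite -/(nmQ z) /cstQ /nmA /mapQ /=; move: fix_nm; case: (nmQ z) => a b [ea eb] /=.
by rewrite -(sg_fixed ea) -(sg_fixed eb).
Qed.

Lemma nmAM x y : nmA (x * y) = nmA x * nmA y.
Proof.
apply: cstQ_inj; rewrite cstQM !nmA_prod -big_split /=.
by apply: eq_bigr => k _; rewrite iter_sgQM.
Qed.

Lemma nmA_cst a : nmA (cstQ a) = a ^+ 6.
Proof.
apply: cstQ_inj; rewrite nmA_prod cstQX.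
rewrite (eq_bigr (fun=> cstQ a)) => [|k _]; last exact: iter_sgQ_cst.
by rewrite prodr_const card_ord.
Qed.

Lemma nmAX n x : nmA (x ^+ n) = nmA x ^+ n.
Proof.
elim: n => [|n IH]; last by rewrite !exprS nmAM IH.
by rewrite !expr0; have := nmA_cst 1; rewrite expr1n /cstQ rmorph1.
Qed.

Lemma divides_cstQ (U : Z) (x : quad Z) :
  divides (cstQ (inQ U)) (cstQ x) -> divides (inQ U) x.
Proof.
have -> : cstQ (inQ U) = inQ (cst U) by apply: quad_eqP => //=.
case/inQ_divides => /= /divides_cst_inj[p ep] /divides_cst_inj[q eq].
by apply: divides_inQ; [exists p|exists q]; rewrite mulrC.
Qed.

Lemma nmA_eqmod1 (U : Z) z : eqmod (cstQ (inQ U)) z 1 -> eqmod (inQ U) (nmA z) 1.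
Proof.
move=> h; apply: divides_cstQ; 
have -> : cstQ (nmA z - 1) = cstQ (nmA z) - 1 by rewrite /cstQ rmorphB rmorph1.
rewrite nmA_prod.
apply: (big_ind (fun x => eqmod (cstQ (inQ U)) x 1)); first exact: eqmod_refl.
  by move=> x y hx hy; rewrite -[1]mulr1; apply: eqmodM.
move=> k _; have := iter_sgQ_divides k h.
by rewrite iter_sgQB iter_sgQ_cst; have := iter_sgQ_cst k 1; rewrite /cstQ rmorph1 => ->.
Qed.

Lemma nmA_comax (U : Z) z : comax z (cstQ (inQ U)) -> comax (nmA z) (inQ U).
Proof.
case=> p [q e]; have h : eqmod (cstQ (inQ U)) (p * z) 1.
  by exists (- q); rewrite -e; ring.
have [r er] := nmA_eqmod1 h; exists (nmA p), (- r).
by rewrite -nmAM; move: er => /eqP; rewrite subr_eq => /eqP ->; ring.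
Qed.

(** With [h j = (h + U) ^ 7], the norm of [h] divides a power of [U] while that of [j] is prime to
    [U]; they are comaximal in a principal ring with units 1 and -1, and their product is a seventh
    power. *)
Lemma nm_cofactor_pow7 (h k : quad O6) (U : Z) : U != 0 -> h * k = cstQ (inQ U) ^+ 7 ->
  comax h k -> exists m, nmA h = m ^+ 7 \/ nmA h = - m ^+ 7.
Proof.
move=> U0 ehk chk; have [j [ej cj]] := comax_pow7_cofactor ehk chk.
have e1 : nmA h * nmA j = nmA (h + cstQ (inQ U)) ^+ 7 by rewrite -nmAM ej nmAX.
have e2 : nmA h * nmA k = (inQ U ^+ 6) ^+ 7 by rewrite -nmAM ehk nmAX nmA_cst.
apply: (quadZ_mul_pow7 _ _ e1).
  apply/eqP => h0; move: e2; rewrite h0 mul0r -exprM => /esym/(congr1 (@re _)).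
  rewrite -rmorphXn /= => /eqP; rewrite expf_eq0 (negPf U0) andbF //.
apply: comax_sym; apply: (@comax_divides _ _ ((inQ U ^+ 6) ^+ 7)).
  by rewrite -e2; exists (nmA k).
by do 2 apply: comaxX; apply: nmA_comax.
Qed.

Definition dvdA (n : Z) (x : quad Z) : bool :=
  Z.eqb (Z.modulo (re x) n) Z0 && Z.eqb (Z.modulo (im x) n) Z0.

Lemma dvdAP n x : n != 0 -> divides (inQ n) x -> dvdA n x.
Proof.
move/eqP=> n0 /inQ_divides[[a ea] [b eb]]; rewrite /dvdA ea eb.
by apply/andP; split; apply/Z.eqb_eq; rewrite mulrC; apply: Z.mod_mul.
Qed.

(** The constant [59 - 20 al] is the value at [X = 4], [Y = 1] of the cubic form [H] below. As 13 is
    inert in [Z[al]], the residue field has 169 elements and its nonzero seventh powers have index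
    7. *)
Lemma no_seventh_root_mod13 : all (fun i => all (fun j =>
    let m : quad Z := sq7 Z ^+ 6 * Quad (Z.of_nat i) (Z.of_nat j) ^+ 7 in
    let c : quad Z := Quad (Zpos 59) (Zneg 20) ^+ 6 in
    ~~ dvdA 13 (m - c) && ~~ dvdA 13 (m + c)) (iota 0 13)) (iota 0 13).
Proof. by vm_compute. Qed.

Lemma quadZ_residue (m : quad Z) : exists i j : nat,
  [/\ (i < 13)%N, (j < 13)%N & eqmod (inQ 13) m (Quad (Z.of_nat i) (Z.of_nat j))].
Proof.
have r (a : Z) : exists i : nat, (i < 13)%N /\ divides 13 (a - Z.of_nat i)%R.
  exists (Z.to_nat (Z.modulo a 13)); have := Z.mod_pos_bound a 13.
  have := Z.div_mod a 13 => h1 h2; split; first by lia.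
  by exists (Z.div a 13); lia.
have [i [i13 hi]] := r (re m); have [j [j13 hj]] := r (im m).
by exists i, j; split=> //; apply: divides_inQ; rewrite !quadE.
Qed.

Lemma kapQ_divides (x : quad Z) : divides (inQ kap) (cstQ x) -> divides (inQ 13) x.
Proof.
case/inQ_divides => /= /kap_divides_cst[p ep] /kap_divides_cst[q eq].
by apply: divides_inQ; [exists p|exists q]; rewrite mulrC.
Qed.

Lemma pow18_mod13 (y : Z) : ~ Z.divide 13 y ->
  Z.divide 13 (y ^+ 18 - 1)%R \/ Z.divide 13 (y ^+ 18 + 1)%R.
Proof.
move=> y13; have h : Z.divide 13 (y ^+ 13 - y)%R.
  apply: (@divides_cst_inj 13).
  by have := @fermat_Z 13 y isT; rewrite /eqmod -(rmorphXn cst) -(rmorphB cst).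
have e1 : y ^+ 13 - y = y * ((y ^+ 6 - 1) * (y ^+ 6 + 1)) by ring.
rewrite e1 in h; case: (@zdivides_prime 13 _ _ isT h) => [//|].
case/(@zdivides_prime 13 _ _ isT) => -[k ek].
  left; exists (k * (y ^+ 12 + y ^+ 6 + 1))%R.
  transitivity ((y ^+ 6 - 1) * (y ^+ 12 + y ^+ 6 + 1)); first by ring.
  by rewrite ek; lia.
right; exists (k * (y ^+ 12 - y ^+ 6 + 1))%R.
transitivity ((y ^+ 6 + 1) * (y ^+ 12 - y ^+ 6 + 1)); first by ring.
by rewrite ek; lia.
Qed.

(** The residue degree of 3 is 3, so [x ^ 27 = x] modulo 3, and 105 is 1 modulo 26. As 105 is 15
    times 7, [x ^ 7] determines [x] modulo 3. *)
Lemma frob3_pow x : eqmod (cst 3) (x ^+ 105) x.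
Proof.
have f3 z : eqmod (cst 3) (z ^+ 3) (iter 4 sg z).
  by apply: (@frobenius 3 4 isT); apply: (@dvdOP 3).
have f27 : eqmod (cst 3) (x ^+ 27) x.
  have := @frobenius_iter 3 4 f3 3 x; rewrite (iter_sg_dvd x (isT : 6 %| 4 * 3)%N).
  by apply.
have -> : (105 = 27 * 3 + 24)%N by [].
rewrite exprD exprM; apply: (@eqmod_trans _ (x ^+ 3 * x ^+ 24)).
  by apply: eqmodM (eqmod_refl _ _); apply: eqmodX.
by rewrite -exprD.
Qed.

Section SecondDescent.
Variables (X Y E E' : O6) (u : Z).
Hypothesis u0 : u != 0.
Hypothesis u7 : Z.divide 7 u.
Hypothesis unitE : E * E' = 1.
Hypothesis eXY : X ^+ 7 - Y ^+ 7 = cst (9 * u ^+ 14) * E.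
Hypothesis cXY : comax X Y.

(** Modulo 7 the seventh power is the automorphism [sg ^ 5], which one more [sg] undoes. *)
Lemma XY_mod7 : exists T, X = Y + 7 * T.
Proof.
have h : eqmod (cst 7) (X ^+ 7) (Y ^+ 7).
  case: u7 => k ek; exists (cst (9 * k * u ^+ 13) * E); rewrite eXY.
  have -> : 9 * u ^+ 14 = 7 * (9 * k * u ^+ 13).
    have -> : u ^+ 14 = u * u ^+ 13 by rewrite -exprS.
    by rewrite {1}ek -[Z.mul k 7]/(k * 7); ring.
  by rewrite (rmorphM cst) /=; ring.
have := eqmod_trans (eqmod_trans (eqmod_sym (frob7 X)) h) (frob7 Y).
move/(iter_sg_divides 1); rewrite iter_sg_cst iter_sgB -!iterD !iter_sg6 => -[T eT].
exists T; have -> : (7 : O6) = cst 7 by [].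
by rewrite -eT; ring.
Qed.

Lemma XY_mod3 : exists T, X = Y + 3 * T.
Proof.
have h : eqmod (cst 3) (X ^+ 7) (Y ^+ 7).
  exists (cst (3 * u ^+ 14) * E); rewrite eXY.
  have -> : 9 * u ^+ 14 = 3 * (3 * u ^+ 14) by ring.
  by rewrite (rmorphM cst) /=; ring.
have := eqmodX 15 h; rewrite -!exprM => h15.
have [T eT] := eqmod_trans (eqmod_trans (eqmod_sym (frob3_pow X)) h15) (frob3_pow Y).
exists T; have -> : (3 : O6) = cst 3 by [].
by rewrite -eT; ring.
Qed.

(* With [z] a primitive seventh root of unity and [z + z ^ 2 + z ^ 4 = al],
   [H = (X - z Y) (X - z ^ 2 Y) (X - z ^ 4 Y)], so that [H] times its conjugate is
   [(X ^ 7 - Y ^ 7) / (X - Y)]; below, [H = sqrt (-7) H1]. *)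
Let H : quad O6 := Quad (X ^+ 3 - X * Y ^+ 2 - Y ^+ 3) (- (X ^+ 2 * Y + X * Y ^+ 2)).

Lemma comax_shift (R : comNzRingType) (n x y z : R) :
  x = y + n * z -> comax x y -> comax n y.
Proof. by move=> -> [p [q e]]; exists (p * z), (p + q); rewrite -e; ring. Qed.

(** Modulo 3, where [X = Y], [H] is [- sqrt (-7) Y ^ 3]. Thus 9 belongs to the other factor and can
    be completed there to a seventh power. *)
Lemma comax_H3 : comax (inQ 3) H.
Proof.
have [T eT] := XY_mod3.
apply: (@comax_eqmod _ _ _ (sq7 O6 * (- 1) * inQ Y ^+ 3)).
  exists (Quad (T * X * (X + Y)) (- (3 * T * Y ^+ 2 + 3 * T ^+ 2 * Y))).
  by rewrite -rmorphXn; apply: quad_eqP; rewrite !quadE /= ?eT; ring.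
apply: comaxM; last first.
  by apply: comaxX; apply: comax_morph; apply: comax_shift eT cXY.
apply: comaxM; last by exists 0, (-1); ring.
exists (- 2), (- sq7 O6).
by apply: quad_eqP; rewrite !quadE /=; ring.
Qed.

Lemma comax_HXY : comax H (inQ (X * Y * (X + Y))).
Proof.
have cm : forall a b : O6, comax a b -> forall n, comax (inQ a) (inQ b ^+ n).
  by move=> a b c n; apply: comaxX; apply: comax_morph.
rewrite !rmorphM; apply: comaxM; first apply: comaxM.
- apply: comax_sym; apply: (@comax_eqmod _ _ _ (inQ Y ^+ 3 * (- 1))).
    exists (Quad (X ^+ 2 - Y ^+ 2) (- (X * Y + Y ^+ 2))).
    by rewrite -rmorphXn; apply: quad_eqP; rewrite !quadE /=; ring.
  by apply: comaxM; [apply: cm|exists 0, (-1); ring].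
- apply: comax_sym; apply: (@comax_eqmod _ _ _ (inQ X ^+ 3)).
    exists (Quad (- (X * Y) - Y ^+ 2) (- (X ^+ 2 + X * Y))).
    by rewrite -rmorphXn; apply: quad_eqP; rewrite !quadE /=; ring.
  by apply: cm; apply: comax_sym.
- apply: comax_sym; apply: (@comax_eqmod _ _ _ (inQ X ^+ 3)).
    exists (Quad (- Y ^+ 2) (- (X * Y))).
    by rewrite -rmorphXn; apply: quad_eqP; rewrite !quadE /=; ring.
  apply: cm; case: cXY => p [q e]; exists q, (p - q); rewrite -e; ring.
Qed.

Variable T : O6.
Hypothesis eT : X = Y + 7 * T.

Let H1 : quad O6 := Quad (- (Y ^+ 3 + 14 * T * Y ^+ 2 + 49 * T ^+ 2 * Y + 49 * T ^+ 3))
  (- (7 * T * Y ^+ 2 + 49 * T ^+ 2 * Y + 98 * T ^+ 3)).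
Let H1b : quad O6 := Quad (- (Y ^+ 3 + 7 * T * Y ^+ 2 - 49 * T ^+ 3))
  (7 * T * Y ^+ 2 + 49 * T ^+ 2 * Y + 98 * T ^+ 3).

Lemma H1_factor : sq7 O6 * H1 = H.
Proof. by apply: quad_eqP; rewrite !quadE /= eT; ring. Qed.

Lemma H1_mul : inQ (49 * T) * H1 * H1b = inQ (X ^+ 7 - Y ^+ 7).
Proof. by apply: quad_eqP; rewrite !quadE /= ?eT; ring. Qed.

Lemma comax_H1_sq7 : comax H1 (sq7 O6).
Proof.
apply: comax_sym; apply: (@comax_eqmod _ _ _ (inQ Y ^+ 3 * (- 1))).
  exists (Quad (- (2 * T * Y ^+ 2 + 21 * T ^+ 2 * Y + 49 * T ^+ 3))
     (3 * T * Y ^+ 2 + 7 * T ^+ 2 * Y)).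
  by rewrite -rmorphXn; apply: quad_eqP; rewrite !quadE /=; ring.
apply: comaxM; last by exists 0, (-1); ring.
apply: comaxX; apply: comax_sym; apply: (@comax_divides _ _ (inQ 7)).
  by exists (- sq7 O6); rewrite mulrN sq7P opprK rmorph_nat.
by apply: comax_morph; apply: comax_sym; apply: comax_shift eT cXY.
Qed.

Lemma comax_H1_T : comax H1 (inQ T).
Proof.
apply: comax_sym; apply: (@comax_eqmod _ _ _ (inQ Y ^+ 3 * (- 1))).
  exists (Quad (- (14 * Y ^+ 2 + 49 * T * Y + 49 * T ^+ 2))
     (- (7 * Y ^+ 2 + 49 * T * Y + 98 * T ^+ 2))).
  by rewrite -rmorphXn; apply: quad_eqP; rewrite !quadE /=; ring.
apply: comaxM; last by exists 0, (-1); ring.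
apply: comaxX; apply: comax_morph.
by apply: (@comax_shift _ T X Y 7 _ cXY); rewrite eT mulrC.
Qed.

Lemma comax_H1_div y : comax y H -> comax y H1.
Proof. by apply: comax_divides; exists (sq7 O6); rewrite mulrC H1_factor. Qed.

(** [H1b] is the conjugate of [H1], and their sum is the coefficient [- X Y (X + Y)] of [al] in [H],
    which is prime to [H]. *)
Lemma comax_H1_H1b : comax H1 H1b.
Proof.
have e : H1 + H1b = inQ (X * Y * (X + Y)) * (- 1).
  by apply: quad_eqP; rewrite !quadE /= eT; ring.
have : comax H1 (H1 + H1b).
  rewrite e; apply: comaxM; last by exists 0, (-1); ring.
  by apply: comax_sym; apply: comax_H1_div; apply: comax_sym; apply: comax_HXY.
by case=> p [q epq]; exists (p + q), q; rewrite -epq; ring.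
Qed.

Lemma nm_H1 : exists m, nmA H1 = m ^+ 7 \/ nmA H1 = - m ^+ 7.
Proof.
(* The factor [3 ^ 5 E'] completes [9 u ^ 14 E] to [(3 u ^ 2) ^ 7]. *)
pose K := inQ (49 * T) * H1b * (inQ (cst 3) ^+ 5 * inQ E').
have U0 : 3 * u ^+ 2 != 0 by rewrite mulf_neq0 // expf_neq0.
apply: (@nm_cofactor_pow7 H1 K _ U0).
  have -> : H1 * K = inQ (49 * T) * H1 * H1b * (inQ (cst 3) ^+ 5 * inQ E').
    by rewrite /K; ring.
  rewrite H1_mul eXY.
  have -> : cstQ (inQ (3 * u ^+ 2)) = inQ (cst (3 * u ^+ 2)) by apply: quad_eqP.
  rewrite -!rmorphXn -!rmorphM /=; congr inQ.
  transitivity (cst (9 * u ^+ 14) * cst 3 ^+ 5 * (E * E')); first by ring.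
  by rewrite unitE mulr1 -!(rmorphXn cst) -(rmorphM cst); congr cst; ring.
rewrite /K; apply: comaxM; last first.
  apply: comaxM; last by apply: comax_unit_r; exists (inQ E); rewrite mulrC -rmorphM unitE rmorph1.
  by apply: comaxX; apply: comax_sym; apply: comax_H1_div; apply: comax_H3.
apply: comaxM; last exact: comax_H1_H1b.
have -> : inQ (49 * T) = sq7 O6 ^+ 4 * inQ T.
  have -> : sq7 O6 ^+ 4 = (sq7 O6 * sq7 O6) ^+ 2 by ring.
  rewrite sq7P sqrrN; apply: quad_eqP; rewrite !quadE /=; ring.
by apply: comaxM; [apply: comaxX; apply: comax_H1_sq7|apply: comax_H1_T].
Qed.

(** The prime [kap] is totally ramified: all conjugates of [H1] have the same residue [r], and
    [nmA H1 = r ^ 6] modulo 13. Since [sqrt (-7) r = y ^ 3 (59 - 20 al)] there, and [y ^ 18] is 1 or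
    -1, the table modulo 13 is contradicted. *)
Lemma second_descent : eqmod kap X (4 * Y) -> ~ Z.divide 13 (res Y) -> False.
Proof.
move=> kXY y13; set y := res Y.
have Yy : eqmod kap Y (cst y) := eqmod_res Y.
have Xy : eqmod kap X (4 * cst y).
  by apply: eqmod_trans kXY _; apply: eqmodM (eqmod_refl _ _) Yy.
pose r : quad Z := Quad (res (re H1)) (res (im H1)).
have H1r k : eqmod (inQ kap) (iter k sgQ H1) (cstQ r).
  rewrite iter_sgQE; apply: divides_inQ; rewrite !quadE /=.
    by rewrite -(res_iter_sg k (re H1)); apply: eqmod_res.
  by rewrite -(res_iter_sg k (im H1)); apply: eqmod_res.
have N6 : eqmod (inQ 13) (nmA H1) (r ^+ 6).
  apply: kapQ_divides.
  have -> : cstQ (nmA H1 - r ^+ 6) = cstQ (nmA H1) - cstQ r ^+ 6.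
    by rewrite /cstQ rmorphB rmorphXn.
  rewrite nmA_prod -[X in _ - _ ^+ X](card_ord 6) -prodr_const.
  apply: (big_ind2 (fun x y => eqmod (inQ kap) x y)); first exact: eqmod_refl.
    by move=> *; apply: eqmodM.
  by move=> k _; apply: H1r.
have sr : eqmod (inQ 13) (sq7 Z * r) (inQ (y ^+ 3) * Quad 59 (- 20)).
  apply: kapQ_divides.
  have -> : cstQ (sq7 Z * r - inQ (y ^+ 3) * Quad 59 (- 20)) =
      sq7 O6 * cstQ r - inQ (cst y ^+ 3) * Quad 59 (- 20).
    have -> : inQ (cst y ^+ 3) = cstQ (inQ (y ^+ 3)).
      by apply: quad_eqP => //=; rewrite (rmorphXn cst).
    have -> : sq7 O6 = cstQ (sq7 Z) by apply: quad_eqP.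
    have -> : Quad 59 (- 20) = cstQ (Quad 59 (- 20)) by apply: quad_eqP.
    by rewrite -!cstQM /cstQ rmorphB.
  have e1 := eqmodM (eqmod_refl (inQ kap) (sq7 O6)) (H1r 0%N).
  rewrite [iter _ _ _]/= H1_factor in e1; apply: eqmod_trans (eqmod_sym e1) _.
  have pe n m := eqmodM (eqmodX n Xy) (eqmodX m Yy).
  apply: divides_inQ; rewrite !quadE /=.
    have := eqmodD (eqmodD (pe 3 0)%N (eqmodM (eqmod_refl _ (-1)) (pe 1 2)%N))
      (eqmodM (eqmod_refl _ (-1)) (pe 0 3)%N).
    by case=> z ez; exists z; rewrite -ez; ring.
  have := eqmodM (eqmod_refl _ (-1)) (eqmodD (pe 2 1)%N (pe 1 2)%N).
  by case=> z ez; exists z; rewrite -ez; ring.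
have [m hm] := nm_H1.
have [i [j [i13 j13 mij]]] := quadZ_residue m.
have key : eqmod (inQ 13) (sq7 Z ^+ 6 * nmA H1) (inQ (y ^+ 18) * Quad 59 (- 20) ^+ 6).
  apply: (@eqmod_trans _ (sq7 Z ^+ 6 * r ^+ 6)).
    by apply: eqmodM N6; apply: eqmod_refl.
  rewrite -exprMn; apply: eqmod_trans (eqmodX 6 sr) _.
  by rewrite exprMn -rmorphXn -exprM; apply: eqmod_refl.
have ysgn : exists e : quad Z, (e = 1 \/ e = -1) /\ eqmod (inQ 13) (inQ (y ^+ 18)) e.
  case: (pow18_mod13 y13) => -[k ek]; [exists 1|exists (-1)]; split; auto.
    by exists (inQ k); rewrite -rmorphM mulrC -[k * 13]ek rmorphB rmorph1.
  by exists (inQ k); rewrite -rmorphM mulrC -[k * 13]ek rmorphD rmorph1 opprK.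
have [e [he ye]] := ysgn.
have m7 := eqmodX 7 mij; set M := Quad (Z.of_nat i) (Z.of_nat j) in mij m7.
have key2 : eqmod (inQ 13) (sq7 Z ^+ 6 * M ^+ 7) (Quad 59 (- 20) ^+ 6) \/
    eqmod (inQ 13) (sq7 Z ^+ 6 * M ^+ 7) (- Quad 59 (- 20) ^+ 6).
  have k1 : eqmod (inQ 13) (sq7 Z ^+ 6 * nmA H1) (e * Quad 59 (- 20) ^+ 6).
    by apply: eqmod_trans key _; apply: eqmodM ye (eqmod_refl _ _).
  have k2 : eqmod (inQ 13) (sq7 Z ^+ 6 * m ^+ 7) (sq7 Z ^+ 6 * M ^+ 7).
    by apply: eqmodM m7; apply: eqmod_refl.
  case: hm he k1 => -> [] -> k1; [left|right|right|left];
    apply: eqmod_trans (eqmod_sym k2) _; case: k1 => z ez;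
    by [exists z; rewrite -ez; ring|exists (- z); rewrite mulrN -ez; ring].
have := no_seventh_root_mod13.
move/allP/(_ i); rewrite mem_iota => /(_ i13)/allP/(_ j); rewrite mem_iota => /(_ j13).
rewrite -/M => /andP[/negP n1 /negP n2].
case: key2 => h; [apply: n1|apply: n2]; exact: dvdAP.
Qed.

End SecondDescent.

(** * The element of norm [(a^13 + b^13) / (a + b)] *)

Definition gel (S P : Z) : O6 := cst S - kap * cst P.

Definition normP (S P : Z) : Z := (S ^+ 6 - 13 * S ^+ 5 * P + 65 * S ^+ 4 * P ^+ 2
  - 156 * S ^+ 3 * P ^+ 3 + 182 * S ^+ 2 * P ^+ 4 - 91 * S * P ^+ 5 + 13 * P ^+ 6)%R.

Lemma normP_sum (a b : Z) : (a + b) * normP ((a + b) ^+ 2) (a * b)%R = a ^+ 13 + b ^+ 13.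
Proof. by rewrite /normP; ring. Qed.

Lemma normP_mod (S P : Z) : eqmod S (normP S P) (13 * P ^+ 6).
Proof.
exists (S ^+ 5 - 13 * S ^+ 4 * P + 65 * S ^+ 3 * P ^+ 2
  - 156 * S ^+ 2 * P ^+ 3 + 182 * S * P ^+ 4 - 91 * P ^+ 5).
by rewrite /normP; ring.
Qed.

Lemma normP_modP (S P : Z) : eqmod P (normP S P) (S ^+ 6).
Proof.
exists (- (13 * S ^+ 5) + 65 * S ^+ 4 * P
  - 156 * S ^+ 3 * P ^+ 2 + 182 * S ^+ 2 * P ^+ 3 - 91 * S * P ^+ 4 + 13 * P ^+ 5).
by rewrite /normP; ring.
Qed.

(** Grouping the conjugates in pairs reduces the coefficients of the norm form to six identities
    between constants, decided by computation. *)
Lemma three_quadratics (R : comNzRingType) (S P s1 p1 s2 p2 s3 p3 c1 c2 c3 c4 c5 c6 : R) :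
    s1 + s2 + s3 = c1 -> p1 + p2 + p3 + s1 * s2 + s1 * s3 + s2 * s3 = c2 ->
    s1 * s2 * s3 + p1 * (s2 + s3) + p2 * (s1 + s3) + p3 * (s1 + s2) = c3 ->
    p1 * p2 + p1 * p3 + p2 * p3 + p1 * s2 * s3 + p2 * s1 * s3 + p3 * s1 * s2 = c4 ->
    s1 * p2 * p3 + s2 * p1 * p3 + s3 * p1 * p2 = c5 -> p1 * p2 * p3 = c6 ->
  (S ^+ 2 - s1 * S * P + p1 * P ^+ 2) * (S ^+ 2 - s2 * S * P + p2 * P ^+ 2) *
    (S ^+ 2 - s3 * S * P + p3 * P ^+ 2) =
  S ^+ 6 - c1 * S ^+ 5 * P + c2 * S ^+ 4 * P ^+ 2 - c3 * S ^+ 3 * P ^+ 3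
  + c4 * S ^+ 2 * P ^+ 4 - c5 * S * P ^+ 5 + c6 * P ^+ 6.
Proof. by move=> <- <- <- <- <- <-; ring. Qed.

Lemma nm_linear S P k (s1 := k + sg k) (p1 := k * sg k) :
  cst (nm (cst S - k * cst P)) =
  (cst S ^+ 2 - s1 * cst S * cst P + p1 * cst P ^+ 2) *
  (cst S ^+ 2 - iter 2 sg s1 * cst S * cst P + iter 2 sg p1 * cst P ^+ 2) *
  (cst S ^+ 2 - iter 4 sg s1 * cst S * cst P + iter 4 sg p1 * cst P ^+ 2).
Proof.
have e j : iter j sg (cst S - k * cst P) = cst S - iter j sg k * cst P.
  by rewrite iter_sgB iter_sgM !iter_sg_cst.
rewrite nm_prod (eq_bigr (fun j : 'I_6 => cst S - iter j sg k * cst P)) => [|j _]; last exact: e.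
rewrite !big_ord_recr big_ord0 /= /s1 /p1.
by rewrite !(rmorphD sg, rmorphM sg) /=; ring.
Qed.

Lemma nm_gel S P : nm (gel S P) = normP S P.
Proof.
apply: cst_inj; rewrite nm_linear.
apply: etrans (@three_quadratics _ _ _ _ _ _ _ _ _ (cst 13) (cst 65) (cst 156) (cst 182)
  (cst 91) (cst 13) _ _ _ _ _ _) _;
    [by vm_compute|by vm_compute|by vm_compute|by vm_compute|by vm_compute|by vm_compute|].
rewrite -!(rmorphXn cst) -!(rmorphM cst) -(rmorphB cst) -(rmorphD cst) -(rmorphB cst).
by rewrite -(rmorphD cst) -(rmorphB cst) -(rmorphD cst).
Qed.

Lemma gel_divides_nm S P : divides (gel S P) (cst (normP S P)).
Proof. by rewrite -nm_gel; apply: divides_nm. Qed.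

Lemma comax_cst (m n : Z) : comax m n -> comax (cst m) (cst n).
Proof. exact: comax_morph. Qed.

Lemma comax_gel (m S P : Z) : comax m (normP S P) -> comax (cst m) (gel S P).
Proof. by move=> c; apply: comax_divides (gel_divides_nm S P) _; apply: comax_cst. Qed.

Lemma dividesZP (m n : Z) : divides m n <-> Z.divide m n.
Proof. by split=> -[z ->]; exists z; rewrite mulrC. Qed.

Lemma Z_bezout (m n : Z) : exists d p q : Z, [/\ divides d m, divides d n & d = p * m + q * n].
Proof.
have [p [q e]] := Z.gcd_bezout m n _ erefl; exists (Z.gcd m n), p, q.
by split; [apply/dividesZP/Z.gcd_divide_l|apply/dividesZP/Z.gcd_divide_r|rewrite -e].
Qed.

Lemma comax_prime (p : nat) (m : Z) : prime p -> ~ Z.divide (Z.of_nat p) m ->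
  comax (Z.of_nat p) m.
Proof.
move=> pp pm; have [d [x [y [[z ez] dm e]]]] := Z_bezout (Z.of_nat p) m.
have dp : (Z.abs_nat d %| p)%N.
  have := f_equal Z.abs_nat ez; rewrite (abs_natM d z) Zabs2Nat.id => ->.
  exact: dvdn_mulr.
have dvd_pm : Z.abs_nat d = p -> False.
  move=> ed; apply: pm; apply/dividesZP; apply: divides_trans dm.
  have [->|->] : Z.of_nat p = d \/ Z.of_nat p = - d by lia.
    exact: divides_refl.
  by exists (-1); rewrite mulrN1 opprK.
case/primeP: pp => _ /(_ _ dp) /orP[] /eqP // d1.
have [e1|e1] : d = 1 \/ d = -1 by lia.
  by exists x, y; rewrite -e.
by exists (- x), (- y); rewrite !mulNr -opprD -e e1 opprK.
Qed.

Lemma Z_coprime_pow7 (x y z : Z) : x != 0 -> comax x y -> x * y = z ^+ 7 ->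
  exists d, x = d ^+ 7.
Proof.
move=> x0 cxy exy; have [d [p [q [dx dz e]]]] := Z_bezout x z.
have [f [ef [g eg]]] := comax_mul_pow dx dz e cxy exy (mulfI x0).
have [f1|f1] : f = 1 \/ f = -1 by apply: (Z.eq_mul_1 f g); exact: esym eg.
  by exists d; rewrite ef f1 mul1r.
by exists (- d); rewrite ef f1; ring.
Qed.

(** * Seventh powers modulo 49 *)

Lemma P7_congr x x' : eqmod (cst 49) x x' -> eqmod (cst 49) (P7 x) (P7 x').
Proof.
move=> h; suff h' k : eqmod (cst 49) (iter k pow7 x) (iter k pow7 x') by exact: h'.
by elim: k => // k IH; rewrite !iterS /pow7; apply: eqmodX.
Qed.

Lemma lamr_eqmod x x' y : eqmod (cst 49) x x' -> lamr x y -> lamr x' y.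
Proof.
move=> h l; apply: eqmod_trans (eqmod_sym (P7_congr h)) _; apply: eqmod_trans l _.
by apply: eqmodM h (eqmod_refl _ _).
Qed.

Lemma lamr_eqmod7 x y y' : eqmod (cst 7) y y' -> lamr x y -> lamr x y'.
Proof.
case=> w ew l; apply: eqmod_trans l _; exists (x * w).
have -> : cst 49 = cst 7 * cst 7 by [].
transitivity (cst 7 * x * (y - y')); first by ring.
by rewrite ew; ring.
Qed.

Lemma ell_eqmod y y' : eqmod (cst 7) y y' -> Z.divide 7 (ell y - ell y')%R.
Proof.
case=> w ew; have -> : y = y' + cst 7 * w by rewrite -ew; ring.
exists (ell w); rewrite ellD; case: w {ew} => a b c d e f; rewrite mul_cstE /ell.
by cbv beta iota delta [x0_ x1_ x2_ x3_ x4_ x5_]; lia.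
Qed.

Lemma dvdO_complete n x : n != 0 -> divides (cst n) x -> dvdO n x.
Proof.
case: x => y0 y1 y2 y3 y4 y5 /eqP n0 /divides_cstP[] /= [d0 d1 d2] [d3 d4 d5].
by rewrite /= !(proj2 (Z.eqb_eq _ _)) //; apply/(Z.mod_divide _ _ n0).
Qed.

Lemma th9_order : dvdO 2 (th ^+ 9 ^+ 7 - 1) && all (fun m => all (fun r =>
  dvdO 2 (th ^+ 9 ^+ m - th ^+ 9 ^+ r) ==> (m == r)) (iota 0 2)) (iota 0 7).
Proof. by vm_compute. Qed.

(** Modulo 2 the order of [th ^ 9] is 7, so [z] determines the exponent modulo 7. *)
Lemma good_ell (r : nat) z y : (r < 2)%N -> good z -> comax (cst 7) z -> lamr z y ->
  eqmod (cst 2) z (th ^+ r) -> Z.divide 7 (ell y - Z.of_nat r)%R.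
Proof.
move=> r2 [n [y' [l' h2 h7]]] c7 l zr.
have yy := ell_eqmod (lamr_uniq c7 l l').
have nr : eqmod (cst 2) (th ^+ 9 ^+ n) (th ^+ 9 ^+ r).
  apply: eqmod_trans (eqmod_sym h2) _; have := eqmodX 9 zr.
  by rewrite -[_ ^+ r ^+ 9]exprM -[_ ^+ 9 ^+ r]exprM [(r * 9)%N]mulnC.
have /andP[/(@dvdOP 2 _ isT) o7 /allP t] := th9_order.
have mr : eqmod (cst 2) (th ^+ 9 ^+ (n %% 7)) (th ^+ 9 ^+ r).
  apply: eqmod_trans nr; rewrite {2}(divn_eq n 7) exprD [in X in eqmod _ _ X]mulnC.
  rewrite [_ ^+ (7 * _)]exprM; apply: eqmod_sym.
  have := eqmodM (eqmodX (n %/ 7) o7) (eqmod_refl (cst 2) (th ^+ 9 ^+ (n %% 7))).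
  by rewrite expr1n mul1r.
have /allP/(_ r) := t (n %% 7)%N (ltac:(by rewrite mem_iota /= ltn_mod)).
rewrite mem_iota => /(_ r2); rewrite (dvdO_complete _ mr) //= => /eqP e.
case: yy h7 => k1 e1 [k2 e2]; exists (k1 + k2 + Z.of_nat (n %/ 7)).
have := divn_eq n 7; rewrite e => en.
by move: e1 e2; rewrite en; lia.
Qed.

Definition residues49 : seq Z := [seq Z.of_nat i | i <- iota 0 49].

Lemma residues49P (m : Z) : exists2 r, r \in residues49 & eqmod 49 m r.
Proof.
exists (Z.modulo m 49); last first.
  by exists (Z.div m 49); have := Z.div_mod m 49; lia.
apply/mapP; exists (Z.to_nat (Z.modulo m 49)); have := Z.mod_pos_bound m 49.
  by rewrite mem_iota; lia.
by lia.
Qed.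

Lemma eqmod_modulo (n m : Z) : n != 0 -> eqmod n m (Z.modulo m n).
Proof. by move/eqP => n0; exists (Z.div m n); have := Z.div_mod m n n0; lia. Qed.

Lemma eqmod_eqb (n m : Z) : n != 0 -> Z.eqb (Z.modulo m n) 0 <-> divides n m.
Proof.
move/eqP=> n0; rewrite dividesZP -(Z.mod_divide _ _ n0).
by split=> [/Z.eqb_eq|->].
Qed.

(** The sixth roots of unity modulo 49, that is, the seventh powers of units. *)
Definition roots49 : seq Z := [:: 1; 18; 19; 30; 31; 48].

Lemma pow7_table : all (fun r : Z => Z.eqb (Z.modulo r 7) 0 ||
  Z.eqb (Z.modulo (r ^+ 7 ^+ 6 - 1)%R 49) 0 &&
  has (fun s => Z.eqb (Z.modulo (r ^+ 7 - s)%R 49) 0) roots49) residues49.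
Proof. by vm_compute. Qed.

Lemma pow7_mod49 (u : Z) : ~ Z.divide 7 u -> eqmod 49 (u ^+ 7 ^+ 6) 1 /\
  exists2 s, s \in roots49 & eqmod 49 (u ^+ 7) s.
Proof.
move=> u7; have [r rR ur] := residues49P u.
have := allP pow7_table r rR; case/orP=>
  [/eqmod_eqb r7|/andP[/eqmod_eqb h /hasP[s sR /eqmod_eqb h']]].
  case: u7; apply/dividesZP; apply: eqmod_divides (r7 isT).
  by apply: eqmod_weak ur; exists 7.
split; first by apply: eqmod_trans (h isT); apply/eqmodX/eqmodX.
by exists s => //; apply: eqmod_trans (h' isT); apply: eqmodX.
Qed.

Lemma normP_eqmod (n S P S' P' : Z) : eqmod n S S' -> eqmod n P P' ->
  eqmod n (normP S P) (normP S' P').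
Proof.
move=> hS hP; rewrite /normP.
have m (c : Z) i j := eqmodM (eqmodM (eqmod_refl n c) (eqmodX i hS)) (eqmodX j hP).
have := eqmodD (m 1%R 6%N 0%N) (eqmodD (m (- 13)%R 5%N 1%N) (eqmodD (m 65%R 4%N 2%N)
  (eqmodD (m (- 156)%R 3%N 3%N) (eqmodD (m 182%R 2%N 4%N) (eqmodD (m (- 91)%R 1%N 5%N)
    (m 13%R 0%N 6%N)))))).
by case=> w ew; exists w; rewrite -ew; ring.
Qed.

Lemma gel_eqmod (n S P S' P' : Z) : eqmod n S S' -> eqmod n P P' ->
  eqmod (cst n) (gel S P) (gel S' P').
Proof.
case=> s es [p ep]; exists (cst s - kap * cst p); rewrite /gel.
transitivity (cst (S - S') - kap * cst (P - P')); first by rewrite !(rmorphB cst); ring.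
by rewrite es ep !(rmorphM cst) /=; ring.
Qed.

(* The logarithm of [g] modulo 7 is [(g ^ (7 ^ 6) - g) / (7 g)]; the inverse of [g] modulo 7 is
   [n ^ 5] times the product of the other conjugates, where [n] is the norm of [g]. *)
Definition log7 (n : Z) (g : O6) : O6 :=
  let: MkO y0 y1 y2 y3 y4 y5 := P7m g - g in
  let q := MkO (Z.div y0 7) (Z.div y1 7) (Z.div y2 7) (Z.div y3 7) (Z.div y4 7) (Z.div y5 7) in
  redO 7 (cst (n ^+ 5) * (iter 1 sg g * iter 2 sg g * iter 3 sg g * iter 4 sg g * iter 5 sg g) * q).

(** [s] stands for [a + b] and [L] lists the values of [ell] to exclude. The condition [n ^ 6 = t]
    modulo 49 says that the norm [n] is a seventh power for [t = 1], and 13 times one for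
    [t = 13 ^ 6]. *)
Definition log_check (L : seq Z) (t s a : Z) : bool :=
  let S := Z.modulo (s ^+ 2) 49 in let P := Z.modulo (a * (s - a)) 49 in
  let n := Z.modulo (normP S P) 49 in
  ~~ Z.eqb (Z.modulo n 7) 0 && (Z.eqb (Z.modulo (n ^+ 6 - t) 49) 0 ==>
   let g := gel S P in let y := log7 n g in
   dvdO 49 (P7m g - g * (1 + cst 7 * y)) && (Z.modulo (ell y) 7 \notin L)).

Lemma log_checkP L t (a b s : Z) : log_check L t s (Z.modulo a 49) -> eqmod 49 (a + b) s ->
  ~ Z.divide 7 (normP ((a + b) ^+ 2) (a * b)%R) /\
  (eqmod 49 (normP ((a + b) ^+ 2) (a * b)%R ^+ 6) t ->
    exists2 y, lamr (gel ((a + b) ^+ 2) (a * b)%R) y & Z.modulo (ell y) 7 \notin L).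
Proof.
rewrite /log_check; set S0 := Z.modulo (_ ^+ 2) _; set P0 := Z.modulo (_ * _) _.
move=> h hab; have hS : eqmod 49 ((a + b) ^+ 2) S0.
  by apply: eqmod_trans (eqmod_modulo _ _) => //; apply: eqmodX.
have hP : eqmod 49 (a * b)%R P0.
  apply: eqmod_trans (eqmod_modulo _ _) => //.
  have ha := eqmod_modulo a (isT : 49 != 0 :> Z).
  have := eqmodM ha (eqmodD hab (eqmodM (eqmod_refl 49 (-1)) ha)).
  by case=> w ew; exists w; rewrite -ew; ring.
have := eqmod_trans (normP_eqmod hS hP) (eqmod_modulo _ (isT : 49 != 0 :> Z)).
have := gel_eqmod hS hP; move: h; rewrite -[Zpos 49]/(49%:R : Z).
move: S0 P0 hS hP => S0 P0 _ _; move: ((a + b) ^+ 2) (a * b)%R => S P.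
move: (gel S P) (gel S0 P0) (normP S P) (Z.modulo (normP S0 P0) _) => g g0 N n.
case/andP=> /negP n7 /implyP h hg hn; split=> [/dividesZP d7|h6].
  apply: n7; apply/(eqmod_eqb n (isT : 7 != 0 :> Z)); apply: eqmod_divides d7.
  by apply: eqmod_weak (eqmod_sym hn); exists 7.
have /h /andP[hl hL] : Z.eqb (Z.modulo (n ^+ 6 - t)%R 49) 0.
  apply/(eqmod_eqb _ (isT : 49 != 0 :> Z)); apply: eqmod_trans h6.
  exact/eqmodX/eqmod_sym.
by exists (log7 n g0) => //; apply: lamr_eqmod (lamr_check hl); apply: eqmod_sym.
Qed.

(** For [a + b = 3 u ^ 7]. The values 0 and 1 are those imposed by parity, [g] being 1 or [theta]
    modulo 2. *)
Lemma log_table_B :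
  all (fun s => all (log_check [:: 0; 1] 1 (3 * s)) residues49) roots49.
Proof. by vm_compute. Qed.

(* [4 = 3 / 13] modulo 49, since [13 (a + b) = 3 u ^ 7] when 13 divides [a + b]. *)
Lemma log_table_A :
  all (fun s => all (log_check [:: 0] (13 ^+ 6) (4 * s)) residues49) roots49.
Proof. by vm_compute. Qed.

Lemma log_tableP L t k (a b u : Z) :
    all (fun s => all (log_check L t (k * s)) residues49) roots49 ->
    ~ Z.divide 7 u -> eqmod 49 (a + b) (k * u ^+ 7) ->
  ~ Z.divide 7 (normP ((a + b) ^+ 2) (a * b)%R) /\
  (eqmod 49 (normP ((a + b) ^+ 2) (a * b)%R ^+ 6) t ->
    exists2 y, lamr (gel ((a + b) ^+ 2) (a * b)%R) y & Z.modulo (ell y) 7 \notin L).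
Proof.
move=> tab u7 hab; have [_ [s sR us]] := pow7_mod49 u7.
apply: (@log_checkP _ _ _ _ (k * s)); last first.
  by apply: eqmod_trans hab _; apply: eqmodM us; apply: eqmod_refl.
apply: (allP (allP tab s sR)); apply/mapP; exists (Z.to_nat (Z.modulo a 49)).
  by rewrite mem_iota; have := Z.mod_pos_bound a 49; lia.
by have := Z.mod_pos_bound a 49; lia.
Qed.

(** As [gel S P] is [S - 2 P + P theta] and [P] is invertible modulo [v], [theta] is congruent to an
    integer modulo [(v, g)]. *)
Lemma gel_descent (S P : Z) (k g : O6) (v : Z) : gel S P = k * g -> nm g = v ^+ 7 -> v != 0 ->
  comax P v -> exists e x, divides e 1 /\ g = e * x ^+ 7.
Proof.
move=> eg ng v0 [p [q e]].
apply: (@seventh_power_descent _ v (- (p * (S - 2 * P)))%R v0 ng).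
exists (cst q * th), (cst p * k); rewrite -[cst p * k * g]mulrA -eg /gel /kap.
rewrite (rmorphN cst) !(rmorphM cst, rmorphB cst) /=.
have e1 : cst q * cst v = 1 - cst p * cst P.
  by rewrite -!(rmorphM cst) -[1]/(cst 1) -(rmorphB cst) -e; congr cst; ring.
transitivity (cst p * (cst S - (cst 2 - th) * cst P) + th * (cst q * cst v)); last by ring.
by rewrite e1; ring.
Qed.

(** * Properties of [g] for coprime [a] and [b] *)

Section Coprime.
Variables a b : Z.
Hypothesis cab : comax a b.
Let S : Z := (a + b) ^+ 2.
Let P : Z := (a * b)%R.

Lemma comax_sum_prod : comax (a + b) P.
Proof.
have [p [q e]] := cab; apply: comaxM.
  by exists q, (p - q); rewrite -e; ring.
by exists p, (q - p); rewrite -e; ring.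
Qed.

Lemma comax_S_P : comax S P.
Proof. by apply: comax_sym; apply: comaxX; apply: comax_sym; exact: comax_sum_prod. Qed.

Lemma comax_P_norm : comax P (normP S P).
Proof. by apply: comax_eqmod (normP_modP S P) _; apply/comaxX/comax_sym/comax_S_P. Qed.

Lemma sum_prod_parity :
  (divides 2 (S - 1) /\ divides 2 P) \/ (divides 2 (a + b) /\ divides 2 (P - 1)).
Proof.
have par (x : Z) : exists y : Z, x = 2 * y \/ x = 2 * y + 1.
  by exists (Z.div x 2); have := Z.div_mod x 2; have := Z.mod_pos_bound x 2; lia.
have [p [q e]] := cab; have [x [ex|ex]] := par a; have [y [ey|ey]] := par b.
- have : 2 * (p * x + q * y) = 1 by rewrite -[RHS]e ex ey; ring.
  by move: (p * x + q * y) => z ez; lia.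
- left; split; last by exists (x * b); rewrite /P ex; ring.
  by exists (2 * (x + y) ^+ 2 + 2 * (x + y)); rewrite /S ex ey; ring.
- left; split; last by exists (a * y); rewrite /P ey; ring.
  by exists (2 * (x + y) ^+ 2 + 2 * (x + y)); rewrite /S ex ey; ring.
- right; split; first by exists (x + y + 1); rewrite ex ey; ring.
  by exists (2 * x * y + x + y); rewrite /P ex ey; ring.
Qed.

Lemma comax_2_norm : comax 2 (normP S P).
Proof.
have odd (x : Z) : divides 2 (x - 1) -> comax 2 x.
  by case=> y e; exists (- y), 1; rewrite -[RHS](subKr x) e; ring.
case: sum_prod_parity => -[hS hP].
  by apply: comax_eqmod (eqmod_weak hP (normP_modP S P)) _; apply/comaxX/odd.
apply: comax_eqmod (eqmod_weak _ (normP_mod S P)) _; first by apply: divides_expS hS _.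
by apply: comaxM; [exists (- 6), 1; ring|apply/comaxX/odd].
Qed.

Lemma gel_odd : divides 2 (S - 1) -> divides 2 P -> eqmod (cst 2) (gel S P) (th ^+ 0).
Proof.
case=> s es [p ep]; exists (cst s - kap * cst p); rewrite /gel expr0.
transitivity (cst (S - 1) - kap * cst P); first by rewrite (rmorphB cst) rmorph1; ring.
by rewrite es ep !(rmorphM cst) /=; ring.
Qed.

Lemma gel_even : divides 2 (a + b) -> divides 2 (P - 1) -> eqmod (cst 2) (gel S P) (th ^+ 1).
Proof.
case=> s es [p ep]; exists (cst (s * (a + b)) - cst P + th * cst p); rewrite /gel expr1 /kap.
transitivity (cst S - cst 2 * cst P + th * cst (P - 1)); first by rewrite (rmorphB cst) rmorph1;
  ring.
have -> : S = 2 * (s * (a + b)) by rewrite /S expr2 {1}es; ring.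
by rewrite ep !(rmorphM cst) /=; ring.
Qed.

Lemma not_divides_P (p : nat) : prime p -> divides (Z.of_nat p) (a + b) ->
  ~ Z.divide (Z.of_nat p) P.
Proof.
move=> pp ps /dividesZP pP; have [x [y e]] := comax_sum_prod.
have [z ez] : divides (Z.of_nat p) 1.
  by rewrite -e; apply: divides_add; apply: divides_mull.
have := f_equal Z.abs_nat ez; rewrite (abs_natM (Z.of_nat p) z) Zabs2Nat.id => /esym/eqP.
by rewrite muln_eq1 => /andP[/eqP p1 _]; rewrite p1 in pp.
Qed.

(** Modulo 49, [g] is [kap] times the integer [- P], whose logarithm is an integer. *)
Lemma gel_log_7 : divides 7 (a + b) -> ~ Z.divide 7 (normP S P) /\
  exists m, lamr (gel S P) (lkap + cst m).
Proof.
move=> h7; have nP := @not_divides_P 7 isT h7.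
have [s es] : divides 49 S by rewrite [X in divides X _](_ : _ = 7 ^+ 2) //; apply: divides_exp.
split.
  move/dividesZP => h; have /dividesZP : divides 7 (13 * P ^+ 6).
    apply: eqmod_divides h; apply: eqmod_sym; apply: eqmod_weak (normP_mod S P).
    by exists (7 * s); rewrite es; ring.
  case/(@zdivides_prime 7 _ _ isT) => [[z ez]|/(@zdivides_primeX 7 _ _ isT)//].
  by move: ez; rewrite -[13]/(Zpos 13); lia.
have [m hm] : exists k, lamr (cst (- P)) (cst k).
  by apply: lamr_cst => -[z ez]; apply: nP; exists (- z); move: ez; rewrite -[- P]/(Z.opp P); lia.
exists m; apply: lamr_eqmod (lamrM lamr_kap hm); exists (- cst s).
by rewrite /gel es (rmorphM cst) (rmorphN cst) /=; ring.
Qed.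

End Coprime.

(** Modulo 7, [ell] is 1 at [lkap] and 0 at integers, the value that goes with [a + b] even. *)
Lemma ell_lkap m : ~ Z.divide 7 (ell (lkap + cst m) - 0)%R.
Proof.
have e : ell (lkap + cst m) = (7 * (5 - 2 * m) + 1)%R.
  rewrite ellD /ell /lkap.
  by cbv beta iota delta [cst x0_ x1_ x2_ x3_ x4_ x5_]; lia.
by rewrite e; move: (5 - 2 * m)%R => t [z]; lia.
Qed.

Lemma good_unit_pow7 z e x : divides e 1 -> z = e * x ^+ 7 -> comax (cst 2) z -> good z.
Proof.
move=> ue ez c2; rewrite ez; apply: goodM (good_unit ue) (good_pow7 _).
by apply: comax_divides c2; exists (e * x ^+ 6); rewrite ez exprS; ring.
Qed.

(** * The case where 13 does not divide [a + b] *)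

(* [hunit = kap ^ 6 / 13] and [wunit = sg kap / kap]. *)
Definition hunit : O6 := MkO (-132) (-33) (-66) (-72) (-88) (-71).
Definition hunitV : O6 := MkO (-1587) (-5983) (-18751) (-24197) (-12178) (-27271).
Definition wunit : O6 := cst 2 + th.
Definition wunitV : O6 := MkO (-6) (-1) (-2) (-4) (-5) (-3).
Definition w1unitV : O6 := MkO 0 (-1) 0 (-1) 0 0.

Lemma hunit_mulV : hunit * hunitV = 1. Proof. by vm_compute. Qed.
Lemma wunit_mulV : wunit * wunitV = 1. Proof. by vm_compute. Qed.
Lemma w1unit_mulV : (wunit - 1) * w1unitV = 1. Proof. by vm_compute. Qed.
Lemma sg_kap : sg kap = kap * wunit. Proof. by vm_compute. Qed.
Lemma sg_hunit : sg hunit = wunit ^+ 6 * hunit. Proof. by vm_compute. Qed.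
(** Modulo 7, [6 lkap] is [- lkap] and the logarithm of 13 is an integer. *)
Lemma lamr_hunit : lamr hunit (- lkap + cst 5).
Proof. by apply: lamr_check; vm_compute. Qed.

(** The factor [hunit] cancels the logarithm of [kap], so that of the unit [e hunit] is an integer
    and Kummer's lemma applies. *)
Lemma gel_hunit (g e x : O6) m : comax (cst 7) g -> lamr g (lkap + cst m) ->
  divides e 1 -> g = e * x ^+ 7 -> exists B, divides B g /\ hunit * g = B ^+ 7.
Proof.
move=> c7 lg ue eg; have [y ly] := lamr_ex (comax_unit_r (cst 7) ue).
have := lamrM ly (lamr0 x); rewrite -eg addr0 => lg'.
have le := lamr_eqmod7 (lamr_uniq c7 lg' lg) ly.
have := lamrM le lamr_hunit.
have -> : lkap + cst m + (- lkap + cst 5) = cst (m + 5) by rewrite (rmorphD cst); ring.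
have uh : divides (e * hunit) 1.
  by rewrite -[1]mulr1; apply: divides_mul ue _; exists hunitV; rewrite hunit_mulV.
case/(kummer uh) => z [_ ez]; exists (z * x).
have hB : hunit * g = (z * x) ^+ 7 by rewrite exprMn -ez eg; ring.
split=> //; exists (hunitV * (z * x) ^+ 6).
rewrite mulrCA -exprS -hB mulrA [hunitV * _]mulrC hunit_mulV; ring.
Qed.

Lemma sg_gel (S P : Z) : sg (gel S P) = cst S - kap * wunit * cst P.
Proof.
rewrite -[LHS]/(iter 1 sg (cst S - kap * cst P)) iter_sgB iter_sgM !iter_sg_cst.
by rewrite -sg_kap.
Qed.

(** The difference [g - sg g] is [kap (wunit - 1) P], where [wunit - 1] is a unit, and [g] is [S]
    modulo both [kap] and [P]. *)
Lemma comax_gel_sg (S P : Z) : comax S 13 -> comax S P -> comax (gel S P) (sg (gel S P)).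
Proof.
move=> c13 cSP; suff [p [q e]] : comax (gel S P) (kap * ((wunit - 1) * cst P)).
  by exists (p + q), (- q); rewrite -e sg_gel /gel; ring.
apply: comaxM; last apply: comaxM.
- apply: comax_sym; apply: (@comax_eqmod _ _ _ (cst S)).
    by exists (- cst P); rewrite /gel; ring.
  apply: comax_sym; apply: comax_divides kap_divides_13 _; exact: comax_cst.
- by apply: comax_unit_r; exists w1unitV; rewrite w1unit_mulV.
apply: comax_sym; apply: (@comax_eqmod _ _ _ (cst S)).
  by exists (- kap); rewrite /gel; ring.
by apply: comax_sym; apply: comax_cst.
Qed.

Lemma case_7_divides (S P u : Z) B : S = 9 * u ^+ 14 -> u != 0 -> Z.divide 7 u ->
  comax S 13 -> comax S P -> divides B (gel S P) -> hunit * gel S P = B ^+ 7 -> False.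
Proof.
move=> eS u0 u7 c13 cSP Bg hB.
have uE : (wunit - 1) * sg hunit * (w1unitV * sg hunitV) = 1.
  have e : sg hunit * sg hunitV = 1 by vm_compute.
  transitivity ((wunit - 1) * w1unitV * (sg hunit * sg hunitV)); first by ring.
  by rewrite w1unit_mulV e mulr1.
(* From [sg hunit = wunit ^ 6 hunit] and [wunit g - sg g = (wunit - 1) S], where [P] has
   cancelled. *)
have eXY : (wunit * B) ^+ 7 - sg B ^+ 7 = cst (9 * u ^+ 14) * ((wunit - 1) * sg hunit).
  have -> : sg B ^+ 7 = sg hunit * sg (gel S P).
    by rewrite -[LHS]/(iter 1 sg B ^+ 7) -iter_sgX -hB iter_sgM.
  rewrite exprMn -hB sg_gel sg_hunit -eS /gel.
  by move: wunit hunit kap => w h k; ring.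
have cXY : comax (wunit * B) (sg B).
  apply: comax_sym; apply: comaxM.
    by apply: comax_unit_r; exists wunitV; rewrite wunit_mulV.
  apply: comax_divides (Bg) _; apply: comax_sym.
  apply: (@comax_divides _ _ (sg (gel S P))); first exact: (iter_sg_divides 1 Bg).
  exact: comax_gel_sg.
have [T eT] := XY_mod7 u7 eXY.
apply: (@second_descent _ _ _ _ u u0 uE eXY cXY T eT).
  have h1 := eqmod_res B; have := eqmod_res (sg B); have /= -> := res_iter_sg 1 B => h2.
  have w4 : eqmod kap wunit 4.
    exists (-1); rewrite /wunit /kap; have -> : (4 : O6) = cst 2 + cst 2 by [].
    by ring.
  by apply: eqmodM w4 (eqmod_trans h1 (eqmod_sym h2)).
have /= -> := res_iter_sg 1 B => h13.
have kB : divides kap B.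
  apply: eqmod_divides (eqmod_res B) _; apply: divides_trans kap_divides_13 _.
  exact: divides_cst.
have [y ey] := divides_trans kB Bg.
have /kap_divides_cst/dividesZP [z ez] : divides kap (cst S).
  by exists (y + cst P); rewrite mulrDr -ey /gel; ring.
case: c13 => p [q]; rewrite ez => e; have : 13 * (p * z + q) = 1 by rewrite -[RHS]e; ring.
by move: (p * z + q) => t; rewrite -[13]/(Zpos 13); lia.
Qed.

Lemma notin_0 (x : Z) : Z.modulo x 7 \notin [:: 0] -> ~ Z.divide 7 (x - 0)%R.
Proof.
move=> h [z ez]; move/negP: h; apply; rewrite inE; apply/eqP; rewrite subr0 in ez.
by rewrite ez; apply: Z.mod_mul.
Qed.

(** Transfers divisibility by 3 from [a ^ 13 + b ^ 13] to [a + b]. *)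
Lemma exp13_mod3 (x : Z) : Z.divide 3 (x ^+ 13 - x)%R.
Proof.
have [k ek] : Z.divide 3 (x ^+ 3 - x)%R.
  apply: (@divides_cst_inj 3).
  by have := @fermat_Z 3 x isT; rewrite /eqmod -(rmorphXn cst) -(rmorphB cst).
exists (k * (x ^+ 10 + x ^+ 8 + x ^+ 6 + x ^+ 4 + x ^+ 2 + 1))%R.
transitivity ((x ^+ 3 - x) * (x ^+ 10 + x ^+ 8 + x ^+ 6 + x ^+ 4 + x ^+ 2 + 1)); first by ring.
by rewrite ek; move: (_ + 1)%R => t; lia.
Qed.

Lemma divides_pow7_prime (p : nat) (k m u : Z) : prime p -> ~ Z.divide (Z.of_nat p) m ->
  divides (Z.of_nat p) k -> m * u ^+ 7 = k -> Z.divide (Z.of_nat p) u.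
Proof.
move=> pp pm /dividesZP pk e; rewrite -e in pk.
by case: (zdivides_prime pp pk) => // /(zdivides_primeX pp).
Qed.

(** * The equation with [a + b = 3 w], and its two consequences *)

Section Equation.
Variables a b w c : Z.
Hypothesis cab : comax a b.
Hypothesis c0 : c != 0.
Hypothesis ew : a + b = 3 * w.
Let S : Z := (a + b) ^+ 2.
Let P : Z := (a * b)%R.
Hypothesis ec : w * normP S P = c ^+ 7.

Lemma w_neq0 : w != 0.
Proof.
by apply/eqP => w0; have /esym/eqP := ec; rewrite w0 mul0r expf_eq0 (negPf c0).
Qed.

Lemma normP_neq0 : normP S P != 0.
Proof.
by apply/eqP => n0; have /esym/eqP := ec; rewrite n0 mulr0 expf_eq0 (negPf c0).
Qed.

Lemma divides_w_sum : divides w (a + b).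
Proof. by exists 3; rewrite ew mulrC. Qed.

Lemma thirteen_divides : Z.divide 13 (a + b)%R.
Proof.
case: (Zdivide_dec 13 (a + b)%R) => // n13; exfalso.
have c13 := comax_sym (@comax_prime 13 _ isT n13).
have cwN : comax w (normP S P).
  apply: comax_sym; apply: comax_divides divides_w_sum _; apply: comax_sym.
  apply: (@comax_eqmod _ _ _ (13 * P ^+ 6)).
    by apply: eqmod_weak (normP_mod S P); apply: divides_expS (divides_refl _) _.
  by apply: comaxM c13 _; apply/comaxX/comax_sum_prod.
have [u eu] := Z_coprime_pow7 w_neq0 cwN ec.
have [v ev] : exists v, normP S P = v ^+ 7.
  by apply: (Z_coprime_pow7 normP_neq0 (comax_sym cwN)); rewrite mulrC ec.
have u0 : u != 0 by have := w_neq0; rewrite eu expf_eq0.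
have v0 : v != 0 by have := normP_neq0; rewrite ev expf_eq0.
have cPv : comax P v.
  by apply: comax_divides (comax_P_norm cab); rewrite -/S -/P ev;
    apply: divides_expS (divides_refl _) _.
have [e [x [ue eg]]] : exists e x, divides e 1 /\ gel S P = e * x ^+ 7.
  by apply: (@gel_descent S P 1 _ v); rewrite ?mul1r ?nm_gel.
have gg : good (gel S P).
  by apply: good_unit_pow7 ue eg _; apply: comax_gel; apply: comax_2_norm.
have ell_parity y : comax (cst 7) (gel S P) -> lamr (gel S P) y ->
    Z.divide 7 (ell y - 0)%R \/ Z.divide 7 (ell y - 1)%R.
  move=> c7 ly; case: (sum_prod_parity cab) => -[h1 h2]; [left|right].
    exact: (@good_ell 0 _ _ isT gg c7 ly (gel_odd h1 h2)).
  exact: (@good_ell 1 _ _ isT gg c7 ly (gel_even h1 h2)).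
case: (Zdivide_dec 7 u) => u7; last first.
  have [n7 hy] := log_tableP (b := b) (a := a) log_table_B u7 (ltac:(by rewrite ew eu;
    apply: eqmod_refl)).
  have c7 := comax_gel (@comax_prime 7 _ isT n7).
  have v7 : ~ Z.divide 7 v.
    move=> /dividesZP h; apply: n7; apply/dividesZP.
    by rewrite -/S -/P ev; apply: divides_expS h _.
  have [y ly] : exists2 y, lamr (gel S P) y & Z.modulo (ell y) 7 \notin [:: 0; 1].
    by apply: hy; rewrite -/S -/P ev; apply: (pow7_mod49 v7).1.
  case: (ell_parity y c7 ly) => -[z ez]; rewrite !inE => /negP; apply; apply/orP.
    by left; apply/eqP; rewrite subr0 in ez; rewrite ez; apply: Z.mod_mul.
  right; apply/eqP; have -> : ell y = Z.add 1 (Z.mul z 7) by move: ez; lia.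
  by rewrite Z.mod_add.
have h7 : divides 7 (a + b).
  by rewrite ew eu; apply: divides_mull; apply: divides_expS => //; apply/dividesZP.
have [n7 [m lm]] := gel_log_7 cab h7.
have c7 := comax_gel (@comax_prime 7 _ isT n7).
have [B [Bg hB]] := gel_hunit c7 lm ue eg.
apply: (@case_7_divides S P u B _ u0 u7 _ (comax_S_P cab) Bg hB).
  by rewrite /S ew eu; ring.
by apply: comax_sym; apply: comaxX; apply: comax_sym.
Qed.

Lemma four_divides : Z.divide 13 (a + b)%R -> Z.divide 4 (a + b)%R.
Proof.
case=> s es; have {}es : a + b = 13 * s by rewrite es; lia.
have [M eM] := normP_mod S P; pose q : Z := (P ^+ 6 + 13 * s ^+ 2 * M)%R.
have eN : normP S P = 13 * q.
  by rewrite -[LHS](subrK (13 * P ^+ 6)) eM /q /S es; ring.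
have d13 : divides 13 (a + b) by exists s.
have cq13 : comax 13 q.
  apply: (@comax_eqmod _ _ _ (P ^+ 6)); first by exists (s ^+ 2 * M); rewrite /q; ring.
  apply: comaxX; apply: comax_sym; apply: comax_divides d13 _; apply: comax_sym.
  exact: comax_sum_prod.
have cwq : comax w q.
  apply: (@comax_eqmod _ _ _ (P ^+ 6)).
    exists (3 * s * M); transitivity (13 * s * (s * M)); first by rewrite /q; ring.
    by rewrite -es ew; ring.
  apply: comaxX; apply: comax_sym; apply: comax_divides divides_w_sum _; apply: comax_sym.
  exact: comax_sum_prod.
have cq : comax (13 * w) q.
  by apply: comax_sym; apply: comaxM; apply: comax_sym.
have ec' : 13 * w * q = c ^+ 7 by rewrite -ec eN; ring.
have q0 : q != 0 by have := normP_neq0; rewrite eN mulf_eq0 negb_or => /andP[].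
have [u eu] := Z_coprime_pow7 (mulf_neq0 (isT : 13 != 0 :> Z) w_neq0) cq ec'.
have [v ev] : exists v, q = v ^+ 7.
  by apply: (Z_coprime_pow7 q0 (comax_sym cq)); rewrite mulrC ec'.
have v0 : v != 0 by have := q0; rewrite ev expf_eq0.
have vN : divides v (normP S P).
  by rewrite eN ev; apply: divides_mull; apply: divides_expS (divides_refl _) _.
have cPv : comax P v by apply: comax_divides vN (comax_P_norm cab).
have [k ek] := kap_divides_13.
pose g := k * cst (13 * s ^+ 2) - cst P.
have eg : gel S P = kap * g.
  rewrite /gel /g mulrBr mulrA -ek -(rmorphM cst); congr (cst _ - _).
  by rewrite /S es; ring.
have ng : nm g = v ^+ 7.
  have h : nm kap * nm g = 13 * q by rewrite -nmM -eg nm_gel.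
  by rewrite nm_kap ev in h; exact: (mulfI (isT : 13 != 0 :> Z) h).
have [e [x [ue ex]]] := gel_descent eg ng v0 cPv.
have c2 : comax (cst 2) (gel S P) by apply: comax_gel; apply: comax_2_norm.
have gg : good (gel S P).
  rewrite eg; apply: goodM good_kap _; apply: good_unit_pow7 ue ex _.
  by apply: comax_divides c2; exists kap; rewrite eg mulrC.
have e13 : 13 * (a + b) = 3 * u ^+ 7 by rewrite -eu ew; ring.
have [c7 [y ly y0]] : comax (cst 7) (gel S P) /\
    exists2 y, lamr (gel S P) y & ~ Z.divide 7 (ell y - 0)%R.
  case: (Zdivide_dec 7 u) => u7.
    have h7 : divides 7 (a + b).
      have : divides 7 (13 * (a + b)).
        by rewrite e13; apply: divides_mull; apply: divides_expS => //; apply/dividesZP.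
      by apply: comax_Gauss; exists 2, (-1); ring.
    have [n7 [m lm]] := gel_log_7 cab h7.
    split; first exact: comax_gel (@comax_prime 7 _ isT n7).
    by exists (lkap + cst m) => //; apply: ell_lkap.
  have h4 : eqmod 49 (a + b) (4 * u ^+ 7).
    have e1 : 13 * (a + b - 4 * u ^+ 7) = - (49 * u ^+ 7) by rewrite mulrBr e13; ring.
    (* 34 is the inverse of 13 modulo 49: their product is [1 + 9 * 49]. *)
    exists (- (34 * u ^+ 7) - 9 * (a + b - 4 * u ^+ 7)).
    transitivity (34 * (13 * (a + b - 4 * u ^+ 7)) - 441 * (a + b - 4 * u ^+ 7)); first by ring.
    by rewrite e1; ring.
  have [n7 hy] := log_tableP log_table_A u7 h4.
  split; first exact: comax_gel (@comax_prime 7 _ isT n7).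
  have v7 : ~ Z.divide 7 v.
    by move=> /dividesZP h; apply: n7; apply/dividesZP; apply: divides_trans h vN.
  have [y ly hy'] : exists2 y, lamr (gel S P) y & Z.modulo (ell y) 7 \notin [:: 0].
    apply: hy; rewrite -/S -/P eN ev exprMn.
    rewrite -[X in eqmod _ _ X]mulr1; apply: eqmodM (eqmod_refl _ _) _.
    exact: (pow7_mod49 v7).1.
  by exists y => //; apply: notin_0.
case: (sum_prod_parity cab) => -[h1 h2].
  (* For [a + b] odd, [g] is 1 modulo 2 and [ell y] would be 0. *)
  by case: y0; apply: (@good_ell 0 _ _ isT gg c7 ly (gel_odd h1 h2)).
have [t et] : Z.divide 2 u.
  apply: (@divides_pow7_prime 2 (13 * (a + b))%R 3) => //; last exact: divides_mull.
  by case=> z; clear; lia.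
have : 13 * (a + b) = 384 * t ^+ 7 by rewrite e13 et -[Z.mul t 2]/(t * 2); ring.
move: (t ^+ 7) (a + b); clear => T A eT.
(* Here [A = 40 A - 39 A] and [39 A = 1152 T]. *)
by exists (10 * A - 288 * T)%R; lia.
Qed.

End Equation.

(** * Transfer from [int] to [Z] *)

Lemma comax_int_Z (a b : int) : coprimez a b -> comax (Z_of_int a) (Z_of_int b).
Proof.
move/eqP=> e; have [u [v h]] := Bezoutz a b; exists (Z_of_int u), (Z_of_int v).
by rewrite -!rmorphM -rmorphD h e.
Qed.

(** The thirteenth power of the gcd of [a] and [b] divides [3 c ^ 7] and is prime to [c], so it
    divides 3. *)
Lemma coprimez_of_equation (a b c : int) : gcdz (gcdz a b) c = 1 ->
  a ^+ 13 + b ^+ 13 = 3 * c ^+ 7 -> coprimez a b.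
Proof.
move=> hg he; set d := gcdz a b in hg *; rewrite /coprimez -/d.
have d13 : (d ^+ 13 %| 3 * c ^+ 7)%Z.
  by rewrite -he rpredD //; apply: dvdz_exp2r; rewrite ?dvdz_gcdl ?dvdz_gcdr.
have cd : coprimez (d ^+ 13) (c ^+ 7) by rewrite coprimez_pexpl // coprimez_pexpr // /coprimez hg.
rewrite Gauss_dvdzl // in d13.
have dE : d = `|d|%N by [].
have {}d13 : (`|d| ^ 13 %| 3)%N by have := d13; rewrite dvdzE abszX.
rewrite dE; move: `|d|%N d13 => [|[|n]] // /(@dvdn_leq _ 3 isT) h.
by have := leq_trans (ltn_expl 13 (isT : 1 < n.+2)%N) h.
Qed.

Lemma dvdz_of_Z (n m : int) : Z.divide (Z_of_int n) (Z_of_int m) -> (n %| m)%Z.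
Proof.
case=> z ez; apply/dvdzP; exists (int_of_Z z); apply: (can_inj Z_of_intK).
by rewrite rmorphM /= int_of_ZK.
Qed.

Theorem theorem4p1 (a b c : int)
    (habc : a * b * c != 0)
    (hgcd : gcdz (gcdz a b) c = 1)
    (heq : a ^+ 13 + b ^+ 13 = 3 * c ^+ 7) :
  (13 %| a + b)%Z /\ (4 %| a + b)%Z.
Proof.
have cab := comax_int_Z (coprimez_of_equation hgcd heq).
have c0 : Z_of_int c != 0.
  have: c != 0 by apply: contraNneq habc => ->; rewrite mulr0.
  by apply: contra_neq => h; apply: (can_inj Z_of_intK).
have eab : Z_of_int (a + b) = Z_of_int a + Z_of_int b := rmorphD Z_of_int a b.
have e : Z_of_int a ^+ 13 + Z_of_int b ^+ 13 = 3 * Z_of_int c ^+ 7.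
  have := f_equal Z_of_int heq; rewrite (rmorphD Z_of_int) !(rmorphXn Z_of_int) => ->.
  by rewrite (rmorphM Z_of_int) !(rmorphXn Z_of_int).
move: (Z_of_int a) (Z_of_int b) (Z_of_int c) eab cab c0 e => A B C eab cab c0 e.
have [w ew] : divides 3 (A + B).
  have : divides 3 (A ^+ 13 + B ^+ 13) by rewrite e; exists (C ^+ 7).
  have /dividesZP hA := exp13_mod3 A; have /dividesZP hB := exp13_mod3 B.
  move=> h; have := divides_add h (divides_opp (divides_add hA hB)).
  by congr divides; ring.
have ec : w * normP ((A + B) ^+ 2) (A * B)%R = C ^+ 7.
  apply: (mulfI (isT : 3 != 0 :> Z)); rewrite -e -normP_sum mulrA ew.
  by [].
have h13 := thirteen_divides cab c0 ew ec.
split; apply: dvdz_of_Z; rewrite eab //.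
exact: (four_divides cab c0 ew ec h13).
Qed.
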